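(* Let $k$ be a positive integer, $\ell\in\{1,\dots,k\}$, and let $\mu,\nu$ be partitions such that $\lambda=(\mu,\nu)$ is a partition with $\lambda_1\le k$ and $\mu_{\ell(\mu)}>\ell\geq\nu_1$. Then \[ B_{\ell^{k+1-\ell}}\, s^{(k)}_\lambda[X;t] = t^{|\mu|-\ell(\mu)\,\ell}\, s^{(k)}_{(\ell^{k+1-\ell})\cup\lambda}[X;t]. \]
   Context: For $n\in\mathbb Z$, $B_n=\sum_{i\ge0}s_{i+n}[X]\,s_i[X(t-1)]^\perp$ acting on symmetric functions over $\mathbb Q(q,t)$ ($f^\perp$ adjoint to multiplication by $f$ for the Hall scalar product; $s_i[X(t-1)]$ the plethystic substitution $p_n\mapsto(t^n-1)p_n$); for a partition $\rho$ of length $L$, $B_\rho=\prod_{1\le a<b\le L}(1-te_{ab})B_{\rho_1}\cdots B_{\rho_L}$ with $e_{ab}$ raising the $a$-th index by one and lowering the $b$-th by one. $\Lambda^{(k)}_t$ is the span of $H_\rho[X;t]=B_{\rho_1}\cdots B_{\rho_{\ell(\rho)}}\cdot1$ with $\rho_1\le k$. Main hook-length $h_M(\rho)=\rho_1+\ell(\rho)-1$. $k$-split: for $\rho_1\le k$, $\rho^{\to k}=(\rho^{(1)},\dots,\rho^{(s)})$ cuts $\rho$ (without rearranging, from the largest parts) into consecutive blocks of rows with $h_M(\rho^{(i)})=k$ for $i<s$. The $k$-split polynomials $G^{(k)}_{()}=1$, $G^{(k)}_\rho=B_{\rho^{(1)}}G^{(k)}_{(\rho^{(2)},\dots)}$ ($\rho_1\le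 k$) form a basis of $\Lambda^{(k)}_t$; $T^{(k)}_j$ is the linear operator with $T^{(k)}_jG^{(k)}_\rho=G^{(k)}_\rho$ if $\rho_1=j$ and $0$ otherwise. The $k$-Schur functions are defined recursively for $k$-bounded partitions by $s^{(k)}_{()}=1$ and $s^{(k)}_\rho[X;t]=T^{(k)}_{\rho_1}B_{\rho_1}s^{(k)}_{(\rho_2,\rho_3,\dots)}[X;t]$. $(\ell^{k+1-\ell})\cup\lambda$ is the partition obtained by rearranging into weakly decreasing order the parts of $\lambda$ together with $k+1-\ell$ parts equal to $\ell$; $(\mu,\nu)$ is concatenation. *)

(* Defs.v *)
From HB Require Import structures.
From mathcomp Require Import all_boot all_order all_algebra.
From mathcomp Require Import finmap.
From mathcomp Require Import monalg.
From Stdlib Require Import ClassicalEpsilon.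

Set Implicit Arguments.
Unset Strict Implicit.
Unset Printing Implicit Defensive.

Import GRing.Theory.
Local Open Scope ring_scope.

(* Symmetric functions over a field F of characteristic 0 are represented in
   the power-sum generators: they form the polynomial ring F[p_1, p_2, ...].
   Variables are indexed by nat with a shift: the variable i is p_(i+1).  Thus
   a monomial m is the power sum p_lambda of the partition lambda having m i
   parts equal to i+1. *)
Definition sym (F : fieldType) := {malg F[{cmonom nat}]}.

Definition psum (F : fieldType) (n : nat) : sym F := << ucm n.-1 >>.

(* the size |lambda| *)
Definition wgt (m : {cmonom nat}) : nat := \sum_(i <- finsupp m) m i * i.+1.

Definition sdeg (F : fieldType) (g : sym F) : nat := \max_(m <- msupp g) wgt m.

(* z_lambda = \prod_i i^(m_i) m_i! *)
Definition zee (m : {cmonom nat}) : nat :=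
  \prod_(i <- finsupp m) (i.+1 ^ m i * (m i)`!).

(* Hall scalar product: <p_lambda, p_mu> = z_lambda if lambda = mu, else 0 *)
Definition hall (F : fieldType) (f g : sym F) : F :=
  \sum_(m <- msupp f) f@_m * g@_m * (zee m)%:R.

(* f^perp g, expanded on the orthogonal basis of the power sums p_c.  Only the
   monomials c = b / a below can contribute; see hall_perp for adjointness. *)
Definition perp (F : fieldType) (f g : sym F) : sym F :=
  [malg c in [fset divcm b a | b in msupp g, a in msupp f]%fset =>
     hall g (f * << c >>) / (zee c)%:R].

Lemma malgUE (F : fieldType) (x : F) (c : {cmonom nat}) :
  << x *g c >> = x *: << c >> :> sym F.
Proof.
apply/malgP => m; rewrite mcoeffZ [LHS]mcoeffU [X in _ * X]mcoeffU.
by rewrite mulrnAr mulr1.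
Qed.

Lemma hallEw (F : fieldType) (f g : sym F) (d : {fset {cmonom nat}}) :
  fsubset (msupp f) d -> hall f g = \sum_(m <- d) f@_m * g@_m * (zee m)%:R.
Proof.
move=> sub; rewrite /hall (big_fset_incl _ sub) //= => m _ /mcoeff_outdom ->.
by rewrite !mul0r.
Qed.

Lemma hallC (F : fieldType) (f g : sym F) : hall f g = hall g f.
Proof.
rewrite (hallEw g (fsubsetUl (msupp f) (msupp g))).
rewrite (hallEw f (fsubsetUr (msupp f) (msupp g))).
by apply: eq_bigr => m _; rewrite (mulrC f@_m).
Qed.

Lemma hallDr (F : fieldType) (f g h : sym F) :
  hall f (g + h) = hall f g + hall f h.
Proof.
by rewrite /hall -big_split; apply: eq_bigr => m _; rewrite mcoeffD mulrDr mulrDl.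
Qed.

Lemma hallZr (F : fieldType) (a : F) (f g : sym F) :
  hall f (a *: g) = a * hall f g.
Proof.
rewrite /hall big_distrr; apply: eq_bigr => m _ /=.
by rewrite mcoeffZ mulrCA !mulrA.
Qed.

Lemma hall_sumr (F : fieldType) (f : sym F) (I : Type) (s : seq I)
    (G : I -> sym F) :
  hall f (\sum_(i <- s) G i) = \sum_(i <- s) hall f (G i).
Proof.
elim: s => [|i s IH]; last by rewrite !big_cons hallDr IH.
by rewrite !big_nil /hall big1 // => m _; rewrite mcoeff0 mulr0 mul0r.
Qed.

Lemma zee_neq0 (F : fieldType) (m : {cmonom nat}) :
  [pchar F] =i pred0 -> (zee m)%:R != 0 :> F.
Proof.
move=> /pcharf0P ->; rewrite -lt0n /zee prodn_gt0 // => i.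
by rewrite muln_gt0 expn_gt0 fact_gt0.
Qed.

Lemma mcoeff_perp (F : fieldType) (f g : sym F) (c : {cmonom nat}) :
  (perp f g)@_c = hall g (f * << c >>) / (zee c)%:R.
Proof.
rewrite /perp mcoeffE; case: ifPn => // ncin.
rewrite /hall big1_seq ?mul0r // => m /andP[_ min].
rewrite mcoeffMl big1_seq ?mulr0 ?mul0r // => a /andP[_ ain].
rewrite msuppU1 big_seq_fset1 mcoeffUU.
case: eqP => [E|]; last by rewrite mulr0n.
case/negP: ncin; apply/imfset2P; exists m => //; exists a => //.
by apply/eqP/cmP => i; rewrite divcmE -E cmM addKn.
Qed.

Lemma hall_perp (F : fieldType) (f g h : sym F) :
  [pchar F] =i pred0 -> hall (perp f g) h = hall g (f * h).
Proof.
move=> F0; rewrite {2}[h]monalgE mulr_sumr hall_sumr hallC [LHS]/hall.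
apply: eq_bigr => c _; rewrite mcoeff_perp -mulrA mulfVK ?zee_neq0 //.
by rewrite (malgUE h@_c) -scalerAr hallZr.
Qed.

Definition cmon_of (n : nat) (c : {ffun 'I_n -> 'I_n.+1}) : {cmonom nat} :=
  \big[mmul/mone]_(i < n) expcmn (ucm (i : nat)) (c i).

(* s_n = h_n = \sum_(lambda |- n) p_lambda / z_lambda; c i is the multiplicity
   of the part i+1 in lambda *)
Definition hsym (F : fieldType) (n : nat) : sym F :=
  \sum_(c : {ffun 'I_n -> 'I_n.+1} | (\sum_i c i * i.+1)%N == n)
    << ((zee (cmon_of c))%:R)^-1 *g cmon_of c >>.

Definition hsymz (F : fieldType) (n : int) : sym F :=
  if n is Posz m then hsym F m else 0.

(* the F-algebra morphism sending p_n to phi n for n >= 1 *)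
Definition pleth (F : fieldType) (phi : nat -> sym F) (f : sym F) : sym F :=
  mmap (fun a : F => malgC a)
       (fun m : {cmonom nat} => \prod_(i <- finsupp m) phi i.+1 ^+ m i) f.

(* s_i[X(t-1)] *)
Definition hsymt (F : fieldType) (t : F) (i : nat) : sym F :=
  pleth (fun n => (t ^+ n - 1) *: psum F n) (hsym F i).

(* The terms of index i > deg g vanish; see BopE. *)
Definition Bop (F : fieldType) (t : F) (n : int) (g : sym F) : sym F :=
  \sum_(i < (sdeg g).+1) hsymz F (i%:Z + n) * perp (hsymt t i) g.

Lemma wgtEw (m : {cmonom nat}) (d : {fset nat}) :
  fsubset (finsupp m) d -> wgt m = \sum_(i <- d) m i * i.+1.
Proof.
move=> sub; rewrite /wgt (big_fset_incl _ sub) //= => i _.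
by rewrite -cmE_eq0 => /eqP ->.
Qed.

Lemma wgtM (a b : {cmonom nat}) : wgt (mmul a b) = (wgt a + wgt b)%N.
Proof.
rewrite (@wgtEw a (finsupp a `|` finsupp b)%fset) ?fsubsetUl //.
rewrite (@wgtEw b (finsupp a `|` finsupp b)%fset) ?fsubsetUr //.
rewrite /wgt mdomD -big_split; apply: eq_bigr => i _ /=.
by rewrite cmM mulnDl.
Qed.

Lemma wgt1 : wgt mone = 0%N.
Proof. by rewrite /wgt mdom1 big_seq_fset0. Qed.

Lemma wgtU i : wgt (ucm i) = i.+1.
Proof. by rewrite /wgt mdomU big_seq_fset1 cmUU mul1n. Qed.

Lemma expcmnS (m : {cmonom nat}) n : expcmn m n.+1 = mmul m (expcmn m n).
Proof.
case: n => [|n] //=; apply/eqP/cmP => i.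
by rewrite /expcmn /= cmM cm1 addn0.
Qed.

Lemma wgtX (m : {cmonom nat}) n : wgt (expcmn m n) = (n * wgt m)%N.
Proof.
by elim: n => [|n IH]; [rewrite wgt1 | rewrite expcmnS wgtM IH mulSn].
Qed.

Lemma wgt_cmon_of n (c : {ffun 'I_n -> 'I_n.+1}) :
  wgt (cmon_of c) = (\sum_i c i * i.+1)%N.
Proof.
rewrite /cmon_of; elim/big_rec2: _ => [|i y1 y2 _ <-]; first exact: wgt1.
by rewrite wgtM wgtX wgtU.
Qed.

(* all monomials of f have degree n *)
Definition homog (F : fieldType) n (f : sym F) :=
  forall m, m \in msupp f -> wgt m = n.

Lemma homogD (F : fieldType) n (f g : sym F) :
  homog n f -> homog n g -> homog n (f + g).
Proof.
by move=> hf hg m /(fsubsetP (msuppD_le _ _)); rewrite inE => /orP[/hf|/hg].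
Qed.

Lemma homogZ (F : fieldType) n a (f : sym F) : homog n f -> homog n (a *: f).
Proof. by move=> hf m /(fsubsetP (msuppZ_le _ _)) /hf. Qed.

Lemma homog0 (F : fieldType) n : homog n (0 : sym F).
Proof. by move=> m; rewrite msupp0. Qed.

Lemma homogU (F : fieldType) a (m : {cmonom nat}) :
  homog (wgt m) (<< a *g m >> : sym F).
Proof. by move=> k /(fsubsetP msuppU_le); rewrite inE => /eqP ->. Qed.

Lemma homogM (F : fieldType) n1 n2 (f g : sym F) :
  homog n1 f -> homog n2 g -> homog (n1 + n2) (f * g).
Proof.
move=> hf hg m /msuppM_le [a [b [/hf <- /hg <- ->]]]; exact: wgtM.
Qed.

Lemma homog_sum (F : fieldType) n (I : Type) (s : seq I) (P : pred I)
    (G : I -> sym F) :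
  (forall i, P i -> homog n (G i)) -> homog n (\sum_(i <- s | P i) G i).
Proof.
move=> h; elim/big_rec: _ => [|i x Pi hx]; first exact: homog0.
by apply: homogD => //; apply: h.
Qed.

Lemma homog_mono (F : fieldType) (phi : nat -> sym F) (m : {cmonom nat}) :
  (forall i, homog i.+1 (phi i.+1)) ->
  homog (wgt m) (\prod_(i <- finsupp m) phi i.+1 ^+ m i).
Proof.
move=> h; rewrite /wgt; elim/big_rec2: _ => [|i y1 y2 _ IH].
  by rewrite -[X in homog X]wgt1; apply: homogU.
apply: homogM => //; elim: (m i) => [|n IHn].
  by rewrite expr0 -[X in homog X]wgt1; apply: homogU.
by rewrite exprS mulSn; apply: homogM.
Qed.

Lemma homog_hsymt (F : fieldType) (t : F) i : homog i (hsymt t i).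
Proof.
rewrite /hsymt /pleth.
have hmon (m : {cmonom nat}) : wgt m = i -> homog i
    (\prod_(j <- finsupp m) ((t ^+ j.+1 - 1) *: psum F j.+1) ^+ m j).
  move=> <-; apply: (homog_mono (phi := fun n => (t ^+ n - 1) *: psum F n)).
  by move=> j; apply: homogZ; rewrite -[X in homog X](wgtU j); apply: homogU.
rewrite mmapE big_seq; apply: homog_sum => m min.
rewrite mul_malgC; apply: homogZ; apply: hmon.
suff hh : homog i (hsym F i) by apply: hh.
apply: homog_sum => c /eqP ci m' /homogU ->; by rewrite wgt_cmon_of.
Qed.

Lemma perp_eq0 (F : fieldType) n (f g : sym F) :
  homog n f -> (sdeg g < n)%N -> perp f g = 0.
Proof.
move=> hf gn; apply/malgP => c; rewrite mcoeff_perp mcoeff0 /hall.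
rewrite big1_seq ?mul0r // => m /andP[_ mg].
have [|/mcoeff_outdom ->] := boolP (m \in msupp (f * << c >>)); last first.
  by rewrite mulr0 mul0r.
case/msuppM_le => a [b [/hf an _ mE]].
have : (wgt m <= sdeg g)%N by apply: (leq_bigmax_seq (F := wgt)).
by rewrite mE wgtM an leqNgt (leq_trans gn) // leq_addr.
Qed.

Lemma BopE (F : fieldType) (t : F) (n : int) (g : sym F) (N : nat) :
  (sdeg g <= N)%N ->
  Bop t n g = \sum_(i < N.+1) hsymz F (i%:Z + n) * perp (hsymt t i) g.
Proof.
move=> gN; rewrite /Bop.
rewrite (big_ord_widen_cond N.+1 xpredT
  (fun i : nat => hsymz F (i%:Z + n) * perp (hsymt t i) g)) //.
rewrite big_mkcond /=; apply: eq_bigr => i _.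
case: ltnP => // gi; rewrite (perp_eq0 (n := i)) ?mulr0 //.
exact: homog_hsymt.
Qed.

Definition Bprod (F : fieldType) (t : F) (r : seq int) (f : sym F) : sym F :=
  foldr (Bop t) f r.

(* e_ab acting on the sequence of indices; a and b count from 0 *)
Definition raise (ab : nat * nat) (r : seq int) : seq int :=
  mkseq (fun i => r`_i + (i == ab.1)%:Z - (i == ab.2)%:Z) (size r).

Definition ltpairs (L : nat) : seq (nat * nat) :=
  [seq (a, b) | a <- iota 0 L, b <- iota a.+1 (L - a.+1)].

(* The factors (1 - t e_ab) act on the index of the family
   r |-> B_(r_1) ... B_(r_L) f. *)
Definition Bpart (F : fieldType) (t : F) (rho : seq nat) (f : sym F) : sym F :=
  foldr (fun ab (Phi : seq int -> sym F) r => Phi r - t *: Phi (raise ab r))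
        (fun r => Bprod t r f)
        (ltpairs (size rho)) (map Posz rho).

Definition is_part (rho : seq nat) : bool := sorted geq rho && (0%N \notin rho).

Definition kpart (k : nat) (rho : seq nat) : bool :=
  is_part rho && (head 0%N rho <= k)%N.

Definition part_union (mu nu : seq nat) : seq nat := sort geq (mu ++ nu).

Definition hook (rho : seq nat) : nat := head 0%N rho + size rho - 1.

(* A block starting with the part r has main hook-length k exactly when it has
   k + 1 - r rows; the last block may be shorter.  The first argument is fuel;
   size rho suffices, and ksplitP gives the characterization of the split. *)
Fixpoint ksplit_rec (n k : nat) (rho : seq nat) : seq (seq nat) :=
  if n is n'.+1 then
    if rho is r :: _ then
      take (k.+1 - r) rho :: ksplit_rec n' k (drop (k.+1 - r) rho)
    else [::]
  else [::].

Definition ksplit (k : nat) (rho : seq nat) : seq (seq nat) :=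
  ksplit_rec (size rho) k rho.

Lemma ksplit_recE n k r s : ksplit_rec n.+1 k (r :: s) =
  take (k.+1 - r) (r :: s) :: ksplit_rec n k (drop (k.+1 - r) (r :: s)).
Proof. by []. Qed.

Lemma ksplitP (k : nat) (rho : seq nat) : kpart k rho ->
  [/\ flatten (ksplit k rho) = rho, [::] \notin ksplit k rho,
      all (fun b => (hook b <= k)%N) (ksplit k rho)
    & forall i, (i.+1 < size (ksplit k rho))%N ->
        hook (nth [::] (ksplit k rho) i) = k].
Proof.
rewrite /ksplit => /andP[/andP[srt n0] hd].
have {n0 srt hd} al : all (fun r => 0 < r <= k)%N rho.
  apply/allP => x xin; rewrite lt0n; apply/andP; split.
    by apply: contraNneq n0 => <-.
  case: rho xin srt hd {n0} => // r s; rewrite inE => /predU1P[-> //|xs] /=.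
  rewrite path_sortedE; last by move=> a b c ab bc; apply: leq_trans bc ab.
  by case/andP => /allP /(_ _ xs) /= xr _ rk; apply: leq_trans rk.
have := leqnn (size rho); move: {-1}(size rho) => n.
elim: n rho al => [|n IH] [|r s] al sz; try by split; try by [].
have {}sz : (size s <= n)%N by [].
rewrite ksplit_recE.
have /andP[/andP[r0 rk] _] := al.
set d := (k.+1 - r)%N; have dE : d = (k - r).+1 by rewrite /d subSn.
have ald : all (fun r => 0 < r <= k)%N (drop d (r :: s)).
  by apply/allP => x /mem_drop xin; apply: (allP (al : all _ (r :: s))).
have szd : (size (drop d (r :: s)) <= n)%N.
  by rewrite size_drop dE /= subSS (leq_trans (leq_subr _ _)).
have [fl ne hk eqk] := IH _ ald szd.
have hookE : hook (take d (r :: s)) = (r + minn (k - r) (size s))%N.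
  by rewrite /hook dE /= size_take_min addnS subn1.
split.
- by rewrite -[LHS]/(take d (r :: s) ++ flatten _) fl cat_take_drop.
- by rewrite inE negb_or; apply/andP; split; [rewrite dE | exact: ne].
- apply/andP; split; last exact: hk.
  by rewrite hookE -[X in (_ <= X)%N](subnKC rk) leq_add2l geq_minl.
- case=> [|i] isz; last exact: eqk.
  rewrite [LHS]hookE; have [ks|sk] := leqP (k - r) (size s).
    by rewrite subnKC.
  move: isz; rewrite drop_oversize; first by case: (n).
  by rewrite dE; apply: ltnW.
Qed.

Definition Gsplit (F : fieldType) (t : F) (k : nat) (rho : seq nat) : sym F :=
  foldr (Bpart t) 1 (ksplit k rho).

Definition Hpoly (F : fieldType) (t : F) (rho : seq nat) : sym F :=
  Bprod t (map Posz rho) 1.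

Definition in_Lambdak (F : fieldType) (t : F) (k : nat) (f : sym F) : Prop :=
  exists2 s : seq (F * seq nat),
    all (fun x => kpart k x.2) s & f = \sum_(x <- s) x.1 *: Hpoly t x.2.

(* T is the linear operator T^(k)_j on Lambda^(k)_t.  It is extended by 0
   outside Lambda^(k)_t; these values are never used. *)
Definition is_Top (F : fieldType) (t : F) (k j : nat) (T : sym F -> sym F) :=
  [/\ forall (a : F) (f g : sym F), in_Lambdak t k f -> in_Lambdak t k g ->
        T (a *: f + g) = a *: T f + T g,
      forall rho, kpart k rho ->
        T (Gsplit t k rho) = if head 0%N rho == j then Gsplit t k rho else 0
    & forall f, ~ in_Lambdak t k f -> T f = 0].

(* Since the G^(k)_rho form a basis of Lambda^(k)_t, there is exactly one such
   operator. *)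
Definition Top (F : fieldType) (t : F) (k j : nat) : sym F -> sym F :=
  epsilon (inhabits (fun _ : sym F => 0)) (is_Top t k j).

Fixpoint kschur (F : fieldType) (t : F) (k : nat) (rho : seq nat) : sym F :=
  if rho is r :: rho' then Top t k r (Bop t r (kschur t k rho')) else 1.

(* Q(q,t), as the fraction field of Q[q][t]; tQ is the outer variable *)
Definition Qqt : fieldType := {fraction {poly {poly rat}}}.
Definition tQ : Qqt := tofrac 'X.

(* Main.v *)
Require Import Defs.
From mathcomp Require Import all_boot all_order all_algebra all_fingroup.
From mathcomp Require Import finmap monalg.
From mathcomp Require Import zify ring.
From Stdlib Require Import FunctionalExtensionality ClassicalEpsilon Classical.
Set Implicit Arguments.
Unset Strict Implicit.
Unset Printing Implicit Defensive.

(* The vertex operators satisfy the quadratic relation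
     B_m B_n - t B_(m+1) B_(n-1) = - (B_(n-1) B_(m+1) - t B_n B_m),
   which says that B_rho, as a function of the shifted indices rho_i - i, is
   antisymmetric.  Let R = (l^(k+1-l)).  Antisymmetry leaves only one term of
   the product in the commutation with a single row, whence
     B_R B_r = t^(r-l) B_r B_R   for l <= r <= k.
   For a block of main hook-length k with first part r > l, the exchange of
   B_R with the block is governed by a Vandermonde determinant; every term of
   its expansion is again a product of a block with first part r and a block
   with first part l.  Therefore B_R maps the span of the G_rho with first part
   r to that of the G_rho with first part max(r, l), and commutes with T_r for
   r > l on the vectors involved.  This moves B_R past every factor T_r B_r
   coming from a part r of mu, at the cost of t^(r-l).  When the parts of mu are
   used up, B_R s_nu = T_l B_R s_nu = T_l B_l^(k+1-l) s_nu, since the remaining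
   terms of B_R have first part larger than l, and T_l B_l = T_l B_l T_l on the
   vectors with first part at least l turns this into (T_l B_l)^(k+1-l) s_nu.
   That T_j exists, i.e. that the G_rho are linearly independent, follows by
   counting: the H_rho of weight at most n span the monomials in the power sums,
   and the G_rho are related to the H_rho by a unitriangular matrix. *)

Import Order.TTheory GRing.Theory.
Local Open Scope ring_scope.

(** * Newton's identity and the derivations dual to the power sums *)

(** When a block has parts below l, exchanging it with B_R may give several products of blocks, so
    spans with prescribed first part are followed instead of single vectors. The hook condition
    supplies the numbers: a block with first part r has k + 1 - r rows, hence R has exactly r - l
    rows more than a block with first part r > l, and this balance makes the exponents 0, ..., k - l
    of the determinant land on blocks of the same two shapes. The determinant arises because the
    exchange kernel, a product of factors e_b - t e_a, acts on a function antisymmetric both in the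
    indices a and in the indices b; multiplying by the Vandermonde products of the two groups then
    costs only a scalar, invertible since t <> 0 in characteristic 0. The quadratic relation goes
    back to B_m B_n being a combination of symmetric normally ordered products with the coefficients
    of (1 - z)/(1 - t z): the factor 1 - t z clears the denominator. From that relation on, the
    argument runs over an abstract module with operators B_n; multiplication returns only for linear
    independence. *)

Lemma derivation_ext (F : fieldType) (A : comAlgType F) (G : A -> Prop)
    (Gind : forall P : A -> Prop, (forall f g, P f -> P g -> P (f + g)) ->
      (forall x f, P f -> P (x *: f)) -> (forall a, G a -> P a) -> forall f, P f)
    (D : A -> A) (Dlin : linear D)
    (DG : forall a b, G a -> G b -> D (a * b) = D a * b + a * D b) f g :
  D (f * g) = D f * g + f * D g.
Proof.
have LD u v : D (u + v) = D u + D v by have := Dlin 1 u v; rewrite !scale1r.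
have L0 : D 0 = 0 by have := Dlin (-1) 0 0; rewrite scaler0 addr0 scaleN1r addNr.
have LZ x u : D (x *: u) = x *: D u by have := Dlin x u 0; rewrite L0 !addr0.
elim/Gind: f => [u v IHu IHv|x u IH|a Ga].
- by rewrite mulrDl !LD IHu IHv !mulrDl addrACA.
- by rewrite -scalerAl !LZ IH scalerDr -!scalerAl.
elim/Gind: g => [u v IHu IHv|x u IH|b Gb]; last exact: DG.
- by rewrite mulrDr !LD IHu IHv !mulrDr addrACA.
- by rewrite -scalerAr !LZ IH scalerDr -!scalerAr.
Qed.

Section Calculus.
Variables (F : fieldType) (F0 : [pchar F] =i pred0).
Implicit Types (f g h : sym F) (a b c m : {cmonom nat}).

Lemma hallDl f g h : hall (f + g) h = hall f h + hall g h.
Proof. by rewrite hallC hallDr !(hallC h). Qed.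

Lemma hallZl x f g : hall (x *: f) g = x * hall f g.
Proof. by rewrite hallC hallZr hallC. Qed.

Lemma perp_is_linear f : linear (perp f).
Proof.
move=> x g h; apply/malgP => c.
by rewrite mcoeffD mcoeffZ !mcoeff_perp hallDl hallZl mulrDl mulrA.
Qed.
Lemma perpDl f g h : perp (f + g) h = perp f h + perp g h.
Proof.
apply/malgP => c; rewrite mcoeffD [LHS]mcoeff_perp.
rewrite [X in _ = X + _]mcoeff_perp [X in _ = _ + X]mcoeff_perp.
by rewrite -[RHS]mulrDl -hallDr; congr (hall _ _ / _); exact: mulrDl.
Qed.

Lemma perpZl x f h : perp (x *: f) h = x *: perp f h.
Proof.
apply/malgP => c; rewrite mcoeffZ [LHS]mcoeff_perp.
rewrite [X in _ = _ * X]mcoeff_perp [RHS]mulrA -[in RHS]hallZr.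
by congr (hall _ _ / _); rewrite -scalerAl.
Qed.

Lemma perp0l h : perp (0 : sym F) h = 0.
Proof. by have := perpZl 0 0 h; rewrite scaler0 scale0r. Qed.

Lemma perp_suml (I : Type) (s : seq I) (P : pred I) (G : I -> sym F) h :
  perp (\sum_(i <- s | P i) G i) h = \sum_(i <- s | P i) perp (G i) h.
Proof.
elim: s => [|i s IH]; first by rewrite !big_nil perp0l.
by rewrite !big_cons; case: ifP => // _; rewrite perpDl IH.
Qed.

Lemma perpM f g h : perp (f * g) h = perp f (perp g h).
Proof.
apply/malgP => c; rewrite [LHS]mcoeff_perp [RHS]mcoeff_perp.
apply: (congr1 (fun x => x / (zee c)%:R)).
transitivity (hall h (g * (f * << c >>))); last exact/esym/hall_perp.
apply: (congr1 (hall h)).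
transitivity (f * (g * << c >>)); [exact/esym/mulrA | exact: mulrCA].
Qed.

Lemma hallUr g m : hall g << m >> = g@_m * (zee m)%:R.
Proof.
have [min|mnin] := boolP (m \in msupp g).
  rewrite /hall (big_fsetD1 _ min) /= big1_seq ?addr0.
    by rewrite mcoeffU1 eqxx mulr1.
  move=> a /andP[_]; rewrite !inE => /andP[am _].
  by rewrite mcoeffU1 eq_sym (negPf am) mulr0 mul0r.
rewrite (mcoeff_outdom mnin) mul0r /hall big1_seq // => a /andP[_ ain].
rewrite mcoeffU1; case: eqP => [E|_]; last by rewrite mulr0 mul0r.
by rewrite E ain in mnin.
Qed.

Lemma perp1 h : perp 1 h = h.
Proof.
apply/malgP => c; rewrite mcoeff_perp; transitivity (hall h << c >> / (zee c)%:R).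
  by apply: (congr1 (fun x => hall h x / (zee c)%:R)); apply: mul1r.
by rewrite hallUr mulfK ?zee_neq0.
Qed.

Lemma malgUM a b : << a >> * << b >> = << mmul a b >> :> sym F.
Proof.
transitivity (fgmul (<< a >> : sym F) << b >>); first exact: malgM_def.
by rewrite fgmulUU mulr1.
Qed.

Lemma zeeEw m (d : {fset nat}) : fsubset (finsupp m) d ->
  zee m = (\prod_(i <- d) (i.+1 ^ m i * (m i)`!))%N.
Proof.
move=> sub; rewrite /zee (big_fset_incl _ sub) //= => i _.
by rewrite -cmE_eq0 => /eqP ->; rewrite expn0 fact0.
Qed.

(** One more part [i.+1] multiplies z by (i+1)(m_i + 1); this ratio is what turns the adjoint of
    p_(i+1) into (i+1) d/dp_(i+1). *)
Lemma zee_ucmM i c : zee (mmul (ucm i) c) = (zee c * (i.+1 * (c i).+1))%N.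
Proof.
pose d := (i |` finsupp c)%fset.
have id : i \in d by rewrite !inE eqxx.
rewrite (@zeeEw _ d) ?(@zeeEw c d) ?fsubsetU1 //; last first.
  by rewrite mdomD mdomU.
rewrite (big_fsetD1 _ id) (big_fsetD1 (A := d) _ id) /= cmM cmUU add1n.
rewrite factS expnS.
rewrite (eq_big_seq (fun j => (j.+1 ^ c j * (c j)`!)%N)); last first.
  by move=> j; rewrite !inE => /andP[ji _]; rewrite cmM cmU eq_sym (negPf ji).
move: (\prod_(_ <- _) _)%N (i.+1 ^ c i)%N (c i)`! => x y z; ring.
Qed.

(* (i+1) d/dp_(i+1) *)
Definition dperp i g : sym F := perp (psum F i.+1) g.

Lemma mcoeff_dperp i g c :
  (dperp i g)@_c = g@_(mmul (ucm i) c) * (i.+1 * (c i).+1)%:R.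
Proof.
rewrite mcoeff_perp /psum /= malgUM hallUr zee_ucmM natrM mulrCA mulrC mulKf //.
exact: zee_neq0.
Qed.

Lemma dperpU i m :
  dperp i << m >> = (i.+1 * m i)%:R *: << divcm m (ucm i) >>.
Proof.
apply/malgP => c; rewrite mcoeff_dperp mcoeffZ !mcoeffU1.
have [->|ne] := eqVneq m (mmul (ucm i) c).
  have -> : divcm (mmul (ucm i) c) (ucm i) = c.
    by apply/eqP/cmP => j; rewrite divcmE cmM addKn.
  by rewrite eqxx mul1r mulr1 cmM cmUU add1n.
rewrite mul0r; case: eqP => [E|_]; last by rewrite mulr0.
case: (posnP (m i)) => [->|mi]; first by rewrite muln0 mul0r.
case/eqP: ne; apply/eqP/cmP => j; rewrite cmM -E divcmE.
by rewrite subnKC // cmU; case: eqP => // <-.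
Qed.

Lemma sym_ind (P : sym F -> Prop) :
    (forall f g, P f -> P g -> P (f + g)) -> (forall x f, P f -> P (x *: f)) ->
    (forall m, P << m >>) -> forall f, P f.
Proof.
move=> PD PZ PU f; rewrite [f]monalgE; elim/big_ind: _ => // [|m _].
  by rewrite -(scale0r (<< mone >> : sym F)); apply: PZ.
by rewrite (malgUE f@_m); apply: PZ.
Qed.

Lemma dperp_is_linear i : linear (dperp i).
Proof. by move=> x f g; exact: perp_is_linear. Qed.

(** On two monomials all terms are multiples of one monomial, and the multiplicities of the part
    [i.+1] add; linearity does the rest. *)
Lemma dperpM i f g : dperp i (f * g) = dperp i f * g + f * dperp i g.
Proof.
have DU a b : dperp i (<< a >> * << b >>) =
    dperp i << a >> * << b >> + << a >> * dperp i << b >>.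
  rewrite [X in dperp i X = _]malgUM [in LHS]dperpU.
  rewrite [X in _ = X * _ + _]dperpU [X in _ = _ + _ * X]dperpU.
  (* [divcm] truncates, so this needs a positive exponent of i; for exponent 0 the coefficient
     [i.+1 * x i] vanishes. *)
  have divM (x y : {cmonom nat}) : (0 < x i)%N ->
      mmul (divcm x (ucm i)) y = divcm (mmul x y) (ucm i).
    move=> xi; apply/eqP/cmP => j; rewrite cmM !divcmE cmM addnBAC //.
    by rewrite cmU; case: eqP => // <-.
  have E (x y : {cmonom nat}) : (i.+1 * x i)%:R *: << divcm x (ucm i) >> * << y >> =
      (i.+1 * x i)%:R *: << divcm (mmul x y) (ucm i) >> :> sym F.
    case: (posnP (x i)) => [->|xi].
      by rewrite muln0 [X in X * _ = _]scale0r [RHS]scale0r; apply: mul0r.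
    transitivity ((i.+1 * x i)%:R *: (<< divcm x (ucm i) >> * << y >>) : sym F).
      exact/esym/scalerAl.
    by rewrite -(divM _ _ xi); apply: congr1; apply: malgUM.
  rewrite [X in _ = X + _]E [X in _ = _ + X]mulrC [X in _ = _ + X]E mulmC.
  rewrite -[RHS]scalerDl; apply: (congr1 (fun x => x *: _)).
  by rewrite -natrD -mulnDr cmM addnC.
apply: (derivation_ext (G := fun f => exists m, f = << m >>)) => [P PD PZ PU||].
- by apply: sym_ind => // m; apply: PU; exists m.
- exact: dperp_is_linear.
- by move=> _ _ [a ->] [b ->].
Qed.

Lemma cmon_ofE n (c : {ffun 'I_n -> 'I_n.+1}) (j : nat) :
  cmon_of c j = (\sum_(i < n | i == j :> nat) c i)%N.
Proof.
rewrite /cmon_of [RHS]big_mkcond /=.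
elim/big_rec2: _ => [|i y z _ <-]; first by rewrite cm1.
rewrite cmM; congr (_ + _)%N.
elim: (nat_of_ord (c i)) => [|e IH]; first by rewrite cm1; case: ifP.
by rewrite expcmnS cmM IH cmU; case: eqP.
Qed.

Lemma leq_wgt m i : (m i * i.+1 <= wgt m)%N.
Proof.
have [im|] := boolP (i \in finsupp m); last by rewrite -cmE_eq0 => /eqP ->.
by rewrite /wgt (big_fsetD1 _ im) /= leq_addr.
Qed.

Lemma mcoeff_hsym n m :
  (hsym F n)@_m = if wgt m == n then (zee m)%:R^-1 else 0.
Proof.
rewrite /hsym raddf_sum /=.
have wc (c : {ffun 'I_n -> 'I_n.+1}) : (\sum_i c i * i.+1)%N = wgt (cmon_of c).
  by rewrite wgt_cmon_of.
case: eqP => [wm|wm]; last first.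
  rewrite big1 // => c /eqP cn; rewrite mcoeffU; case: eqP => [E|//].
  by case: wm; rewrite -E -wc.
(* Since m i <= |m| = n, the multiplicities of m fit into ['I_n.+1], and m arises from exactly one
   index of the sum. *)
pose c0 : {ffun 'I_n -> 'I_n.+1} := [ffun i : 'I_n => inord (m i)].
have c0E (i : 'I_n) : c0 i = m i :> nat.
  rewrite ffunE inordK // ltnS -[X in (_ <= X)%N]wm; apply: leq_trans (leq_wgt m i).
  by rewrite leq_pmulr.
have cm0 : cmon_of c0 = m.
  apply/eqP/cmP => j; rewrite cmon_ofE.
  case: (ltnP j n) => [jn|nj].
    rewrite (big_pred1 (Ordinal jn)) ?c0E // => i; exact/eqP/eqP => [/val_inj|->].
  rewrite big_pred0 => [|i]; last first.
    by apply/negbTE; apply: contraTneq (ltn_ord i) => ->; rewrite -leqNgt.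
  have := leq_wgt m j; rewrite wm; case: (m j) => // e le.
  by have := leq_trans le nj; rewrite mulSn; lia.
rewrite (eq_bigr (fun c : {ffun _ -> _} => (zee (cmon_of c))%:R^-1 *+ (cmon_of c == m))); last first.
  by move=> c _; apply: mcoeffU.
rewrite (bigD1 c0) /=; last by rewrite wc cm0 wm.
rewrite cm0 eqxx mulr1n big1 ?addr0 // => c /andP[_ ne].
case: eqP => // E; case/eqP: ne; apply/ffunP => i; apply: val_inj.
by rewrite /= c0E -E cmon_ofE (big_pred1 i) // => j; apply/eqP/eqP => [/val_inj|->].
Qed.

Lemma hsym0 : hsym F 0 = 1.
Proof.
apply/malgP => m; rewrite mcoeff_hsym mcoeff1.
have [->|ne] := eqVneq m mone; first by rewrite wgt1 /zee mdom1 big_seq_fset0 invr1.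
case: eqP => // wm; case/eqP: ne; apply/eqP/cmP => i; rewrite cm1.
by have := leq_wgt m i; rewrite wm; case: (m i).
Qed.

Lemma mcoeff_ucmM i f m :
  (<< ucm i >> * f)@_m = if (0 < m i)%N then f@_(divcm m (ucm i)) else 0.
Proof.
rewrite mcoeffMl msuppU1 big_seq_fset1.
case: posnP => [m0|mi].
  rewrite big1_seq // => b _; case: eqP => [E|]; last by rewrite mulr0n.
  by have := congr1 (fun c => c i) E; rewrite m0 cmM cmUU.
have mE : m = mmul (ucm i) (divcm m (ucm i)).
  apply/eqP/cmP => j; rewrite cmM divcmE subnKC //.
  by rewrite cmU; case: eqP => // <-.
have inj b : (mmul (ucm i) b == m) = (b == divcm m (ucm i)).
  apply/eqP/eqP => [<-|->]; last by [].
  by apply/eqP/cmP => j; rewrite divcmE cmM addKn.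
have [din|dnin] := boolP (divcm m (ucm i) \in msupp f).
  rewrite (big_fsetD1 _ din) /= inj eqxx mulr1n mcoeffU1 eqxx mul1r.
  rewrite big1_seq ?addr0 // => b /andP[_]; rewrite !inE => /andP[ne _].
  by rewrite inj (negPf ne) mulr0n.
rewrite (mcoeff_outdom dnin) big1_seq // => b /andP[_ bin].
by rewrite inj; case: eqP => [E|]; [rewrite -E bin in dnin | rewrite mulr0n].
Qed.

(** The coefficient of p_m in p_(i+1) h_(n-i-1) is m_i (i+1) / z_m, and the numerators add up to |m|
    = n. *)
Lemma newton_hsym n :
  n%:R *: hsym F n = \sum_(i < n) psum F i.+1 * hsym F (n - i.+1).
Proof.
apply/malgP => m; rewrite mcoeffZ mcoeff_hsym raddf_sum /=.
have T (i : nat) : (i < n)%N -> (psum F i.+1 * hsym F (n - i.+1))@_m =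
    if wgt m == n then (m i * i.+1)%:R / (zee m)%:R else 0.
  move=> lin; rewrite /psum -[i.+1.-1]/i mcoeff_ucmM.
  case: (posnP (m i)) => [->|mi] /=; first by rewrite mul0n mul0r if_same.
  set d := divcm m (ucm i); have mE : m = mmul (ucm i) d.
    apply/eqP/cmP => j; rewrite cmM divcmE subnKC //.
    by rewrite cmU; case: eqP => // <-.
  have wE : wgt m = (i.+1 + wgt d)%N by rewrite mE wgtM wgtU.
  rewrite mcoeff_hsym wE; have -> : (wgt d == n - i.+1)%N = (i.+1 + wgt d == n)%N.
    by lia.
  case: eqP => // _; rewrite {2}mE zee_ucmM.
  have -> : (d i).+1 = m i by rewrite mE cmM cmUU.
  rewrite (mulnC (m i)) [X in _ / X]natrM invfM mulrCA divff ?mulr1 //.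
  by move/pcharf0P: F0 => ->; rewrite muln_eq0 /= -lt0n.
rewrite (eq_bigr (fun i : 'I_n =>
  if wgt m == n then (m i * i.+1)%:R / (zee m)%:R else 0)); last first.
  by move=> i _; apply: T.
case: eqP => [wm|_]; last by rewrite mulr0 big1.
rewrite -mulr_suml -natr_sum; congr (_%:R / _); rewrite -[LHS]wm.
rewrite -(big_mkord xpredT (fun i => m i * i.+1)%N) /index_iota subn0.
rewrite [RHS](bigID (fun i => i \in finsupp m)) /= [X in (_ + X)%N]big1; last first.
  by move=> i; rewrite -cmE_eq0 => /eqP ->.
rewrite addn0 -big_filter; apply: perm_big; apply: uniq_perm => [||i].
- exact: fset_uniq.
- by rewrite filter_uniq ?iota_uniq.
rewrite mem_filter mem_iota add0n leq0n /=.
have := leq_wgt m i; rewrite wm; case im: (i \in finsupp m) => //=.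
by move: im; rewrite -cmE_neq0; case: (m i) => // e _; lia.
Qed.
End Calculus.

(** * Relations between the vertex operators *)

Section Commutation.
Variables (F : fieldType) (F0 : [pchar F] =i pred0) (t : F).

(* the coefficients of (1 - z) / (1 - t z), i.e. h_a[t - 1] *)
Definition hcoef (a : nat) : F := if a is b.+1 then t ^+ b.+1 - t ^+ b else 1.

(** Newton's identity for h_b[t - 1], where p_r[t - 1] = t^r - 1; here the sum telescopes. *)
Lemma newton_hcoef b :
  b%:R * hcoef b = \sum_(r < b) (t ^+ r.+1 - 1) * hcoef (b - r.+1).
Proof.
case: b => [|n]; first by rewrite mul0r big_ord0.
rewrite big_ord_recr /= subnn mulr1.
rewrite (eq_bigr (fun r : 'I_n => t ^+ n.+1 - t ^+ n +
    (t ^+ (n - r.+1) - t ^+ (n - r)))); last first.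
  move=> r _; have rn := ltn_ord r.
  have -> : (n.+1 - r.+1)%N = (n - r.+1).+1 by lia.
  have -> : (n - r)%N = (n - r.+1).+1 by lia.
  rewrite /hcoef (exprS t n) (exprS t (n - r.+1)).
  have -> : t ^+ n = t ^+ r.+1 * t ^+ (n - r.+1) by rewrite -exprD; congr (_ ^+ _); lia.
  ring.
rewrite big_split /= sumr_const card_ord (reindex_inj rev_ord_inj) /=.
rewrite (eq_bigr (fun i : 'I_n => t ^+ i - t ^+ i.+1)); last first.
  by move=> i _; have ni := ltn_ord i; congr (_ ^+ _ - _ ^+ _); lia.
have -> : \sum_(i < n) (t ^+ i - t ^+ i.+1) = 1 - t ^+ n.
  elim: n => [|n IH]; first by rewrite big_ord0 expr0 subrr.
  by rewrite big_ord_recr /= IH; ring.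
by rewrite -mulr_natl -natr1; ring.
Qed.

Lemma triangle_sum (V : zmodType) (G : nat -> nat -> V) i :
  \sum_(r < i) \sum_(a < i - r) G r a =
  \sum_(b < i) \sum_(r < b.+1) G r (b - r)%N.
Proof.
elim: i => [|i IH]; first by rewrite !big_ord0.
rewrite big_ord_recr [RHS]big_ord_recr /= -IH subSnn big_ord1.
rewrite [in RHS]big_ord_recr /= subnn addrA -big_split /=; congr (_ + _).
apply: eq_bigr => r _; have ri := ltn_ord r.
by rewrite subSn 1?ltnW // big_ord_recr.
Qed.

Lemma triangle_sumC (V : zmodType) (G : nat -> nat -> V) i :
  \sum_(r < i) \sum_(a < i - r) G r a = \sum_(a < i) \sum_(r < i - a) G r a.
Proof.
rewrite triangle_sum (triangle_sum (fun a r => G r a)); apply: eq_bigr => b _.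
rewrite (reindex_inj rev_ord_inj); apply: eq_bigr => r _ /=.
by have rb := ltn_ord r; congr G; lia.
Qed.

Section Abstract.
Variables (A : comAlgType F) (D Q : nat -> A -> A) (h : int -> A).
Hypothesis Dlin : forall i, linear (D i).
Hypothesis DM : forall i f g, D i (f * g) = D i f * g + f * D i g.
Hypothesis Dh : forall i n, D i (h n) = h (n - i.+1%:Z).
Hypothesis Q0 : forall g, Q 0 g = g.
Hypothesis QN : forall i g,
  i%:R *: Q i g = \sum_(r < i) (t ^+ r.+1 - 1) *: D r (Q (i - r.+1)%N g).

(** In generating series, Q(z) = exp(sum_r (t^r - 1) z^r p_r^perp / r) is the exponential of a
    derivation, hence multiplicative, and it multiplies sum_n h_n w^n by (1 - zw)/(1 - tzw). The
    series are avoided by multiplying with i, expanding Q_i through [QN] and inducting. *)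
Lemma skew_mulh i n g :
  Q i (h n * g) = \sum_(a < i.+1) hcoef a *: (h (n - a%:Z) * Q (i - a)%N g).
Proof.
have LD j u v : D j (u + v) = D j u + D j v.
  by have := Dlin j 1 u v; rewrite !scale1r.
have L0 j : D j 0 = 0.
  by have := Dlin j (-1) 0 0; rewrite scaler0 addr0 scaleN1r addNr.
have LZ j x u : D j (x *: u) = x *: D j u.
  by have := Dlin j x u 0; rewrite L0 !addr0.
have LS j m (G : 'I_m -> A) : D j (\sum_(i < m) G i) = \sum_(i < m) D j (G i).
  by elim/big_rec2: _ => // k x y _ <-; rewrite LD.
elim/ltn_ind: i => -[|i] IH.
  by rewrite big_ord1 subr0 scale1r !Q0.
have i0 : (i.+1%:R : F) != 0 by move/pcharf0P: F0 => ->.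
apply: (scalerI i0); rewrite QN.
(* [G1] collects the terms where the derivation hits h, [G2] those where it hits Q g. At a given a,
   [newton_hcoef] sums the former to the coefficient a c_a and [QN] the latter to (i + 1 - a) c_a;
   together (i + 1) c_a. *)
pose G1 r a := ((t ^+ r.+1 - 1) * hcoef a) *:
  (h (n - (a + r).+1%:Z) * Q (i - (a + r))%N g).
pose G2 r a := ((t ^+ r.+1 - 1) * hcoef a) *:
  (h (n - a%:Z) * D r (Q (i - a - r)%N g)).
transitivity (\sum_(r < i.+1) \sum_(a < i.+1 - r) (G1 r a + G2 r a)).
  apply: eq_bigr => r _; have ri := ltn_ord r.
  rewrite IH; last by lia.
  have -> : (i.+1 - r.+1).+1 = (i.+1 - r)%N by lia.
  rewrite LS scaler_sumr; apply: eq_bigr => a _; have ai := ltn_ord a.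
  rewrite LZ DM Dh scalerA scalerDr; congr (_ *: (h _ * Q _ g) + _ *: (_ * D r (Q _ g))).
  - by lia.
  - by lia.
  - by lia.
under eq_bigr => r _ do rewrite big_split /=.
rewrite big_split /= triangle_sum (triangle_sumC G2).
pose G3 a := \sum_(r < i.+1 - a) G2 r a.
have G3E : \sum_(a < i.+1) G3 a = G3 0 + \sum_(a < i.+1) G3 a.+1.
  have Gi : G3 i.+1 = 0 by rewrite /G3 subnn big_ord0.
  by rewrite [LHS]big_ord_recl [in RHS]big_ord_recr /= Gi addr0.
rewrite [X in _ + X = _](_ : _ = \sum_(a < i.+1) G3 a) // G3E.
rewrite scaler_sumr [RHS]big_ord_recl /= addrCA; congr (_ + _).
  rewrite scale1r scalerAr !subn0 QN mulr_sumr; apply: eq_bigr => r _.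
  rewrite /G2 mulr1 -scalerAr; congr (_ *: (h _ * D r (Q _ g))).
  all: rewrite ?subn0 ?subSS ?subr0 //=.
rewrite -big_split /=; apply: eq_bigr => a _; have ai := ltn_ord a.
rewrite /bump /= add1n /G3 subSS.
rewrite (eq_bigr (fun r : 'I_a.+1 => ((t ^+ r.+1 - 1) * hcoef (a.+1 - r.+1)) *:
   (h (n - a.+1%:Z) * Q (i - a)%N g))); last first.
  move=> r _; have ra := ltn_ord r; rewrite /G1 subSS subnK //; lia.
rewrite -scaler_suml -newton_hcoef.
have -> : \sum_(r < i - a) G2 r a.+1 =
    ((i - a)%:R * hcoef a.+1) *: (h (n - a.+1%:Z) * Q (i - a)%N g).
  rewrite [(i - a)%:R * _]mulrC -scalerA [(i - a)%:R *: _]scalerAr QN.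
  rewrite mulr_sumr scaler_sumr.
  apply: eq_bigr => r _; have ra := ltn_ord r.
  rewrite /G2 -scalerAr scalerA [hcoef a.+1 * _]mulrC.
  congr (_ *: (_ * D _ (Q _ g))).
  by lia.
rewrite -scalerDl -mulrDl -natrD scalerA; congr ((_%:R * _) *: _); lia.
Qed.
End Abstract.
End Commutation.

(** * Skewing by the plethystic complete functions *)

Section VertexOperators.
Variables (F : fieldType) (F0 : [pchar F] =i pred0) (t : F).
Implicit Types (f g : sym F) (m n : int).

Lemma dperp_hsymz i n : dperp i (hsymz F n) = hsymz F (n - i.+1%:Z).
Proof.
have key j c : (dperp i (hsym F j))@_c =
    if (i.+1 + wgt c == j)%N then (zee c)%:R^-1 else 0.
  rewrite mcoeff_dperp // mcoeff_hsym // wgtM wgtU.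
  case: eqP => _; last by rewrite mul0r.
  rewrite zee_ucmM natrM invfM -mulrA mulVf ?mulr1 //.
  by move/pcharf0P: F0 => ->; rewrite muln_eq0.
have D0 : dperp i 0 = 0 :> sym F.
  have := dperp_is_linear i (-1) (0 : sym F) 0.
  by rewrite scaler0 addr0 scaleN1r addNr.
case: n => n; last first.
  have -> : Negz n - i.+1%:Z = Negz (n + i.+1) by lia.
  exact: D0.
case: (leqP i.+1 n) => ni.
  have -> : n%:Z - i.+1%:Z = (n - i.+1)%N%:Z by lia.
  apply/malgP => c; rewrite [hsymz F n]/(hsym F n) key /hsymz mcoeff_hsym //.
  by congr (if _ then _ else _); lia.
have -> : n%:Z - i.+1%:Z = Negz (i - n) by lia.
apply/malgP => c; rewrite [hsymz F n]/(hsym F n) key mcoeff0.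
by case: eqP => //; lia.
Qed.

Section Pleth.
Variable phi : nat -> sym F.
Let mono (m : {cmonom nat}) : sym F := \prod_(i <- finsupp m) phi i.+1 ^+ m i.

Lemma plethD f g : pleth phi (f + g) = pleth phi f + pleth phi g.
Proof. exact: mmapD. Qed.

Lemma plethU (m : {cmonom nat}) : pleth phi << m >> = mono m.
Proof. by transitivity (malgC 1 * mono m : sym F); [apply: mmapU | apply: mul1r]. Qed.

Lemma plethZ x f : pleth phi (x *: f) = x *: pleth phi f.
Proof.
rewrite /pleth (mmapEw (msuppZ_le x f)) mmapE scaler_sumr.
apply: eq_bigr => m _; rewrite mcoeffZ.
transitivity (malgC x * malgC f@_m * mono m : sym F).
  by apply: (congr1 (fun z => z * mono m)); apply: mpolyCM.
transitivity (malgC x * (malgC f@_m * mono m) : sym F); first exact/esym/mulrA.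
exact: mul_malgC.
Qed.

Lemma pleth_ucmM j f : pleth phi (<< ucm j >> * f) = phi j.+1 * pleth phi f.
Proof.
elim/sym_ind: f => [u v IHu IHv|x u IH|m].
- transitivity (pleth phi (<< ucm j >> * u + << ucm j >> * v)).
    by apply: congr1; apply: mulrDr.
  transitivity (phi j.+1 * pleth phi u + phi j.+1 * pleth phi v).
    transitivity (pleth phi (<< ucm j >> * u) + pleth phi (<< ucm j >> * v)).
      exact: plethD.
    exact: (f_equal2 (fun a b : sym F => a + b) IHu IHv).
  transitivity (phi j.+1 * (pleth phi u + pleth phi v)); first exact/esym/mulrDr.
  by apply: congr1; exact/esym/plethD.
- transitivity (pleth phi (x *: (<< ucm j >> * u))).
    by apply: congr1; exact/esym/scalerAr.
  transitivity (x *: (phi j.+1 * pleth phi u)); first last.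
  - transitivity (phi j.+1 * (x *: pleth phi u)); first exact: scalerAr.
    by apply: congr1; exact/esym/plethZ.
  transitivity (x *: pleth phi (<< ucm j >> * u)); first exact: plethZ.
  exact: (f_equal (fun a : sym F => x *: a) IH).
transitivity (pleth phi << mmul (ucm j) m >>); first by apply: congr1; apply: malgUM.
rewrite [LHS]plethU [X in _ = _ * X]plethU /mono mdomD mdomU.
set d := ([fset j] `|` finsupp m)%fset.
have jd : j \in d by rewrite !inE eqxx.
have -> : \prod_(i <- finsupp m) phi i.+1 ^+ m i = \prod_(i <- d) phi i.+1 ^+ m i.
  apply: big_fset_incl => [|i _]; first exact: fsubsetUr.
  by rewrite -cmE_eq0 => /eqP ->.
rewrite (big_fsetD1 _ jd) [in RHS](big_fsetD1 _ jd) /=.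
rewrite cmM cmUU add1n exprS -mulrA; congr (_ * (_ * _)).
apply: eq_big_seq => i; rewrite !inE => /andP[ij _].
by rewrite cmM cmU eq_sym (negPf ij).
Qed.
End Pleth.

Lemma hsymt0 : hsymt t 0 = 1.
Proof.
rewrite /hsymt hsym0 //; transitivity (pleth (fun n : nat => (t ^+ n - 1) *: psum F n) << mone >>).
  by congr pleth.
by rewrite plethU mdom1 big_seq_fset0.
Qed.

Lemma newton_hsymt (n : nat) : n%:R *: hsymt t n =
  \sum_(i < n) (t ^+ i.+1 - 1) *: (psum F i.+1 * hsymt t (n - i.+1)).
Proof.
pose phi := fun n : nat => (t ^+ n - 1) *: psum F n.
transitivity (pleth phi (n%:R *: hsym F n)); first exact/esym/plethZ.
rewrite newton_hsym //.
have P0 : pleth phi 0 = 0 by apply: mmap0.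
rewrite (big_morph (pleth phi) (plethD phi) P0); apply: eq_bigr => i _.
transitivity (phi i.+1 * pleth phi (hsym F (n - i.+1))); first exact: pleth_ucmM.
exact/esym/scalerAl.
Qed.

(** Lets a single truncation bound serve for g and for all its images under skewing. *)
Lemma sdeg_perp f g : (sdeg (perp f g) <= sdeg g)%N.
Proof.
rewrite /sdeg; apply/bigmax_leqP_seq => c cin _.
have : hall g (f * << c >>) != 0.
  apply: contraTneq cin => E; rewrite -mcoeff_eq0.
  by rewrite [X in X == 0]mcoeff_perp E mul0r.
rewrite /hall => ne.
have [m min] : exists2 m, m \in msupp g & (f * << c >>)@_m != 0.
  apply/hasP; apply: contraNT ne; rewrite -all_predC => /allP al.
  rewrite big1_seq // => m /andP[_ min].
  by have /= := al _ min; rewrite negbK => /eqP ->; rewrite mulr0 mul0r.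
rewrite mcoeff_neq0.
move=> /msuppM_le [a [b [_ bin E]]].
have bc : b = c by move: bin => /(fsubsetP msuppU_le); rewrite inE => /eqP.
apply: leq_trans (leq_bigmax_seq (F := wgt) _ min isT).
by rewrite E wgtM bc leq_addl.
Qed.

Lemma perp_hsymt_mulhz i n g : perp (hsymt t i) (hsymz F n * g) =
  \sum_(a < i.+1) hcoef t a *: (hsymz F (n - a%:Z) * perp (hsymt t (i - a)) g).
Proof.
apply: (skew_mulh F0 (D := @dperp F) (Q := fun i => perp (hsymt t i))).
- exact: dperp_is_linear.
- exact: dperpM.
- exact: dperp_hsymz.
- by move=> f; rewrite hsymt0 perp1.
- move=> j f; rewrite -perpZl newton_hsymt perp_suml; apply: eq_bigr => r _.
  by rewrite perpZl; apply: congr1; apply: perpM.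
Qed.
End VertexOperators.

(** * Normal ordering and the quadratic relation *)

Section AbstractVertex.
Variables (F : fieldType) (t : F) (A : comAlgType F).
Variables (Q : nat -> A -> A) (h : int -> A) (B : int -> A -> A) (deg : A -> nat).
Hypothesis Qlin : forall i, linear (Q i).
Hypothesis QC : forall i j f, Q i (Q j f) = Q j (Q i f).
Hypothesis Qdeg : forall i f, (deg (Q i f) <= deg f)%N.
Hypothesis h_neg : forall n, h (Negz n) = 0.
Hypothesis Qh : forall i n g, Q i (h n * g) =
  \sum_(a < i.+1) hcoef t a *: (h (n - a%:Z) * Q (i - a)%N g).
Hypothesis BE : forall n g N, (deg g <= N)%N ->
  B n g = \sum_(i < N.+1) h (i%:Z + n) * Q i g.

Lemma vertex_linear n : linear (B n).
Proof.
move=> x f g; set N := (deg (x *: f + g) + deg f + deg g)%N.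
rewrite !(@BE n _ N) ?scaler_sumr -?big_split /=; try by rewrite /N; lia.
by apply: eq_bigr => i _; rewrite Qlin mulrDr scalerAr.
Qed.

(** The terms with a > n carry h_(n-a) = 0, so any M > n gives the full sum. *)
Lemma vertex_mulh (m n : int) g (M : nat) : (n < M%:Z)%R ->
  B m (h n * g) = \sum_(a < M) hcoef t a *: (h (n - a%:Z) * B (m + a%:Z) g).
Proof.
move=> nM; set N := (deg (h n * g) + deg g + M)%N.
rewrite (@BE m _ N); last by rewrite /N; lia.
pose G i a := hcoef t a *: (h (n - a%:Z) * (h (i%:Z + (m + a%:Z)) * Q i g)).
transitivity (\sum_(b < N.+1) \sum_(r < b.+1) G (b - r)%N r).
  apply: eq_bigr => i _; rewrite Qh mulr_sumr; apply: eq_bigr => a _.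
  rewrite /G -scalerAr mulrCA; congr (_ *: (_ * (h _ * _))).
  by have ai := ltn_ord a; lia.
rewrite -(triangle_sum (fun r b => G b r)).
rewrite -(big_mkord xpredT (fun a => \sum_(i < N.+1 - a) G i a)).
rewrite -(big_mkord xpredT (fun a => hcoef t a *: (h (n - a%:Z) * B (m + a%:Z) g))).
rewrite (big_cat_nat (n := M)) //=; last by rewrite /N; lia.
rewrite [X in _ + X]big_nat_cond [X in _ + X]big1 ?addr0; last first.
  move=> a /andP[/andP[Ma _] _]; rewrite big1 // => i _; rewrite /G.
  have -> : n - a%:Z = Negz (absz (n - a%:Z + 1)) by lia.
  by rewrite h_neg mul0r scaler0.
rewrite !big_nat; apply: eq_bigr => a /andP[_ aM].
rewrite (@BE _ g (N - a)); last by rewrite /N; lia.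
rewrite mulr_sumr scaler_sumr subSn //; by rewrite /N; lia.
Qed.

(** The normally ordered product of B_m and B_n: both multiplications by complete functions stand to
    the left of both skewings, whence the symmetry in m and n. *)
Definition vertex_pair N m n f :=
  \sum_(j < N.+1) h (j%:Z + n) * B m (Q j f).

Lemma vertex_pairC N m n f : (deg f <= N)%N ->
  vertex_pair N m n f = vertex_pair N n m f.
Proof.
move=> fN.
have E x y : vertex_pair N x y f =
    \sum_(j < N.+1) \sum_(i < N.+1) h (j%:Z + y) * (h (i%:Z + x) * Q i (Q j f)).
  apply: eq_bigr => j _; rewrite (@BE _ _ N) ?mulr_sumr //.
  exact: leq_trans (Qdeg _ _) fN.
rewrite !E exchange_big /=; apply: eq_bigr => i _; apply: eq_bigr => j _.
by rewrite QC mulrCA.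
Qed.

Lemma vertex_comp (m n : int) f (N M : nat) : (deg f <= N)%N -> (N%:Z + n < M%:Z)%R ->
  B m (B n f) = \sum_(a < M) hcoef t a *: vertex_pair N (m + a%:Z) (n - a%:Z) f.
Proof.
move=> fN NM; rewrite (@BE n f N) //.
have BD u v : B m (u + v) = B m u + B m v.
  by have := vertex_linear m 1 u v; rewrite !scale1r.
have B0 : B m 0 = 0.
  by have := vertex_linear m (-1) 0 0; rewrite scaler0 addr0 scaleN1r addNr.
rewrite (big_morph (B m) BD B0).
rewrite (eq_bigr (fun j : 'I_N.+1 => \sum_(a < M)
  hcoef t a *: (h (j%:Z + (n - a%:Z)) * B (m + a%:Z) (Q j f)))).
  by rewrite exchange_big; apply: eq_bigr => a _; rewrite -scaler_sumr.
move=> j _; have jN := ltn_ord j; rewrite (@vertex_mulh _ _ _ M); last by lia.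
by apply: eq_bigr => a _; rewrite addrA.
Qed.

(** Multiplying (1 - z)/(1 - tz) by 1 - tz leaves 1 - z, so the left side is a difference of just
    two normally ordered products. Since these are symmetric in their indices, the same expression
    for (n - 1, m + 1) is its negative. *)
Lemma vertex_quadratic m n f :
  B m (B n f) - t *: B (m + 1) (B (n - 1) f) =
  - (B (n - 1) (B (m + 1) f) - t *: B n (B m f)).
Proof.
pose N := deg f; pose P := vertex_pair N.
suff E x y : B x (B y f) - t *: B (x + 1) (B (y - 1) f) = P x y f - P (x + 1) (y - 1) f.
  have := E (n - 1) (m + 1); rewrite subrK addrK => ->; rewrite E opprB.
  by rewrite /P (vertex_pairC m) // (vertex_pairC (m + 1)).
(* Large enough for both expansions. The first one gets an extra term, so that after splitting off
   its leading term the sums match index by index, with c_1 - t c_0 = -1 and c_(a+2) - t c_(a+1) =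
   0. *)
pose M := addn (absz (N%:Z + x)%R) (absz (N%:Z + y)%R).
rewrite (@vertex_comp x y f N M.+2) //; last by rewrite /M; lia.
rewrite (@vertex_comp (x + 1) (y - 1) f N M.+1) //; last by rewrite /M; lia.
rewrite [X in X - _]big_ord_recl /= scale1r subr0 addr0 scaler_sumr -addrA -sumrB.
apply: (congr1 (fun z => P x y f + z)).
rewrite big_ord_recl /= big1 ?addr0.
  rewrite /bump /= addn0 expr1 expr0 scale1r -scalerBl.
  have -> : t - 1 - t = -1 by ring.
  by rewrite scaleN1r.
move=> a _; rewrite /bump /= !add1n scalerA.
rewrite [X in _ - _ *: P X _ _](_ : _ = x + a.+2%:Z) ?[X in _ - _ *: P _ X _](_ : _ = y - a.+2%:Z).
- rewrite -scalerBl (_ : _ - _ = 0) ?scale0r // !exprS; ring.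
- lia.
- lia.
Qed.
End AbstractVertex.

Section BopRelations.
Variables (F : fieldType) (F0 : [pchar F] =i pred0) (t : F).
Implicit Types (f g : sym F) (m n : int).

Lemma perpC f g h : perp f (perp g h) = perp g (perp f h) :> sym F.
Proof.
transitivity (perp (f * g) h); first exact/esym/perpM.
by transitivity (perp (g * f) h); [rewrite [f * g]mulrC | exact: perpM].
Qed.

Lemma Bop_is_linear n : linear (Bop t n : sym F -> sym F).
Proof.
apply: (@vertex_linear F (sym F) (fun i => perp (hsymt t i)) (hsymz F) _ (@sdeg F)).
- by move=> i; apply: perp_is_linear.
- by move=> m g N; apply: BopE.
Qed.

Lemma Bop_mulh m n g (M : nat) : (n < M%:Z)%R -> Bop t m (hsymz F n * g) =
  \sum_(a < M) hcoef t a *: (hsymz F (n - a%:Z) * Bop t (m + a%:Z) g).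
Proof.
apply: (@vertex_mulh F t (sym F) (fun i => perp (hsymt t i)) (hsymz F) _ (@sdeg F)).
- by [].
- exact: perp_hsymt_mulhz.
- by move=> m' g' N; apply: BopE.
Qed.

Lemma Bop_quadratic m n f :
  Bop t m (Bop t n f) - t *: Bop t (m + 1) (Bop t (n - 1) f) =
  - (Bop t (n - 1) (Bop t (m + 1) f) - t *: Bop t n (Bop t m f)).
Proof.
apply: (@vertex_quadratic F t (sym F) (fun i => perp (hsymt t i)) (hsymz F) _ (@sdeg F)).
- by move=> i; apply: perp_is_linear.
- by move=> i j g; apply: perpC.
- by move=> i g; apply: sdeg_perp.
- by [].
- exact: perp_hsymt_mulhz.
- by move=> m' g' N; apply: BopE.
Qed.

Lemma Bop1 n : Bop t n 1 = hsymz F n.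
Proof.
rewrite (@BopE _ _ _ _ 0) ?big_ord1 ?add0r; last first.
  apply/bigmax_leqP_seq => m; rewrite -mpolyC1E => /(fsubsetP msuppU_le).
  by rewrite inE => /eqP -> _; rewrite wgt1.
transitivity (hsymz F n * 1); last exact: mulr1.
apply: congr1; transitivity (perp 1 (1 : sym F)); last exact: perp1.
by apply: (congr1 (fun z => perp z 1)); apply: hsymt0.
Qed.
End BopRelations.

(** * Products of raising operators *)

Section Kernel.
Variables (F : fieldType) (F0 : [pchar F] =i pred0) (t : F) (V : lmodType F).
Implicit Types (o : nat -> int) (g : (nat -> int) -> V) (s : seq (nat * nat)).

Definition inc o (a : nat) : nat -> int := fun i => o i + (i == a)%:Z.

(** The factor e_b - t e_a, that is, 1 - t e_a / e_b times e_b. Indices are functions on [nat], so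
    that blocks are shifted and concatenated without length conditions. *)
Definition kpair (ab : nat * nat) g o := g (inc o ab.2) - t *: g (inc o ab.1).

Definition kern s g := foldr kpair g s.

Lemma incC o a b : inc (inc o a) b = inc (inc o b) a.
Proof. by apply: functional_extensionality => i; rewrite /inc addrAC. Qed.

Lemma kpairC p q g : kpair p (kpair q g) = kpair q (kpair p g).
Proof.
apply: functional_extensionality => o; rewrite /kpair.
rewrite (incC o p.2 q.2) (incC o p.2 q.1) (incC o p.1 q.2) (incC o p.1 q.1).
by rewrite !scalerBr !opprD !opprK -!addrA; congr (_ + _); rewrite addrCA.
Qed.

Lemma kern_cat s1 s2 g : kern (s1 ++ s2) g = kern s1 (kern s2 g).
Proof. exact: foldr_cat. Qed.

Lemma kern_rem p s g : p \in s -> kern s g = kpair p (kern (rem p s) g).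
Proof.
elim: s => //= q s IH; rewrite inE; have [->|ne] := eqVneq p q; first by [].
by rewrite /= => ps; rewrite (IH ps) kpairC.
Qed.

Lemma kern_perm s1 s2 g : perm_eq s1 s2 -> kern s1 g = kern s2 g.
Proof.
elim: s1 s2 => [|p s IH] s2 pe; first by move: (perm_size pe); case: s2 {pe}.
have ps : p \in s2 by rewrite -(perm_mem pe) mem_head.
rewrite (kern_rem _ ps) /= (IH (rem p s2)) //.
by have := perm_to_rem ps; move/(perm_trans pe); rewrite perm_cons.
Qed.

Lemma kern_ext (P : pred nat) s g :
  (forall o o', (forall i, P i -> o i = o' i) -> g o = g o') ->
  forall o o', (forall i, P i -> o i = o' i) -> kern s g o = kern s g o'.
Proof.
move=> Hg; elim: s => [|p s IH] o o' Ho /=; first exact: Hg.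
by rewrite /kpair; congr (_ - _ *: _); apply: IH => i Pi; rewrite /inc Ho.
Qed.

Definition sw (i j k : nat) := if k == i then j else if k == j then i else k.
Definition oswap i j o : nat -> int := fun k => o (sw i j k).
Definition anti i j g := forall o, g (oswap i j o) = - g o.

Lemma swK i j : involutive (sw i j).
Proof.
move=> k; rewrite /sw; case: (eqVneq k i) => [->|ki].
  by case: (eqVneq j i) => [->|] //; rewrite eqxx.
case: (eqVneq k j) => [->|kj]; first by rewrite eqxx.
by rewrite (negPf ki) (negPf kj).
Qed.

Lemma sw_eq i j a b : (sw i j a == sw i j b) = (a == b).
Proof. exact: (inj_eq (can_inj (swK i j))). Qed.

Lemma oswap_inc i j o a : inc (oswap i j o) a = oswap i j (inc o (sw i j a)).
Proof.
by apply: functional_extensionality => k; rewrite /inc /oswap sw_eq.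
Qed.

Definition swp i j (p : nat * nat) := (sw i j p.1, sw i j p.2).

Lemma kern_oswap i j s g o :
  kern s g (oswap i j o) = kern (map (swp i j) s) (fun o => g (oswap i j o)) o.
Proof.
by elim: s o => //= p s IH o; rewrite /kpair !oswap_inc !IH.
Qed.

Lemma kernN s g o : kern s (fun o => - g o) o = - kern s g o.
Proof.
elim: s o => //= p s IH o.
by rewrite /kpair !IH scalerN opprB opprK addrC.
Qed.

(** The factors commute, so it suffices that exchanging i and j permutes them. *)
Lemma kern_anti i j s g :
  anti i j g -> perm_eq (map (swp i j) s) s -> anti i j (kern s g).
Proof.
move=> ag pe o; rewrite kern_oswap (kern_perm _ pe) -kernN.
by congr (kern s _ o); apply: functional_extensionality => o'; rewrite ag.
Qed.

Lemma kern_anti_off i j s g : anti i j g ->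
  (forall p, p \in s -> [&& p.1 != i, p.1 != j, p.2 != i & p.2 != j]) ->
  anti i j (kern s g).
Proof.
move=> ag off; apply: kern_anti => //; rewrite (_ : map _ _ = s) //.
rewrite -[RHS]map_id; apply/eq_in_map => -[a b] /off /= /and4P[ai aj bi bj].
by rewrite /swp /sw /= !(negPf ai, negPf aj, negPf bi, negPf bj).
Qed.

Lemma anti_eq0 i j g o : anti i j g -> i != j -> o i = o j -> g o = 0.
Proof.
move=> ag ij oij.
have E : oswap i j o = o.
  apply: functional_extensionality => k; rewrite /oswap /sw.
  by case: eqP => [->|_]; [rewrite oij | case: eqP => [->|]].
have := ag o; rewrite E => /eqP; rewrite eq_sym -subr_eq0 -opprD oppr_eq0.
rewrite -mulr2n -scaler_nat scaler_eq0 => /orP[|/eqP //].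
by move/pcharf0P: F0 => ->.
Qed.

(** The transposition (i k) equals (j k)(i j)(j k): three sign changes. *)
Lemma anti_trans i j k g : i != j -> j != k -> i != k ->
  anti i j g -> anti j k g -> anti i k g.
Proof.
move=> ij jk ik aij ajk o.
have -> : oswap i k o = oswap j k (oswap i j (oswap j k o)).
  apply: functional_extensionality => l; rewrite /oswap; congr o; rewrite /sw.
  have ne := (negPf ij, negPf jk, negPf ik).
  have ne' : (j == i = false) * (k == j = false) * (k == i = false).
    by rewrite (eq_sym j) !(eq_sym k) !ne.
  have [->|li] := altP (l =P i); first by do 5!rewrite ?eqxx ?ne ?ne' /=.
  have [->|lj] := altP (l =P j); first by do 5!rewrite ?eqxx ?ne ?ne' /=.
  have [e|lk] := altP (l =P k); first by rewrite -e in ne ne' *; do 5!rewrite ?eqxx ?ne ?ne' /=.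
  by do 4!rewrite ?(negPf li) ?(negPf lj) ?(negPf lk) /=.
by rewrite ajk aij ajk opprK.
Qed.

Lemma antiC i j g : anti i j g -> anti j i g.
Proof.
move=> a o; rewrite -a; congr g; apply: functional_extensionality => l.
by rewrite /oswap; congr o; rewrite /sw; do ![case: eqP => ?]; lia.
Qed.

Definition antion lo hi g := forall i j, (lo <= i < hi)%N -> (lo <= j < hi)%N ->
  i != j -> anti i j g.

Lemma antion_adj lo hi g :
  (forall i, (lo <= i)%N -> (i.+1 < hi)%N -> anti i i.+1 g) -> antion lo hi g.
Proof.
move=> adj.
have H d : forall i, (lo <= i)%N -> (i + d.+1 < hi)%N -> anti i (i + d.+1) g.
  elim: d => [|d IH] i il ih; first by rewrite addn1; apply: adj => //; lia.
  apply: (@anti_trans i (i + d.+1)%N (i + d.+2)%N); try by lia.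
    by apply: IH => //; lia.
  have -> : (i + d.+2 = (i + d.+1).+1)%N by lia.
  by apply: adj; lia.
move=> i j ii jj; rewrite neq_ltn => /orP[] ij.
  have -> : j = (i + (j - i).-1.+1)%N by lia.
  by apply: H; lia.
apply: antiC; have -> : i = (j + (i - j).-1.+1)%N by lia.
by apply: H; lia.
Qed.

Definition ipairs lo n : seq (nat * nat) :=
  [seq (a, b) | a <- iota lo n, b <- iota a.+1 (lo + n - a.+1)].

Definition rect (A B : seq nat) : seq (nat * nat) := [seq (a, b) | a <- A, b <- B].

Lemma mem_ipairs lo n a b :
  ((a, b) \in ipairs lo n) = (lo <= a < b)%N && (b < lo + n)%N.
Proof.
apply/allpairsPdep/idP => [[x [y [+ + [-> ->]]]]|H].
  by rewrite !mem_iota; lia.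
by exists a, b; rewrite !mem_iota; split => //; lia.
Qed.

Lemma mem_rect lo n lo' n' a b : ((a, b) \in rect (iota lo n) (iota lo' n')) =
  (lo <= a < lo + n)%N && (lo' <= b < lo' + n')%N.
Proof.
apply/allpairsP/idP => [[[x y] /= [+ + [-> ->]]]|H].
  by rewrite !mem_iota => -> ->.
by exists (a, b); rewrite !mem_iota /=; split => //; lia.
Qed.

Lemma uniq_ipairs lo n : uniq (ipairs lo n).
Proof.
apply: allpairs_uniq_dep; first exact: iota_uniq.
  by move=> a _; apply: iota_uniq.
by move=> [a b] [a' b'] _ _ [-> ->].
Qed.

Lemma uniq_rect lo n lo' n' : uniq (rect (iota lo n) (iota lo' n')).
Proof.
by apply: allpairs_uniq; rewrite ?iota_uniq // => -[a b] [a' b'] _ _ [-> ->].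
Qed.

Lemma map_swp_perm i j s : uniq s -> (forall p, p \in s -> swp i j p \in s) ->
  perm_eq (map (swp i j) s) s.
Proof.
have swpK : involutive (swp i j) by case=> a b; rewrite /swp /= !swK.
move=> us st; apply: uniq_perm => //; first by rewrite map_inj_uniq //; apply: can_inj swpK.
move=> p; apply/mapP/idP => [[q qs ->]|ps]; first exact: st.
by exists (swp i j p); [apply: st | rewrite swpK].
Qed.

Definition addon lo n (c : int) o : nat -> int :=
  fun i => o i + (if (lo <= i < lo + n)%N then c else 0).

(* If the entries o_0, ..., o_p are consecutive, raising o_p by at most p makes
   it collide with an earlier entry. *)
Lemma kern_col0 (l : int) p (W : seq nat) g o (e : nat) :
    antion 0 p.+1 g -> (forall i, (i < p)%N -> o i = l - i%:Z) ->
    o p = l - p%:Z + e.+1%:Z -> (e.+1 + size W <= p)%N -> all (ltn p) W ->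
  kern (map (pair p) W) g o = 0.
Proof.
move=> ag; elim: W o e => [|w W IH] o e oi op sz /=.
  move=> _; apply: (anti_eq0 (i := p - e.+1) (j := p)); first by apply: ag; lia.
    by lia.
  by rewrite oi ?op; lia.
move=> /andP[pw pW]; rewrite /kpair /= (IH _ e) ?(IH _ e.+1) ?scaler0 ?subr0 //.
- by move=> i ip; rewrite /inc oi // (_ : i == p = false) ?addr0 //; lia.
- by rewrite /inc op eqxx; lia.
- by move: sz => /=; lia.
- by move=> i ip; rewrite /inc oi // (_ : i == w = false) ?addr0 //; lia.
- by rewrite /inc op (_ : p == w = false); lia.
- by move: sz => /=; lia.
Qed.

(** A raise of o_p makes it collide with an earlier entry, and at most p raises in all cannot carry
    it past the first one. So every factor e_b - t e_p acts as e_b. *)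
Lemma kern_col (l : int) p lo n g o :
    antion 0 p.+1 g -> (forall i, (i <= p)%N -> o i = l - i%:Z) ->
    (n <= p)%N -> (p < lo)%N ->
  kern (map (pair p) (iota lo n)) g o = g (addon lo n 1 o).
Proof.
move=> ag; elim: n lo o => [|n IH] lo o oi np plo /=.
  congr g; apply: functional_extensionality => i; rewrite /addon.
  by rewrite (_ : (_ <= _ < _)%N = false) ?addr0 //; lia.
rewrite {1}/kpair /= (@kern_col0 l p _ g (inc o p) 0%N); last 5 first.
- by [].
- by move=> i ip; rewrite /inc oi 1?ltnW // (_ : i == p = false) ?addr0 //; lia.
- by rewrite /inc oi // eqxx; lia.
- by rewrite size_iota; lia.
- by apply/allP => w; rewrite mem_iota /=; lia.
rewrite scaler0 subr0 IH; last 3 first.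
- by move=> i ip; rewrite /inc oi // (_ : i == lo = false) ?addr0 //; lia.
- by lia.
- by lia.
congr g; apply: functional_extensionality => i; rewrite /addon /inc.
by do ![case: ifP]; case: eqP => /=; lia.
Qed.

(** Row p is peeled off by [kern_col]: the factors of the remaining rows do not touch the entries up
    to p, so antisymmetry there persists. *)
Lemma kern_rect_consecutive (l : int) h p lo n g o :
    antion 0 h g -> (forall i, (i < h)%N -> o i = l - i%:Z) ->
    (n <= p)%N -> (p <= h)%N -> (h <= lo)%N ->
  kern (rect (iota p (h - p)) (iota lo n)) g o = g (addon lo n (h - p)%N%:Z o).
Proof.
move=> ag; move dE : (h - p)%N => d; elim: d p dE o => [|d IH] p dE o oi np ph hlo.
  congr g; apply: functional_extensionality => i; rewrite /addon.
  by case: ifP; rewrite addr0.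
have ag' : antion 0 p.+1 (kern (rect (iota p.+1 d) (iota lo n)) g).
  move=> i j ii jj ij; apply: kern_anti_off; first by apply: ag; lia.
  by move=> [a b]; rewrite mem_rect /=; lia.
have op i : (i <= p)%N -> o i = l - i%:Z by move=> ip; apply: oi; lia.
rewrite /= /rect allpairs_cons kern_cat (kern_col ag' op np); last by lia.
have E i : (i < h)%N -> addon lo n 1 o i = l - i%:Z.
  by move=> ip; rewrite /addon (_ : (_ <= _ < _)%N = false) ?addr0 ?oi //; lia.
rewrite (IH p.+1 _ _ E); try by lia.
congr g; apply: functional_extensionality => i; rewrite /addon.
by case: ifP; lia.
Qed.

(** Both lists consist of all pairs a < b < h + m except those with a < m and h <= b. *)
Lemma kern_exchange m h : (m <= h)%N ->
  perm_eq (rect (iota m (h - m)) (iota h m) ++ ipairs 0 h ++ ipairs h m)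
          (rect (iota 0 m) (iota m (h - m)) ++ ipairs 0 m ++ ipairs m h).
Proof.
move=> mh; apply: uniq_perm.
- rewrite !cat_uniq uniq_rect !uniq_ipairs /= andbT.
  apply/andP; split; last apply/hasPn.
    by apply/hasPn => -[a b]; rewrite mem_cat !mem_ipairs mem_rect; lia.
  by move=> [a b]; rewrite !mem_ipairs; lia.
- rewrite !cat_uniq uniq_rect !uniq_ipairs /= andbT.
  apply/andP; split; last apply/hasPn.
    by apply/hasPn => -[a b]; rewrite mem_cat !mem_ipairs mem_rect; lia.
  by move=> [a b]; rewrite !mem_ipairs; lia.
by move=> [a b]; rewrite !mem_cat !mem_rect !mem_ipairs; lia.
Qed.
End Kernel.

(** * Blocks as antisymmetric functions of the shifted indices *)

Section Blocks.
Variables (F : fieldType) (F0 : [pchar F] =i pred0) (t : F) (V : lmodType F).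
Variable B : int -> V -> V.
Hypothesis Blin : forall n, linear (B n).
Hypothesis Bquad : forall m n f,
  B m (B n f) - t *: B (m + 1) (B (n - 1) f) =
  - (B (n - 1) (B (m + 1) f) - t *: B n (B m f)).
Implicit Types (o : nat -> int) (f : V).

Definition bword (r : seq int) f := foldr B f r.

Lemma bword_linear r : linear (bword r).
Proof.
elim: r => [|n r IH] x f g //.
by rewrite [LHS](_ : _ = B n (bword r (x *: f + g))) // IH; apply: Blin.
Qed.

Lemma bword_cat r r' f : bword (r ++ r') f = bword r (bword r' f).
Proof. exact: foldr_cat. Qed.

Lemma bwordD r f g : bword r (f + g) = bword r f + bword r g.
Proof. by have := bword_linear r 1 f g; rewrite !scale1r. Qed.

Lemma bword0 r : bword r 0 = 0.
Proof.
by have := bword_linear r (-1) 0 0; rewrite scaler0 addr0 scaleN1r addNr.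
Qed.

Lemma bwordZ r x f : bword r (x *: f) = x *: bword r f.
Proof. by have := bword_linear r x f 0; rewrite bword0 !addr0. Qed.

Lemma bwordN r f : bword r (- f) = - bword r f.
Proof. by rewrite -scaleN1r bwordZ scaleN1r. Qed.

Lemma bwordBZ r f x g : bword r (f - x *: g) = bword r f - x *: bword r g.
Proof. by rewrite bwordD bwordN bwordZ. Qed.

Definition wordfun L f o := bword (mkseq o L) f.

Lemma wordfun_ext L f o o' : (forall i, (i < L)%N -> o i = o' i) ->
  wordfun L f o = wordfun L f o'.
Proof.
move=> E; rewrite /wordfun; congr bword; apply/eq_in_map => i.
by rewrite mem_iota => /andP[_]; apply: E.
Qed.

Lemma wordfun_cat p q f o :
  wordfun (p + q) f o = wordfun p (wordfun q f (fun i => o (p + i)%N)) o.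
Proof.
rewrite /wordfun /mkseq iotaD map_cat /bword foldr_cat add0n.
by rewrite -[p in iota p q]addn0 iotaDl -map_comp.
Qed.

(** With x, y at the positions i, i + 1 the value is B_x B_(y+1) - t B_(x+1) B_y, and the quadratic
    relation is its change of sign under exchanging x and y. *)
Lemma kpair_word_anti i L f : (i.+1 < L)%N ->
  anti i i.+1 (kpair t (i, i.+1) (wordfun L f)).
Proof.
move=> iL o; have -> : L = (i + (2 + (L - i.+2)))%N by lia.
set q := (L - i.+2)%N.
pose X := wordfun q f (fun j => o (i + (2 + j))%N).
have W o' x y : o' i = x -> o' i.+1 = y ->
    (forall j, j != i -> j != i.+1 -> o' j = o j) ->
    wordfun (i + (2 + q)) f o' = wordfun i (B x (B y X)) o.
  move=> oi oi1 oj; rewrite wordfun_cat (wordfun_cat 2) {2}/wordfun /= addn0 addn1.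
  rewrite oi oi1 (_ : wordfun q f _ = X).
    by apply: wordfun_ext => j ji; apply: oj; lia.
  by apply: wordfun_ext => j _; apply: oj; lia.
have ne : (i == i.+1 = false) * (i.+1 == i = false) by split; lia.
have K x y : wordfun i (B x (B (y + 1) X)) o - t *: wordfun i (B (x + 1) (B y X)) o =
    wordfun i (B x (B (y + 1) X) - t *: B (x + 1) (B y X)) o.
  by rewrite /wordfun bwordBZ.
rewrite /kpair /= !(W (inc (oswap i i.+1 o) i.+1) (o i.+1) (o i + 1)); last 3 first.
- by rewrite /inc /oswap /sw eqxx ne addr0.
- by rewrite /inc /oswap /sw !(eqxx, ne).
- by move=> j ji ji1; rewrite /inc /oswap /sw (negPf ji) (negPf ji1) addr0.
rewrite !(W (inc (oswap i i.+1 o) i) (o i.+1 + 1) (o i)); last 3 first.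
- by rewrite /inc /oswap /sw eqxx.
- by rewrite /inc /oswap /sw !(eqxx, ne) addr0.
- by move=> j ji ji1; rewrite /inc /oswap /sw (negPf ji) (negPf ji1) addr0.
rewrite !(W (inc o i.+1) (o i) (o i.+1 + 1)); last 3 first.
- by rewrite /inc ne addr0.
- by rewrite /inc eqxx.
- by move=> j ji ji1; rewrite /inc (negPf ji1) addr0.
rewrite !(W (inc o i) (o i + 1) (o i.+1)); last 3 first.
- by rewrite /inc eqxx.
- by rewrite /inc ne addr0.
- by move=> j ji ji1; rewrite /inc (negPf ji) addr0.
rewrite !K -[RHS]bwordN; congr (wordfun i _ o).
by have := Bquad (o i.+1) (o i + 1) X; rewrite addrK.
Qed.

(* Multiplying 1 - t e_a / e_b by e_b for all pairs a < b raises the index b by b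
   in total; so B_rho is the value of this block at o_b = rho_b - b, and in these
   shifted indices the quadratic relation makes it antisymmetric. *)
Definition Eblk L f o := kern t (ipairs 0 L) (wordfun L f) o.

(** Exchanging i and i + 1 permutes all pairs other than (i, i + 1), and the factor of that pair
    makes the word antisymmetric. *)
Lemma Eblk_anti L f : antion 0 L (Eblk L f).
Proof.
apply: antion_adj => i _ iL.
have iin : (i, i.+1) \in ipairs 0 L by rewrite mem_ipairs; lia.
have pe : perm_eq (ipairs 0 L) (rcons (rem (i, i.+1) (ipairs 0 L)) (i, i.+1)).
  by rewrite perm_sym perm_rcons perm_sym perm_to_rem.
rewrite /Eblk (_ : (fun o => _) = kern t (rem (i, i.+1) (ipairs 0 L))
    (kpair t (i, i.+1) (wordfun L f))); last first.
  apply: functional_extensionality => o.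
  by rewrite (kern_perm _ _ pe) -cats1 kern_cat.
apply: kern_anti; first exact: kpair_word_anti.
apply: map_swp_perm; first by rewrite rem_uniq ?uniq_ipairs.
move=> [a b]; rewrite !mem_rem_uniq ?uniq_ipairs // !inE !xpair_eqE !mem_ipairs /=.
by rewrite /sw; do ![case: (eqVneq a _) => ?]; do ![case: (eqVneq b _) => ?]; lia.
Qed.

Lemma Eblk_ext L f o o' : (forall i, (i < L)%N -> o i = o' i) ->
  Eblk L f o = Eblk L f o'.
Proof. by apply: (@kern_ext _ _ _ (ltn^~ L)); apply: wordfun_ext. Qed.

Lemma Eblk_linear L o : linear (fun f => Eblk L f o).
Proof.
rewrite /Eblk => x f g; elim: (ipairs 0 L) o => [|p s IH] o /=.
  exact: bword_linear.
by rewrite /kpair !IH scalerBr scalerDr !scalerA [t * x]mulrC opprD addrACA.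
Qed.

Lemma Eblk_cat p q f o :
  kern t (ipairs 0 p ++ ipairs p q) (wordfun (p + q) f) o =
  Eblk p (Eblk q f (fun i => o (p + i)%N)) o.
Proof.
have E1 s : kern t [seq (p + x.1, p + x.2)%N | x <- s] (wordfun (p + q) f) =
    (fun o => wordfun p (kern t s (wordfun q f) (fun i => o (p + i)%N)) o).
  elim: s => [|[a b] s IH] /=.
    by apply: functional_extensionality => o'; rewrite wordfun_cat.
  apply: functional_extensionality => o'; rewrite IH /kpair /=.
  have sh c : (fun i => inc o' (p + c) (p + i)%N) = inc (fun i => o' (p + i)%N) c.
    by apply: functional_extensionality => i; rewrite /inc eqn_add2l.
  have wf g c : wordfun p g (inc o' (p + c)) = wordfun p g o'.
    by apply: wordfun_ext => i ip; rewrite /inc (_ : _ == _ = false) ?addr0; lia.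
  by rewrite !sh !wf /wordfun bwordBZ.
have E2 : perm_eq (ipairs p q) [seq (p + x.1, p + x.2)%N | x <- ipairs 0 q].
  apply: uniq_perm; first exact: uniq_ipairs.
    rewrite map_inj_uniq ?uniq_ipairs // => -[a b] [c d] [] /addnI -> /addnI ->.
    by [].
  move=> [a b]; rewrite mem_ipairs; apply/idP/mapP => [H|[[c d] + [-> ->]]].
    exists (a - p, b - p)%N => /=; last by congr pair; lia.
    by rewrite mem_ipairs; lia.
  by rewrite mem_ipairs; lia.
rewrite kern_cat (kern_perm _ _ E2) E1.
have : all (fun x => (x.1 < p) && (x.2 < p))%N (ipairs 0 p).
  by apply/allP => -[a b]; rewrite mem_ipairs /=; lia.
rewrite [RHS]/(kern t (ipairs 0 p) (wordfun p (Eblk q f (fun i => o (p + i)%N))) o).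
elim: (ipairs 0 p) o => [//|[a b] s IH] o /= /andP[/andP[ap bp] al].
rewrite /kpair /= !IH //.
by congr (kern _ _ (wordfun _ (Eblk _ _ _)) _ - _ *: kern _ _ (wordfun _ (Eblk _ _ _)) _);
  apply: functional_extensionality => i; rewrite /inc (_ : _ == _ = false) ?addr0 //; lia.
Qed.

Definition bpart (rho : seq nat) f :=
  foldr (fun ab (Phi : seq int -> V) r => Phi r - t *: Phi (raise ab r))
        (bword^~ f) (ltpairs (size rho)) (map Posz rho).

Lemma ltpairsE L : ltpairs L = ipairs 0 L.
Proof. by []. Qed.

Lemma bpartE rho f : bpart rho f = Eblk (size rho) f (fun i => (nth 0%N rho i)%:Z - i%:Z).
Proof.
(* [raise] lowers the index b, whereas [kpair] carries an additional e_b. The two agree once entry i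
   starts lower by the number of pairs of s ending in i; for the full set of pairs this number is
   i. *)
have E L s r : size r = L -> all (fun x => (x.1 < L) && (x.2 < L))%N s ->
    foldr (fun ab (Phi : seq int -> V) r => Phi r - t *: Phi (raise ab r))
        (bword^~ f) s r =
    kern t s (wordfun L f) (fun i => r`_i - (count (fun x : nat * nat => x.2 == i) s)%:Z).
  elim: s r => [|[a b] s IH] r sr /=.
    move=> _; rewrite /wordfun; congr bword.
    apply: (@eq_from_nth _ 0) => [|i ir]; first by rewrite size_mkseq.
    by rewrite nth_mkseq ?subr0 // -sr.
  move=> /andP[/andP[/= aL bL] al]; rewrite /kpair /= (IH r) // (IH (raise (a, b) r)) //.
    congr (kern _ _ _ _ - _ *: kern _ _ _ _); apply: functional_extensionality => i.
      by rewrite /inc (eq_sym b i); move: (count _ s) (i == b) => c [] /=; lia.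
    rewrite /inc (eq_sym b i); case: (ltnP i L) => iL.
      by rewrite nth_mkseq ?sr //=; lia.
    rewrite !nth_default ?size_mkseq ?sr //.
    have /negPf -> : i != a by apply: contraTneq aL => <-; rewrite -leqNgt.
    have /negPf -> : i != b by apply: contraTneq bL => <-; rewrite -leqNgt.
    by rewrite /= add0n addr0.
  by rewrite size_mkseq.
rewrite /bpart ltpairsE (E (size rho)) ?size_map //; last first.
  by apply/allP => -[a b]; rewrite mem_ipairs /=; lia.
apply: Eblk_ext => i ir; rewrite (nth_map 0%N) //; congr (_ - _%:Z).
rewrite -size_filter.
have -> : size [seq x <- ipairs 0 (size rho) | x.2 == i] = size (map (fun a => (a, i)) (iota 0 i)).
  apply: perm_size; apply: uniq_perm; first by rewrite filter_uniq ?uniq_ipairs.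
    by rewrite map_inj_uniq ?iota_uniq // => a b [].
  move=> [a b]; rewrite mem_filter mem_ipairs /=.
  apply/idP/mapP => [/andP[/eqP -> H]|[c ci [-> ->]]].
    by exists a => //; rewrite mem_iota; move: H; rewrite andbC; lia.
  by move: ci; rewrite mem_iota eqxx; lia.
by rewrite size_map size_iota.
Qed.

(** The factors pairing [m, h) with [h, h + m) can be inserted freely: on consecutive entries they
    merely shift the second block by h - m, which the starting point compensates. All factors then
    regroup by [kern_exchange] into the two blocks in the opposite order, linked by the pairs of [0,
    m) with [m, h). *)
Lemma Eblk_exchange (l : int) h m (W : nat -> int) f : (m <= h)%N ->
  Eblk h (Eblk m f W) (fun i => l - i%:Z) =
  kern t (rect (iota 0 m) (iota m (h - m)))
    (fun o => Eblk m (Eblk h f (fun i => o (m + i)%N)) o)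
    (fun i => if (i < h)%N then l - i%:Z else W (i - h)%N - (h - m)%N%:Z).
Proof.
move=> mh; set o' := fun i : nat => if _ then _ else _.
pose M := kern t (ipairs 0 h ++ ipairs h m) (wordfun (h + m) f).
have <- : kern t (rect (iota m (h - m)) (iota h m)) M o' =
    Eblk h (Eblk m f W) (fun i => l - i%:Z).
  have ME o : M o = Eblk h (Eblk m f (fun i => o (h + i)%N)) o by apply: Eblk_cat.
  have Manti : antion 0 h M.
    move=> i j ii jj ij o; rewrite !ME -(Eblk_anti _ ii jj ij).
    congr Eblk; apply: Eblk_ext => e _; rewrite /oswap /sw.
    by rewrite !ifF //; lia.
  rewrite (@kern_rect_consecutive _ F0 _ _ l) //; last first.
    by move=> i ih; rewrite /o' ih.
  rewrite ME; transitivity (Eblk h (Eblk m f W) (addon h m (h - m)%N%:Z o')).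
    congr Eblk; apply: Eblk_ext => e em; rewrite /addon /o'.
    by rewrite ifF ?ifT ?addKn ?subrK //; lia.
  apply: Eblk_ext => i ih; rewrite /addon /o' ih.
  by rewrite ifF ?addr0 //; lia.
rewrite /M -kern_cat (kern_perm _ _ (kern_exchange mh)) kern_cat.
congr (kern _ _ _ _); apply: functional_extensionality => o.
by rewrite addnC Eblk_cat.
Qed.
End Blocks.

(** * Commuting a rectangle with one row *)

Section Wedge.
Variables (F : fieldType) (F0 : [pchar F] =i pred0) (t : F) (V : lmodType F).
Variable B : int -> V -> V.
Hypothesis Blin : forall n, linear (B n).
Hypothesis Bquad : forall m n f,
  B m (B n f) - t *: B (m + 1) (B (n - 1) f) =
  - (B (n - 1) (B (m + 1) f) - t *: B n (B m f)).
Implicit Types (o : nat -> int) (f : V) (s : seq int).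
Local Notation Eblk := (Eblk t B).
Local Notation bpart := (bpart t B).

(** A block as a function of the list of its shifted indices rho_i - i; it alternates in that list,
    hence the name. *)
Definition wedge s f := Eblk (size s) f (nth 0 s).

Lemma wedge_linear s : linear (wedge s).
Proof. exact: Eblk_linear. Qed.

Lemma wedgeZ s x f : wedge s (x *: f) = x *: wedge s f.
Proof.
have L0 : wedge s 0 = 0.
  by have := wedge_linear s (-1) 0 0; rewrite scaler0 addr0 scaleN1r addNr.
by have := wedge_linear s x f 0; rewrite L0 !addr0.
Qed.

Lemma EblkE L f o : Eblk L f o = wedge (mkseq o L) f.
Proof.
rewrite /wedge size_mkseq; apply: Eblk_ext => i iL.
by rewrite nth_mkseq.
Qed.

Lemma bpart_wedge rho f :
  bpart rho f = wedge (mkseq (fun i => (nth 0%N rho i)%:Z - i%:Z) (size rho)) f.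
Proof. by rewrite bpartE EblkE. Qed.

Lemma wedge_swap s1 x y s2 f :
  wedge (s1 ++ x :: y :: s2) f = - wedge (s1 ++ y :: x :: s2) f.
Proof.
rewrite /wedge !size_cat /=.
set L := (_ + _)%N; have iL : (0 <= size s1 < L)%N by rewrite /L; lia.
have jL : (0 <= (size s1).+1 < L)%N by rewrite /L; lia.
have ij : size s1 != (size s1).+1 by lia.
rewrite -(Eblk_anti Blin Bquad _ iL jL ij).
apply: Eblk_ext => i _; rewrite /oswap /sw !nth_cat.
case: (eqVneq i (size s1)) => [->|ne].
  by rewrite ltnn subnn ltnNge leqnSn /= subSnn.
case: (eqVneq i (size s1).+1) => [->|ne1].
  by rewrite ltnNge leqnSn /= subSnn ltnn subnn.
case: ltnP => // ge; have -> : (i - size s1 = (i - (size s1).+2).+2)%N by lia.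
by [].
Qed.

Lemma wedge_move s1 x s2 f :
  wedge (s1 ++ x :: s2) f = (-1) ^+ size s2 *: wedge (s1 ++ rcons s2 x) f.
Proof.
elim: s2 s1 => [|y s2 IH] s1 /=; first by rewrite scale1r.
by rewrite wedge_swap -cat_rcons IH cat_rcons exprS mulN1r scaleNr.
Qed.

Lemma wedge_perm s s' : perm_eq s s' ->
  exists b : bool, forall f, wedge s f = (-1) ^+ b *: wedge s' f.
Proof.
move=> pe; suff [e He] : exists e : nat, forall f, wedge ([::] ++ s) f = (-1) ^+ e *: wedge ([::] ++ s') f.
  by exists (odd e) => f; rewrite signr_odd; apply: He.
elim: s' s pe [::] => [|x s' IH] s pe p.
  by move: (perm_size pe); case: s {pe} => // _; exists 0%N => f; rewrite scale1r.
have xs : x \in s by rewrite (perm_mem pe) mem_head.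
case/splitPr: xs pe => s1 s2 pe.
have pe' : perm_eq (s1 ++ s2) s'.
  by rewrite -(perm_cons x) -(perm_catCA s1 [:: x] s2).
have [e He] := IH _ pe' (rcons p x).
exists (size s1 + e)%N => f; rewrite exprD -scalerA -[p ++ _ :: _]cat_rcons -He cat_rcons.
elim: s1 p f {pe pe' He} => [|y s1 IHs] p f; first by rewrite /= scale1r.
rewrite /= -cat_rcons IHs cat_rcons [wedge (p ++ x :: _) f]wedge_swap.
by rewrite exprS mulN1r scalerN scaleNr opprK.
Qed.

Lemma wedge_nuniq s f : ~~ uniq s -> wedge s f = 0.
Proof.
move/(uniqPn 0) => [i [j [ij js sij]]].
apply: (anti_eq0 F0 (i := i) (j := j)); last exact: sij.
  by apply: (Eblk_anti Blin Bquad f); rewrite ?js ?(ltn_trans ij js) // neq_ltn ij.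
by lia.
Qed.

Section OneRow.
Variables (g : (nat -> int) -> V) (S : pred nat).
Hypothesis ag : forall a b, S a -> S b -> a != b -> anti a b g.

Lemma anti_pair0 a b (s : seq nat) : S a -> S b -> a != b ->
  a \notin 0%N :: s -> b \notin 0%N :: s -> anti a b (kern t (map (pair 0%N) s) g).
Proof.
move=> Sa Sb ab; rewrite !inE !negb_or => /andP[a0 an] /andP[b0 bn].
apply: kern_anti_off; first exact: ag.
move=> _ /mapP[c cs ->] /=; rewrite !(eq_sym 0%N) a0 b0 /=.
by apply/andP; split; [apply: contraNneq an => <- | apply: contraNneq bn => <-].
Qed.

(** Unless entry j is raised it collides with entry q, so e_j survives in the factor e_j - t e_0;
    the raised entry j then takes the role of q for j - 1. *)
Lemma kern_up (l : int) j q o : (j < q)%N -> S q -> (forall y, (0 < y <= j)%N -> S y) ->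
    o q = l - j%:Z -> (forall y, (0 < y <= j)%N -> o y = l - y%:Z) ->
  kern t (map (pair 0%N) (rev (iota 1 j))) g o = g (addon 1 j 1 o).
Proof.
elim: j q o => [|j IH] q o jq Sq Sj oq oy.
  congr g; apply: functional_extensionality => i; rewrite /addon.
  by rewrite ifF ?addr0 //; lia.
rewrite -[j.+1]addn1 iotaD rev_cat /= add1n /kpair /=.
rewrite [X in _ - t *: X](_ : _ = 0); last first.
  apply: (anti_eq0 F0 (i := j.+1) (j := q)).
  - by apply: anti_pair0 => //; rewrite ?inE ?mem_rev ?mem_iota; try apply: Sj; lia.
  - by lia.
  - have q0 : (q == 0)%N = false by lia.
    by rewrite /inc oq oy ?q0 //; lia.
rewrite scaler0 subr0 (IH j.+1) //; first last.
- move=> y yj; have y1 : (y == j.+1) = false by lia.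
  by rewrite /inc y1 addr0 oy //; lia.
- by rewrite /inc eqxx oy; lia.
- by move=> y yj; apply: Sj; lia.
- by apply: Sj; lia.
congr g; apply: functional_extensionality => i; rewrite /addon /inc.
by case: (eqVneq i j.+1) => [->|ne]; do ![case: ifP => ?]; rewrite /=; lia.
Qed.

(** Here a raised entry y collides with entry q, so only - t e_0 survives; entry y, left where it
    is, takes the role of q for y + 1. *)
Lemma kern_down (l : int) d y q o : S q -> q \notin 0%N :: iota y d -> (0 < y)%N ->
    (forall i, (y <= i < y + d)%N -> S i) ->
    o q = l - y%:Z + 1 -> (forall i, (y <= i < y + d)%N -> o i = l - i%:Z) ->
  kern t (map (pair 0%N) (iota y d)) g o = (- t) ^+ d *: g (addon 0 1 d%:Z o).
Proof.
elim: d y q o => [|d IH] y q o Sq qn y0 Sy oq oy.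
  rewrite scale1r; congr g; apply: functional_extensionality => i; rewrite /addon.
  by case: ifP; rewrite addr0.
move: (qn); rewrite !inE !mem_iota => qn'.
rewrite /= /kpair /= [X in X - _](_ : _ = 0); last first.
  apply: (anti_eq0 F0 (i := y) (j := q)).
  - by apply: anti_pair0 => //; rewrite ?inE ?mem_iota; try apply: Sy; lia.
  - by lia.
  - have q1 : (q == y) = false by lia.
    by rewrite /inc oq oy ?eqxx ?q1 //; lia.
rewrite sub0r (IH y.+1 y) //; first last.
- move=> i iy; have i0 : (i == 0)%N = false by lia.
  by rewrite /inc i0 addr0 oy //; lia.
- have y1 : (y == 0)%N = false by lia.
  by rewrite /inc y1 oy //; lia.
- by move=> i iy; apply: Sy; lia.
- by rewrite !inE !mem_iota; lia.
- by apply: Sy; lia.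
rewrite exprS mulNr scaleNr -scalerA; congr (- (_ *: (_ *: g _))).
apply: functional_extensionality => i; rewrite /addon /inc.
by case: (eqVneq i 0%N) => [->|ne] /=; do ?[case: ifP]; lia.
Qed.
End OneRow.

(* The single row collides with the rectangle, so that one of the two terms of
   each factor 1 - t e_ab vanishes. *)
Lemma rect_comm (l c h : nat) f : (l <= c < l + h)%N ->
  bpart (nseq h l) (B c%:Z f) = t ^+ (c - l) *: B c%:Z (bpart (nseq h l) f).
Proof.
(* The lone row enters the exchanged kernel with the index c - (h - 1) = l - j, which is entry j of
   the rectangle; this coincidence decides every factor. *)
move=> lch; pose e := (c - l)%N; pose j := (h.-1 - e)%N.
have bR f' : bpart (nseq h l) f' = Eblk h f' (fun i => l%:Z - i%:Z).
  rewrite bpartE size_nseq; apply: Eblk_ext => i ih.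
  by rewrite nth_nseq ih.
have B1 o f' : Eblk 1 f' o = B (o 0%N) f' by [].
rewrite bR -[B c f](B1 (fun _ => c%:Z)) (Eblk_exchange F0 Blin Bquad); last by lia.
set G := fun o => _; set o0 := fun i : nat => _.
have aG a b : (0 < a <= h)%N -> (0 < b <= h)%N -> a != b -> anti a b G.
  move=> ah bh ab o; rewrite /G !B1.
  have -> : oswap a b o 0%N = o 0%N by rewrite /oswap /sw !ifF //; lia.
  have L := Eblk_linear; rewrite -[RHS]scaleN1r.
  have BZ x f' : B (o 0%N) (x *: f') = x *: B (o 0%N) f'.
    by have := bwordZ Blin [:: o 0%N] x f'.
  rewrite -BZ scaleN1r; congr (B _ _).
  have ab' : (a.-1 != b.-1)%N by lia.
  have a' : (0 <= a.-1 < h)%N by lia.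
  have b' : (0 <= b.-1 < h)%N by lia.
  rewrite -(Eblk_anti Blin Bquad f a' b' ab'); apply: Eblk_ext => i ih.
  rewrite /oswap !add1n; congr o; rewrite /sw.
  by do ![case: eqP => ?]; lia.
have pe : perm_eq (rect (iota 0 1) (iota 1 (h - 1)))
    (map (pair 0%N) (rev (iota 1 j)) ++ map (pair 0%N) (iota j.+1 e)).
  rewrite /rect /= cats0 -map_cat; apply: perm_map.
  rewrite perm_sym; apply: perm_trans (_ : perm_eq (iota 1 j ++ iota j.+1 e) _).
    by rewrite perm_cat2r perm_rev.
  rewrite -add1n -iotaD (_ : j + e = h - 1)%N //; lia.
rewrite (kern_perm _ _ pe) kern_cat.
have aG' a b : (0 < a <= j)%N || (a == h) -> (0 < b <= j)%N || (b == h) -> a != b ->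
    anti a b (kern t (map (pair 0%N) (iota j.+1 e)) G).
  move=> ah bh ab; apply: (anti_pair0 (S := fun a => 0 < a <= h)%N) => //; try by lia.
  - by rewrite !inE mem_iota; lia.
  - by rewrite !inE mem_iota; lia.
rewrite (@kern_up _ _ aG' l%:Z j h); try by rewrite ?eqxx ?orbT //; lia.
- rewrite (@kern_down _ _ aG l%:Z e j.+1 h); try by lia.
  + rewrite {1}/G B1.
    set s1 := mkseq (fun i => l%:Z - i%:Z) j.
    set s2 := mkseq (fun i => l%:Z - (j.+1 + i)%N%:Z) e.
    rewrite (_ : addon _ _ _ _ _ = c%:Z); last first.
      by rewrite /addon /o0 /=; rewrite ifT; lia.
    rewrite (_ : Eblk h f _ = wedge (s1 ++ rcons s2 (l%:Z - j%:Z)) f); last first.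
      rewrite EblkE; congr wedge; apply: (@eq_from_nth _ 0).
        by rewrite size_mkseq size_cat size_rcons !size_mkseq; lia.
      move=> i; rewrite size_mkseq => ih; rewrite nth_mkseq // nth_cat size_mkseq.
      rewrite /addon /o0; case: (ltnP i j) => ij.
        by rewrite nth_mkseq //; do ![case: ifP => ?]; rewrite /=; lia.
      rewrite nth_rcons size_mkseq; case: (ltnP (i - j) e) => ie.
        by rewrite nth_mkseq //; do ![case: ifP => ?]; rewrite /=; lia.
      by do ![case: ifP => ?]; rewrite /=; lia.
    have -> : bpart (nseq h l) f = wedge (s1 ++ (l%:Z - j%:Z) :: s2) f.
      rewrite bR EblkE; congr wedge; apply: (@eq_from_nth _ 0).
        by rewrite size_mkseq size_cat /= !size_mkseq; lia.
      move=> i; rewrite size_mkseq => ih; rewrite nth_mkseq // nth_cat size_mkseq.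
      case: (ltnP i j) => ij; first by rewrite nth_mkseq.
      case: (eqVneq i j) => [->|ne]; first by rewrite subnn.
      by rewrite (_ : i - j = (i - j.+1).+1)%N /= ?nth_mkseq; lia.
    (* Putting l - j back into its place costs (-1)^e, which turns (- t)^e into t^e. *)
    rewrite wedge_move size_mkseq.
    have -> : B c ((-1) ^+ e *: wedge (s1 ++ rcons s2 (l%:Z - j%:Z)) f) =
        (-1) ^+ e *: B c (wedge (s1 ++ rcons s2 (l%:Z - j%:Z)) f).
      exact: (bwordZ Blin [:: c%:Z]).
    by rewrite scalerA; congr (_ *: _); rewrite -/e mulrC -exprMn mulN1r.
  + by rewrite !inE mem_iota; lia.
  + by rewrite /addon /o0; do ![case: ifP => ?]; rewrite /=; lia.
  + by move=> i ie; rewrite /addon /o0; do ![case: ifP => ?]; rewrite /=; lia.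
- by rewrite /o0 ifF; lia.
- by move=> y yj; rewrite /o0 ifT; lia.
Qed.
End Wedge.

(** * Exchanging a rectangle with a block *)

Lemma prod_ipairs_vandermonde (R : comNzRingType) (x : nat -> R) lo n :
  \prod_(p <- ipairs lo n) (x p.2 - x p.1) =
  \sum_(s : 'S_n) (-1) ^+ s * \prod_(i < n) x (lo + i)%N ^+ s i.
Proof.
transitivity (\prod_(i < n) \prod_(j < n | (i < j)%N) (x (lo + j)%N - x (lo + i)%N)).
  rewrite /ipairs big_allpairs_dep -[lo in iota lo n]addn0 iotaDl big_map.
  rewrite -{1}[n]subn0 -/(index_iota 0 n) big_mkord; apply: eq_bigr => i _ /=.
  have -> : iota (lo + i).+1 (lo + n - (lo + i).+1) = map (addn lo) (index_iota i.+1 n).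
    by rewrite /index_iota -iotaDl addnS; congr iota; lia.
  by rewrite big_map big_geq_mkord; apply: eq_bigl.
have := det_Vandermonde (\row_(i < n) x (lo + i)%N).
rewrite -det_tr /determinant => E.
transitivity (\prod_(i < n) \prod_(j < n | (i < j)%N)
    ((\row_(i < n) x (lo + i)%N) 0 j - (\row_(i < n) x (lo + i)%N) 0 i)).
  by apply: eq_bigr => i _; apply: eq_bigr => j _; rewrite !mxE.
rewrite -E; apply: eq_bigr => s _; congr (_ * _); apply: eq_bigr => i _.
by rewrite !mxE.
Qed.

Section Shift.
Variables (F : fieldType) (F0 : [pchar F] =i pred0) (t : F) (V : lmodType F).
Implicit Types (o : nat -> int) (g : (nat -> int) -> V).

(* sym F serves here merely as the polynomial ring in the raising operators e_0, e_1, ... *)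
Definition raise_by (p : sym F) g o : V :=
  \sum_(c <- msupp p) p@_c *: g (fun i => o i + (c i)%:Z).

Lemma raise_byEw (d : {fset {cmonom nat}}) (p : sym F) g o : fsubset (msupp p) d ->
  raise_by p g o = \sum_(c <- d) p@_c *: g (fun i => o i + (c i)%:Z).
Proof.
move=> sub; rewrite /raise_by (big_fset_incl _ sub) //= => c _ /mcoeff_outdom ->.
by rewrite scale0r.
Qed.

Lemma raise_byD (p q : sym F) g o :
  raise_by (p + q) g o = raise_by p g o + raise_by q g o.
Proof.
rewrite (raise_byEw g o (msuppD_le p q)) (raise_byEw g o (fsubsetUl (msupp p) (msupp q))).
rewrite (raise_byEw g o (fsubsetUr (msupp p) (msupp q))) -big_split /=.
by apply: eq_bigr => c _; rewrite mcoeffD scalerDl.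
Qed.

Lemma raise_byZ x (p : sym F) g o : raise_by (x *: p) g o = x *: raise_by p g o.
Proof.
rewrite (raise_byEw g o (msuppZ_le x p)) /raise_by scaler_sumr.
by apply: eq_bigr => c _; rewrite mcoeffZ scalerA.
Qed.

Lemma raise_byU (m : {cmonom nat}) g o :
  raise_by << m >> g o = g (fun i => o i + (m i)%:Z).
Proof.
rewrite (raise_byEw g o msuppU_le) big_seq_fset1; transitivity (1 *: g (fun i => o i + (m i)%:Z)).
  by apply: (congr1 (fun z => z *: _)); rewrite mcoeffU1 eqxx.
exact: scale1r.
Qed.

Lemma raise_by1 g o : raise_by 1 g o = g o.
Proof.
transitivity (raise_by << mone >> g o); first by [].
rewrite raise_byU; congr g; apply: functional_extensionality => i.
by rewrite cm1 addr0.
Qed.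

Lemma raise_byX a (p : sym F) g o :
  raise_by (<< ucm a >> * p) g o = raise_by p g (inc o a).
Proof.
elim/sym_ind: p => [u v IHu IHv|x u IH|m].
- transitivity (raise_by (<< ucm a >> * u + << ucm a >> * v) g o).
    by apply: (congr1 (fun z => raise_by z g o)); apply: mulrDr.
  transitivity (raise_by (<< ucm a >> * u) g o + raise_by (<< ucm a >> * v) g o).
    exact: raise_byD.
  by rewrite raise_byD; apply: f_equal2.
- transitivity (raise_by (x *: (<< ucm a >> * u)) g o).
    by apply: (congr1 (fun z => raise_by z g o)); exact/esym/scalerAr.
  transitivity (x *: raise_by (<< ucm a >> * u) g o); first exact: raise_byZ.
  by rewrite raise_byZ; apply: congr1.
transitivity (raise_by << mmul (ucm a) m >> g o).
  by apply: (congr1 (fun z => raise_by z g o)); apply: malgUM.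
rewrite [LHS]raise_byU [RHS]raise_byU; congr g; apply: functional_extensionality => i.
by rewrite /inc cmM cmU eq_sym PoszD addrA.
Qed.
End Shift.

Section VandermondeKernel.
Variables (F : fieldType) (F0 : [pchar F] =i pred0) (t : F) (V : lmodType F).
Implicit Types (o : nat -> int) (g : (nat -> int) -> V) (u : nat -> F).

(** The kernel over all pairs becomes a Vandermonde product in the variables u_a e_a. With weight t
    on one group and 1 on the other, the mixed pairs give the factors e_b - t e_a. *)
Definition wpair u (p : nat * nat) g o : V :=
  u p.2 *: g (inc o p.2) - u p.1 *: g (inc o p.1).

Definition wkern u (s : seq (nat * nat)) g := foldr (wpair u) g s.

Section Poly.
Variables (P : comAlgType F) (X : nat -> P).
Variable act : P -> ((nat -> int) -> V) -> (nat -> int) -> V.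
Hypothesis actD : forall p q g o, act (p + q) g o = act p g o + act q g o.
Hypothesis actZ : forall x p g o, act (x *: p) g o = x *: act p g o.
Hypothesis act1 : forall g o, act 1 g o = g o.
Hypothesis actX : forall a p g o, act (X a * p) g o = act p g (inc o a).

Lemma wkern_act u s g o :
  wkern u s g o = act (\prod_(p <- s) (u p.2 *: X p.2 - u p.1 *: X p.1)) g o.
Proof.
elim: s o => [|p s IH] o; first by rewrite big_nil act1.
rewrite big_cons mulrBl -!scalerAl -scaleNr actD !actZ !actX -!IH scaleNr.
by [].
Qed.

Lemma act_exp a e p g o : act (X a ^+ e * p) g o =
  act p g (fun i => o i + (if i == a then e else 0%N)%:Z).
Proof.
elim: e o => [|e IH] o.
  rewrite expr0 mul1r; congr act; apply: functional_extensionality => i.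
  by rewrite if_same addr0.
rewrite exprS -mulrA actX IH; congr act; apply: functional_extensionality => i.
by rewrite /inc; case: eqP => _ /=; lia.
Qed.

Lemma wkern_vandermonde_poly u lo n g o : wkern u (ipairs lo n) g o =
  \sum_(s : 'S_n) ((-1) ^+ s * \prod_(i < n) u (lo + i)%N ^+ s i) *:
    g (fun j => o j + (\sum_(i < n | (lo + i == j)%N) s i)%N%:Z).
Proof.
rewrite wkern_act (prod_ipairs_vandermonde (fun a => u a *: X a)).
have A0 : act 0 g o = 0 by have := actZ 0 0 g o; rewrite !scale0r.
rewrite (big_morph (fun p => act p g o) (fun p q => actD p q g o) A0).
apply: eq_bigr => s _.
have -> : (-1) ^+ s * \prod_(i < n) (u (lo + i)%N *: X (lo + i)%N) ^+ s i =
    ((-1) ^+ s * \prod_(i < n) u (lo + i)%N ^+ s i) *: \prod_(i < n) X (lo + i)%N ^+ s i.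
  rewrite -scalerA; under eq_bigr do rewrite exprZn.
  rewrite scaler_prod; case: (odd_perm s); rewrite ?expr0 ?expr1 ?mul1r ?scale1r //.
  by rewrite mulN1r scaleN1r.
rewrite actZ; congr (_ *: _).
rewrite -[\prod_(i < n) _]mulr1; move: (index_enum _) => r.
have E : act (\prod_(i <- r) X (lo + i)%N ^+ s i * 1) g o =
    g (fun j => o j + (\sum_(i <- r | (lo + i == j)%N) s i)%N%:Z).
  elim: r o {A0} => [|i r IH] o.
    rewrite big_nil mulr1 act1; congr g; apply: functional_extensionality => j.
    by rewrite big_nil addr0.
  rewrite big_cons -mulrA act_exp IH; congr g; apply: functional_extensionality => j.
  by rewrite big_cons eq_sym; case: ifP => _; lia.
by rewrite E.
Qed.
End Poly.

Lemma wkern_vandermonde u lo n g o : wkern u (ipairs lo n) g o =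
  \sum_(s : 'S_n) ((-1) ^+ s * \prod_(i < n) u (lo + i)%N ^+ s i) *:
    g (fun j => o j + (\sum_(i < n | (lo + i == j)%N) s i)%N%:Z).
Proof.
apply: (@wkern_vandermonde_poly (sym F) (fun a => << ucm a >>) (@raise_by F V)).
- exact: raise_byD.
- exact: raise_byZ.
- exact: raise_by1.
- exact: raise_byX.
Qed.

Lemma wkern_perm u s1 s2 g : perm_eq s1 s2 -> wkern u s1 g = wkern u s2 g.
Proof.
move=> pe; apply: functional_extensionality => o.
have W := @wkern_act (sym F) (fun a => << ucm a >>) (@raise_by F V)
  (@raise_byD F V) (@raise_byZ F V) (@raise_by1 F V) (@raise_byX F V).
by rewrite !W (perm_big _ pe).
Qed.
End VandermondeKernel.

(** The effect of one Vandermonde monomial, with the exponents s(0), ..., s(n-1), on the entries lo,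
    ..., lo + n - 1. *)
Definition addp lo n (s : 'S_n) (o : nat -> int) : nat -> int :=
  fun j => o j + (\sum_(i < n | (lo + i == j)%N) s i)%N%:Z.

Lemma addp_in lo n (s : 'S_n) (o : nat -> int) (i : 'I_n) :
  addp lo s o (lo + i)%N = o (lo + i)%N + (s i)%:Z.
Proof.
rewrite /addp (big_pred1 i) // => j; rewrite eqn_add2l.
by apply/eqP/eqP => [/val_inj|->].
Qed.

Lemma addp_out lo n (s : 'S_n) (o : nat -> int) j : ~~ (lo <= j < lo + n)%N -> addp lo s o j = o j.
Proof.
move=> nj; rewrite /addp big_pred0 ?addr0 // => i; apply: contraNF nj => /eqP <-.
by have := ltn_ord i; lia.
Qed.

Lemma addp_tperm lo n (s : 'S_n) (o : nat -> int) a (x y : 'I_n) :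
    (forall i, (lo <= i < lo + n)%N -> o i = a) ->
  addp lo (tperm x y * s)%g o = oswap (lo + x)%N (lo + y)%N (addp lo s o).
Proof.
move=> oa; apply: functional_extensionality => j; rewrite /oswap.
have [jin|jout] := boolP (lo <= j < lo + n)%N; last first.
  have sj : sw (lo + x)%N (lo + y)%N j = j.
    by have := ltn_ord x; have := ltn_ord y; rewrite /sw; do ![case: eqP => ?]; lia.
  by rewrite sj !addp_out.
have jn : (j - lo < n)%N by lia.
have -> : j = (lo + Ordinal jn)%N by rewrite /=; lia.
have -> : sw (lo + x)%N (lo + y)%N (lo + Ordinal jn)%N = (lo + tperm x y (Ordinal jn))%N.
  rewrite /sw !eqn_add2l; case: tpermP => [->|->|xj yj]; rewrite ?eqxx //.
    by case: eqP => // ->.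
  rewrite ifF; last by apply/eqP => /val_inj.
  by rewrite ifF //; apply/eqP => /val_inj.
rewrite !addp_in permM !oa //.
  by have := ltn_ord (tperm x y (Ordinal jn)); lia.
by rewrite /=; lia.
Qed.

Section Exchange.
Variables (F : fieldType) (F0 : [pchar F] =i pred0) (t : F) (t0 : t != 0) (V : lmodType F).
Implicit Types (o : nat -> int) (g : (nat -> int) -> V) (u : nat -> F).

Lemma anti_perm lo n (s : 'S_n) g o a : antion lo (lo + n) g ->
    (forall i, (lo <= i < lo + n)%N -> o i = a) ->
  g (addp lo s o) = (-1) ^+ s *: g (addp lo (1 : 'S_n)%g o).
Proof.
move=> ag oa; have [ts -> /= al] := prod_tpermP s.
elim: ts al => [_|[x y] ts IH /= /andP[xy al]].
  by rewrite big_nil odd_perm1 scale1r.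
rewrite big_cons (addp_tperm _ _ _ oa) ag; last 3 first.
- by rewrite /=; have := ltn_ord x; lia.
- by rewrite /=; have := ltn_ord y; lia.
- by rewrite eqn_add2l.
by rewrite IH // odd_mul_tperm xy signr_addb expr1 mulN1r scaleNr.
Qed.

(** From a constant starting point all n! Vandermonde terms agree: the sign of s in the determinant
    cancels the one from antisymmetry. *)
Lemma wkern_anti_const u (w : F) lo n g o a : antion lo (lo + n) g ->
    (forall i, (lo <= i < lo + n)%N -> o i = a) ->
    (forall i, (lo <= i < lo + n)%N -> u i = w) ->
  wkern u (ipairs lo n) g o =
    (n`!%:R * w ^+ (\sum_(i < n) i)) *: g (addp lo (1 : 'S_n)%g o).
Proof.
move=> ag oa uw; rewrite wkern_vandermonde.
rewrite (eq_bigr (fun _ => w ^+ (\sum_(i < n) i) *: g (addp lo (1 : 'S_n)%g o))).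
  by rewrite sumr_const card_Sn -scaler_nat scalerA.
move=> s _; rewrite -/(addp lo s o) (anti_perm s ag oa) scalerA mulrAC.
rewrite -expr2 sqrr_sign mul1r; congr (_ *: _).
rewrite (eq_bigr (fun i => w ^+ s i)); last first.
  by move=> i _; rewrite uw //; have := ltn_ord i; lia.
by rewrite prodrXr; congr (_ ^+ _); rewrite [RHS](reindex_inj (@perm_inj _ s)).
Qed.

Lemma kern_wkern u s g : (forall p, p \in s -> u p.1 = t /\ u p.2 = 1) ->
  kern t s g = wkern u s g.
Proof.
elim: s => //= p s IH H; rewrite IH => [|q qs]; last by apply: H; rewrite inE qs orbT.
apply: functional_extensionality => o; rewrite /kpair /wpair.
by have [-> ->] := H p (mem_head _ _); rewrite scale1r.
Qed.

(* The antisymmetrized kernel prod (y - t z) over consecutive exponents is the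
   Vandermonde determinant in the variables t z, y: its monomials have the
   exponents 0, ..., m + n - 1, each exactly once. *)
Lemma kern_rect_span m n g (a b : int) o :
    antion 0 m g -> antion m (m + n) g ->
    (forall i, (i < m)%N -> o i = a) -> (forall i, (m <= i < m + n)%N -> o i = b) ->
  exists c : 'S_(m + n) -> F,
    kern t (rect (iota 0 m) (iota m n)) g
      (fun i => if (i < m)%N then a + (m - i.+1)%N%:Z
                else if (i < m + n)%N then b + (m + n - i.+1)%N%:Z else o i) =
    \sum_(s : 'S_(m + n)) c s *: g (addp 0 s o).
Proof.
move=> ag1 ag2 oa ob; set G := kern t _ g; set o' := fun i : nat => _.
pose u i := if (i < m)%N then t else 1.
have GW : G = wkern u (rect (iota 0 m) (iota m n)) g.
  apply: kern_wkern => -[x y]; rewrite mem_rect /= => H.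
  by rewrite /u ifT ?ifF //; lia.
have aG1 : antion 0 m G.
  move=> i j im jm ij; apply: kern_anti; first exact: ag1.
  apply: map_swp_perm; first exact: uniq_rect.
  move=> [x y]; rewrite !mem_rect /= /sw.
  by do ![case: (eqVneq x _) => ?]; do ![case: (eqVneq y _) => ?]; lia.
have aG2 : antion m (m + n) G.
  move=> i j im jm ij; apply: kern_anti; first exact: ag2.
  apply: map_swp_perm; first exact: uniq_rect.
  move=> [x y]; rewrite !mem_rect /= /sw.
  by do ![case: (eqVneq x _) => ?]; do ![case: (eqVneq y _) => ?]; lia.
pose o1 := addp m (1 : 'S_n)%g (addp 0 (1 : 'S_m)%g o).
have [e Ee] : exists e : bool, G o' = (-1) ^+ e *: G o1.
  (* The decreasing staircases of [o'] are those of [o1] reversed within each group, so antisymmetry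
     of [G] gives a sign. *)
  pose r1 : 'S_m := perm (@rev_ord_inj m); pose r2 : 'S_n := perm (@rev_ord_inj n).
  exists (r2 (+) r1).
  have -> : o' = addp m r2 (addp 0 r1 o).
    apply: functional_extensionality => i; rewrite /o'.
    case: (ltnP i m) => im.
      rewrite addp_out; last by lia.
      have -> : i = (0 + Ordinal im)%N by [].
      by rewrite addp_in permE oa.
    case: (ltnP i (m + n)) => imn; last by rewrite !addp_out //; lia.
    have jn : (i - m < n)%N by lia.
    have -> : i = (m + Ordinal jn)%N by rewrite /=; lia.
    rewrite addp_in permE addp_out ?ob /=; lia.
  have c2 i : (m <= i < m + n)%N -> addp 0 r1 o i = b.
    by move=> H; rewrite addp_out ?ob //; lia.
  rewrite (anti_perm _ aG2 c2).
  have ag1' : antion 0 (0 + m) (fun o => G (addp m (1 : 'S_n)%g o)).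
    move=> i j im jm ij o2; rewrite -(aG1 i j im jm ij); congr G.
    apply: functional_extensionality => k; rewrite /addp /oswap; congr (_ + _%:Z).
    have [kin|kout] := boolP (m <= k)%N.
      by rewrite (_ : sw i j k = k) // /sw; do ![case: eqP => ?]; lia.
    have swk : (sw i j k < m)%N by rewrite /sw; do ![case: eqP => ?]; lia.
    by rewrite !big_pred0 // => l; lia.
  rewrite (anti_perm (g := fun o => G (addp m (1 : 'S_n)%g o)) r1 ag1' (a := a)); last first.
    by move=> i im; apply: oa; lia.
  by rewrite scalerA signr_addb.
(* The Vandermonde product over all pairs is the mixed kernel times the products of the two groups;
   these start from constant entries and contribute only a scalar. *)
have K : wkern u (ipairs 0 (m + n)) g o =
    ((m`!%:R * t ^+ (\sum_(i < m) i)) * n`!%:R) *: G o1.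
  have pe : perm_eq (ipairs 0 (m + n))
      (ipairs 0 m ++ ipairs m n ++ rect (iota 0 m) (iota m n)).
    apply: uniq_perm; first exact: uniq_ipairs.
      rewrite !cat_uniq uniq_rect !uniq_ipairs /= andbT; apply/andP; split.
        by apply/hasPn => -[x y]; rewrite mem_cat !mem_ipairs mem_rect; lia.
      by apply/hasPn => -[x y]; rewrite !mem_ipairs mem_rect; lia.
    by move=> [x y]; rewrite !mem_cat !mem_ipairs mem_rect; lia.
  rewrite (wkern_perm _ _ pe) /wkern !foldr_cat -!/(wkern u _ _) -GW.
  have H2 o2 : (forall i, (m <= i < m + n)%N -> o2 i = b) ->
      wkern u (ipairs m n) G o2 = n`!%:R *: G (addp m (1 : 'S_n)%g o2).
    move=> ob2; rewrite (wkern_anti_const (w := 1) aG2 ob2) ?expr1n ?mulr1 //.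
    by move=> i im; rewrite /u ifF //; lia.
  have ag1' : antion 0 (0 + m) (wkern u (ipairs m n) G).
    move=> i j im jm ij o2; rewrite !wkern_vandermonde -sumrN.
    apply: eq_bigr => s _; rewrite -scalerN; congr (_ *: _).
    rewrite -(aG1 i j im jm ij); congr G; apply: functional_extensionality => k.
    rewrite /oswap; congr (_ + _%:Z).
    have [kin|kout] := boolP (m <= k)%N.
      by rewrite (_ : sw i j k = k) // /sw; do ![case: eqP => ?]; lia.
    have swk : (sw i j k < m)%N by rewrite /sw; do ![case: eqP => ?]; lia.
    by rewrite !big_pred0 // => l; lia.
  rewrite (wkern_anti_const (w := t) (a := a) ag1').
  - rewrite H2 ?scalerA // => i im.
    by rewrite addp_out ?ob //; lia.
  - by move=> i im; apply: oa; lia.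
  - by move=> i im; rewrite /u ifT //; lia.
set kap := _ * _ in K.
(* The scalar is m! n! t^(m(m-1)/2): this is where dividing by it requires characteristic 0 and t <>
   0. *)
have kap0 : kap != 0.
  by rewrite !mulf_neq0 ?expf_neq0 //; move/pcharf0P: F0 => ->; rewrite -lt0n fact_gt0.
rewrite wkern_vandermonde in K.
exists (fun s : 'S_(m + n) => (-1) ^+ e * (kap^-1 *
  ((-1) ^+ s * \prod_(i < m + n) u (0 + i)%N ^+ s i))).
have -> : G o' = ((-1) ^+ e * kap^-1) *: (kap *: G o1).
  by rewrite scalerA mulfVK // Ee.
rewrite -K scaler_sumr; apply: eq_bigr => s _; rewrite scalerA -!mulrA.
by [].
Qed.
End Exchange.

(** * Partitions through their shifted parts *)

Definition sidx (a : seq nat) : seq int :=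
  mkseq (fun i => (nth 0%N a i)%:Z - i%:Z) (size a).

Lemma sorted_gt_nth (s : seq int) i j : sorted >%R s -> (i <= j < size s)%N ->
  s`_j <= s`_i - (j - i)%N%:Z.
Proof.
move=> ss; elim: j => [|j IH] /andP[ij js].
  have -> : i = 0%N by lia.
  by rewrite subr0.
have [e|ne] := eqVneq i j.+1; first by rewrite e subnn subr0.
have := IH _; have -> : (i <= j < size s)%N by lia.
move=> /(_ isT) h1.
have h2 : s`_j.+1 < s`_j.
  have tr : transitive (>%R : rel int) by move=> x y z xy yz; apply: lt_trans yz xy.
  by apply: (sorted_ltn_nth tr 0 ss); rewrite ?inE /=; lia.
by lia.
Qed.

(** Sorted decreasingly, distinct integers satisfy s_i >= s_last + (size - 1 - i) >= -i, so the s_i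
    + i are natural numbers, and they decrease weakly. *)
Lemma sort_sidx (s : seq int) : uniq s -> (forall x, x \in s -> 1 - (size s)%:Z <= x) ->
  exists a, [/\ sorted geq a, size a = size s & perm_eq s (sidx a)].
Proof.
move=> us lb; pose s' := rev (sort <=%O s).
have pe : perm_eq s' s by rewrite perm_rev perm_sort.
have ss : sorted >%R s'.
  by rewrite rev_sorted (_ : sorted _ _ = uniq s) // -sort_lt_sorted.
have sz : size s' = size s by rewrite size_rev size_sort.
have pos i : (i < size s)%N -> 0 <= s'`_i + i%:Z.
  move=> si; have := @sorted_gt_nth s' i (size s).-1 ss; rewrite sz.
  have -> : (i <= (size s).-1 < size s)%N by lia.
  move=> /(_ isT); have := lb s'`_(size s).-1.
  by rewrite -(perm_mem pe) mem_nth ?sz; last lia; move=> /(_ isT); lia.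
exists (mkseq (fun i => absz (s'`_i + i%:Z)) (size s)).
rewrite size_mkseq; split=> //.
  apply/(sortedP 0%N) => i; rewrite size_mkseq => si.
  rewrite !nth_mkseq //; last by lia.
  have := @sorted_gt_nth s' i i.+1 ss; rewrite sz leqnSn si => /(_ isT).
  by have := pos i; have := pos i.+1; rewrite si /= => /(_ isT); lia.
rewrite perm_sym; apply: perm_trans pe; rewrite (_ : sidx _ = s') //.
apply: (@eq_from_nth _ 0) => [|i]; first by rewrite /sidx !size_mkseq sz.
rewrite /sidx !size_mkseq => si; rewrite !nth_mkseq //.
by have := pos i si; lia.
Qed.

Lemma sidx_ge a i j : sorted geq a -> (i <= j < size a)%N ->
  (nth 0%N a j <= nth 0%N a i)%N.
Proof.
move=> sa /andP[ij ja]; have tr : transitive geq by move=> x y z yx zy; apply: leq_trans zy yx.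
have re : reflexive geq by move=> x; apply: leqnn.
by apply: (sorted_leq_nth tr re 0%N sa) => //; rewrite inE; lia.
Qed.

Lemma mem_sidx a i : (i < size a)%N -> (nth 0%N a i)%:Z - i%:Z \in sidx a.
Proof. by move=> ia; apply: map_f; rewrite mem_iota. Qed.

Lemma sidxP a x : x \in sidx a ->
  exists2 i, (i < size a)%N & x = (nth 0%N a i)%:Z - i%:Z.
Proof. by case/mapP => i; rewrite mem_iota => ia ->; exists i. Qed.

Lemma sidx_head a (M : nat) : sorted geq a -> M%:Z \in sidx a ->
  (forall x, x \in sidx a -> x <= M%:Z) -> head 0%N a = M.
Proof.
move=> sa /sidxP[i ia Me] ub; rewrite -nth0.
have := ub _ (@mem_sidx a 0 _); have -> : (0 < size a)%N by lia.
move=> /(_ isT); have := @sidx_ge a 0 i sa; rewrite ia => /(_ isT).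
by move: Me; set x := nth _ _ i; set y := nth _ _ 0; lia.
Qed.

Lemma sidx_last a (x : int) : sorted geq a -> (0 < size a)%N -> x \in sidx a ->
  (forall y, y \in sidx a -> x <= y) -> (last 0%N a)%:Z = x + (size a).-1%:Z.
Proof.
move=> sa a0 /sidxP[i ia xe] lb; rewrite -nth_last.
have := lb _ (@mem_sidx a (size a).-1 _); have -> : ((size a).-1 < size a)%N by lia.
move=> /(_ isT); have := @sidx_ge a i (size a).-1 sa.
have -> : (i <= (size a).-1 < size a)%N by lia.
move=> /(_ isT); have [e|ne] := eqVneq i (size a).-1.
  by rewrite -e; move: xe; set y := nth _ _ i; lia.
by move: xe; set y := nth _ _ i; set z := nth _ _ _; lia.
Qed.

Lemma sidx_sorted_lt a i j : sorted geq a -> (i < j < size a)%N ->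
  (nth 0%N a j)%:Z - j%:Z < (nth 0%N a i)%:Z - i%:Z.
Proof.
move=> sa ij; have := @sidx_ge a i j sa; have -> : (i <= j < size a)%N by lia.
by move=> /(_ isT); lia.
Qed.

(** Strictly decreasing entries in a window of as many integers fill it. *)
Lemma sidx_rect a (l : nat) : sorted geq a ->
  (forall x, x \in sidx a -> l%:Z - (size a)%:Z + 1 <= x <= l%:Z) -> a = nseq (size a) l.
Proof.
move=> sa bd; apply: (@eq_from_nth _ 0%N) => [|i ia]; first by rewrite size_nseq.
rewrite nth_nseq ia.
have := bd _ (@mem_sidx a 0 _); have := bd _ (@mem_sidx a (size a).-1 _).
have -> : ((size a).-1 < size a)%N by lia.
have -> : (0 < size a)%N by lia.
move=> /(_ isT) h1 /(_ isT) h2.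
have := @sidx_ge a 0 i sa; rewrite ia => /(_ isT).
have := @sidx_ge a i (size a).-1 sa; have -> : (i <= (size a).-1 < size a)%N by lia.
move=> /(_ isT); move: h1 h2; move: (nth _ _ 0) (nth _ _ _) (nth _ _ i) => x y z; lia.
Qed.

Section ExchangeTerms.
Variables (F : fieldType) (F0 : [pchar F] =i pred0) (t : F) (t0 : t != 0) (V : lmodType F).
Variable B : int -> V -> V.
Hypothesis Blin : forall n, linear (B n).
Hypothesis Bquad : forall m n f,
  B m (B n f) - t *: B (m + 1) (B (n - 1) f) =
  - (B (n - 1) (B (m + 1) f) - t *: B n (B m f)).
Local Notation Eblk := (Eblk t B).
Local Notation bpart := (bpart t B).
Local Notation wedge := (wedge t B).
Variables (m n l : nat) (d : seq nat).

(* Positions i < m hold the first block and positions m <= i < m + n the rows of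
   the second one that do not come from d; the permutation s distributes the
   Vandermonde exponents 0, ..., m + n - 1 among all of these. *)
Definition exch_base (i : nat) : int :=
  if (i < m)%N then l%:Z - m%:Z + 1 else if (i < m + n)%N then l%:Z - (m + n)%N%:Z + 1
  else (nth 0%N d (i - (m + n)))%:Z - (i - (m + n))%N%:Z - n%:Z.

Definition exch_term (s : 'S_(m + n)) (f : V) : V :=
  Eblk m (Eblk (m + n) f (fun i => addp 0 s exch_base (m + i)%N)) (addp 0 s exch_base).

(** Adding the decreasing staircases of [kern_rect_span] to [exch_base] gives l - i at every
    position below m + n, which is the starting point of [Eblk_exchange]. *)
Lemma exchange_bpart f : size d = m -> exists c : 'S_(m + n) -> F,
  bpart (nseq (m + n) l) (bpart d f) = \sum_(s : 'S_(m + n)) c s *: exch_term s f.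
Proof.
move=> sd; set Xi := fun o : nat -> int => Eblk m (Eblk (m + n) f (fun i => o (m + i)%N)) o.
have aXi1 : antion 0 m Xi.
  move=> i j im jm ij o; rewrite /Xi.
  have -> : (fun e => oswap i j o (m + e)%N) = (fun e => o (m + e)%N).
    apply: functional_extensionality => e; rewrite /oswap; congr o.
    by rewrite /sw; do ![case: eqP => ?]; lia.
  exact: (Eblk_anti Blin Bquad _ im jm ij).
have aXi2 : antion m (m + n) Xi.
  move=> i j im jm ij o; rewrite /Xi.
  have -> : Eblk (m + n) f (fun e => oswap i j o (m + e)%N) =
      - Eblk (m + n) f (fun e => o (m + e)%N).
    have i' : (0 <= i - m < m + n)%N by lia.
    have j' : (0 <= j - m < m + n)%N by lia.
    have ij' : (i - m != j - m)%N by lia.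
    rewrite -(Eblk_anti Blin Bquad f i' j' ij'); congr Eblk.
    apply: functional_extensionality => e; rewrite /oswap; congr o.
    by rewrite /sw; do ![case: eqP => ?]; lia.
  rewrite -scaleN1r (EblkE t B) wedgeZ // scaleN1r -(EblkE t B); congr (- _).
  apply: Eblk_ext => e em; rewrite /oswap; congr o.
  by rewrite /sw; do ![case: eqP => ?]; lia.
have [||c Ec] := kern_rect_span F0 t0 aXi1 aXi2 (o := exch_base)
    (a := l%:Z - m%:Z + 1) (b := l%:Z - (m + n)%N%:Z + 1).
- by move=> i im; rewrite /exch_base im.
- by move=> i im; rewrite /exch_base ifF ?ifT //; lia.
exists c; rewrite -Ec !(bpartE t B) size_nseq sd.
transitivity (Eblk (m + n) (Eblk m f (fun i => (nth 0%N d i)%:Z - i%:Z)) (fun i => l%:Z - i%:Z)).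
  by apply: Eblk_ext => i im; rewrite nth_nseq im.
rewrite (Eblk_exchange F0 Blin Bquad); last by lia.
rewrite addKn; congr (kern _ _ _ _); apply: functional_extensionality => i.
rewrite /exch_base; case: (ltnP i m) => im; first by rewrite ifT; lia.
by case: (ltnP i (m + n)) => imn //; lia.
Qed.

Hypothesis (sd : sorted geq d) (szd : size d = m) (hd : head 0%N d = (l + n)%N).
Hypothesis (m0 : (0 < m)%N) (l0 : (0 < l)%N).

(** In a nonzero term the entries of the second block are distinct, and they include all d_j - j -
    n; an exponent whose value there would be one of these must therefore sit in the first block.
    The largest exponent would give l = d_0 - n, so it sits in the first block and makes its first
    part l + n. All entries of the first block are at least l - m + 1, which bounds its last part
    below by l. *)
Lemma exch_term_spec (s : 'S_(m + n)) f :
  exch_term s f = 0 \/ exists (e : bool) (a b : seq nat),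
  [/\ exch_term s f = (-1) ^+ e *: bpart a (bpart b f),
      [/\ sorted geq a, size a = m, head 0%N a = (l + n)%N & (l <= last 0%N a)%N],
      [/\ sorted geq b, size b = (m + n)%N & head 0%N b = l]
    & if (l <= last 0%N d)%N then a = d /\ b = nseq (m + n) l
      else last 0%N b = last 0%N d].
Proof.
rewrite /exch_term !(EblkE t B).
set L1 := mkseq (addp 0 s exch_base) m.
set L2 := mkseq (fun i => addp 0 s exch_base (m + i)%N) (m + n).
have [u2|nu2] := boolP (uniq L2); last first.
  left; rewrite (wedge_nuniq F0 Blin Bquad _ nu2).
  by have := wedgeZ t Blin L1 0 0; rewrite !scale0r.
right.
have os (k : 'I_(m + n)) : addp 0 s exch_base k = exch_base k + (s k)%:Z.
  by rewrite -[in LHS](add0n k) addp_in.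
have dj j : (j < m)%N -> (last 0%N d <= nth 0%N d j <= l + n)%N.
  move=> jm; rewrite -hd -nth0 -nth_last szd !sidx_ge //; lia.
have oW j : (j < m)%N -> addp 0 s exch_base (m + (n + j))%N =
    (nth 0%N d j)%:Z - j%:Z - n%:Z.
  move=> jm; rewrite addp_out; last by lia.
  rewrite /exch_base !ifF; try by lia.
  by rewrite addnA addKn.
have inj2 : {in gtn (m + n) &, injective (fun i => addp 0 s exch_base (m + i)%N)}.
  exact/mkseq_uniqP.
have oY (k : 'I_(m + n)) : (m <= k)%N ->
    addp 0 s exch_base (m + (k - m))%N = l%:Z - (m + n)%N%:Z + 1 + (s k)%:Z.
  move=> mk; rewrite subnKC // os /exch_base ifF ?ifT //.
  by have := ltn_ord k; lia.
have noclash (k : 'I_(m + n)) j : (m <= k)%N -> (j < m)%N ->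
    l%:Z - (m + n)%N%:Z + 1 + (s k)%:Z != (nth 0%N d j)%:Z - j%:Z - n%:Z.
  move=> mk jm; apply/eqP; rewrite -oY // -oW // => /inj2.
  have kn := ltn_ord k; have h1 : (k - m < m + n)%N by lia.
  have h2 : (n + j < m + n)%N by lia.
  by move=> /(_ h1 h2); lia.
have oZ (k : 'I_(m + n)) : (k < m)%N -> addp 0 s exch_base k = l%:Z - m%:Z + 1 + (s k)%:Z.
  by move=> km; rewrite os /exch_base km.
have L1P x : x \in L1 -> exists2 k : 'I_(m + n), (k < m)%N & x = l%:Z - m%:Z + 1 + (s k)%:Z.
  case/mapP => i; rewrite mem_iota => /= im ->.
  have iN : (i < m + n)%N by lia.
  by exists (Ordinal iN) => //; rewrite -oZ.
have inL1 (k : 'I_(m + n)) : (k < m)%N -> l%:Z - m%:Z + 1 + (s k)%:Z \in L1.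
  by move=> km; rewrite -oZ //; apply: map_f; rewrite mem_iota.
have u1 : uniq L1.
  apply/mkseq_uniqP => i j; rewrite !inE => im jm.
  have iN : (i < m + n)%N by lia.
  have jN : (j < m + n)%N by lia.
  rewrite (oZ (Ordinal iN)) // (oZ (Ordinal jN)) // => E.
  have : s (Ordinal iN) = s (Ordinal jN) by apply: val_inj => /=; lia.
  by move=> /perm_inj [].
have sz1 : size L1 = m by rewrite size_mkseq.
have sz2 : size L2 = (m + n)%N by rewrite size_mkseq.
have L2P x : x \in L2 -> (exists2 k : 'I_(m + n), (m <= k)%N & x = l%:Z - (m + n)%N%:Z + 1 + (s k)%:Z)
    \/ exists2 j, (j < m)%N & x = (nth 0%N d j)%:Z - j%:Z - n%:Z.
  case/mapP => i; rewrite mem_iota => /= im ->.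
  case: (ltnP i n) => ni.
    have iN : (m + i < m + n)%N by lia.
    left; exists (Ordinal iN); first by rewrite /= leq_addr.
    by rewrite -oY /= ?addKn // leq_addr.
  right; exists (i - n)%N; first by lia.
  by rewrite -oW ?subnKC //; lia.
have WL2 j : (j < m)%N -> (nth 0%N d j)%:Z - j%:Z - n%:Z \in L2.
  move=> jm; rewrite -oW //; apply: (map_f (fun i => addp 0 s exch_base (m + i)%N)).
  by rewrite mem_iota; lia.
have sN (k : 'I_(m + n)) : (s k < m + n)%N by apply: ltn_ord.
have [x x1|a [sa sza pa]] := sort_sidx u1.
  by have [k km ->] := L1P _ x1; rewrite sz1; lia.
have [x x2|b [sb szb pb]] := sort_sidx u2.
  by have [[k mk ->]|[j jm ->]] := L2P _ x2; rewrite sz2; lia.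
have bE g : bpart b g = wedge (sidx b) g by exact: bpart_wedge.
have aE g : bpart a g = wedge (sidx a) g by exact: bpart_wedge.
have [e1 E1] := wedge_perm Blin Bquad pa.
have [e2 E2] := wedge_perm Blin Bquad pb.
exists (e1 (+) e2), a, b; split.
- by rewrite E2 (wedgeZ t Blin) E1 -aE -bE scalerA signr_addb mulrC.
- split=> //; first by rewrite sza.
    apply: sidx_head => // [|x].
      rewrite -(perm_mem pa).
      have Nm : ((m + n).-1 < m + n)%N by lia.
      pose k := (s^-1)%g (Ordinal Nm).
      have sk : s k = Ordinal Nm by rewrite permKV.
      case: (ltnP k m) => km.
        have := inL1 k km; rewrite sk /= (_ : _ + _ = (l + n)%N%:Z) //; lia.
      have := noclash k 0%N km m0; rewrite sk nth0 hd /=.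
      by case/eqP; lia.
    rewrite -(perm_mem pa) => /L1P[k km ->]; have := sN k; lia.
  have a0 : (0 < size a)%N by rewrite sza sz1.
  have : (last 0%N a)%:Z - (size a).-1%:Z \in sidx a.
    by rewrite -nth_last; apply: mem_sidx; lia.
  by rewrite -(perm_mem pa) sza sz1 => /L1P[k km]; lia.
- split=> //; first by rewrite szb.
  apply: sidx_head => // [|x]; rewrite -(perm_mem pb).
    by have := WL2 0%N m0; rewrite nth0 hd (_ : _ - _ - _ = l%:Z) //; lia.
  move=> /L2P[[k mk ->]|[j jm ->]]; first by have := sN k; lia.
  by have := dj j jm; lia.
case: leqP => ld.
  split.
    have pd : perm_eq (sidx d) L1.
      have ud : uniq (sidx d).
        apply/mkseq_uniqP => i j; rewrite !inE => id jd.
        case: (ltngtP i j) => // ij.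
          by have := @sidx_sorted_lt d i j sd; rewrite ij => /(_ jd); lia.
        by have := @sidx_sorted_lt d j i sd; rewrite ij => /(_ id); lia.
      (* If all d_j >= l, every d_j - j - n lies in the range of the exponents of the second block.
         The exponent with that value thus sits in the first block, where it gives d_j - j. *)
      have sub : {subset sidx d <= L1}.
        move=> x /sidxP[j jd ->]; rewrite szd in jd.
        have vj : (absz ((nth 0%N d j)%:Z - j%:Z - n%:Z - (l%:Z - (m + n)%N%:Z + 1))%R < m + n)%N.
          by have := dj j jd; lia.
        pose k := (s^-1)%g (Ordinal vj).
        have sk : s k = Ordinal vj by rewrite permKV.
        case: (ltnP k m) => km.
          have := inL1 k km; rewrite sk /= (_ : l%:Z - m%:Z + 1 + _ = (nth 0%N d j)%:Z - j%:Z) //.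
          by have := dj j jd; lia.
        have := noclash k j km jd; rewrite sk /=.
        by case/eqP; have := dj j jd; lia.
      have le : (size L1 <= size (sidx d))%N by rewrite sz1 size_mkseq szd.
      by have [_ e] := uniq_min_size ud sub le; apply: uniq_perm.
    have ua : forall a', sorted geq a' -> sorted >%R (sidx a').
      move=> a' sa'; apply/(sortedP 0) => i; rewrite size_mkseq => ia.
      rewrite !nth_mkseq //; last by lia.
      by apply: sidx_sorted_lt => //; rewrite leqnn.
    have eqs : sidx a = sidx d.
      apply: (@sorted_eq _ (>%R : rel int)).
      - by move=> x y z xy yz; apply: lt_trans yz xy.
      - by move=> x y /andP[xy yx]; have := lt_trans xy yx; rewrite ltxx.
      - exact: ua.
      - exact: ua.
      by rewrite perm_sym; apply: perm_trans pd pa.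
    apply: (@eq_from_nth _ 0%N) => [|i ia]; first by rewrite sza sz1 szd.
    have := congr1 (fun z => nth 0 z i) eqs.
    by rewrite /sidx !nth_mkseq //; [lia | rewrite szd -sz1 -sza].
  rewrite -sz2 -szb; apply: sidx_rect => // x; rewrite -(perm_mem pb) szb sz2.
  by move=> /L2P[[k mk ->]|[j jm ->]]; [have := sN k | have := dj j jm]; lia.
(* Otherwise d_(m-1) - (m-1) - n lies below the range of the exponents, so it is the least entry of
   the second block and determines the last part of b. *)
have b0 : (0 < size b)%N by rewrite szb sz2; lia.
have nl : nth 0%N d m.-1 = last 0%N d by rewrite -nth_last szd.
have lb y : y \in sidx b -> (last 0%N d)%:Z - m.-1%:Z - n%:Z <= y.
  rewrite -(perm_mem pb) => /L2P[[k mk ->]|[j jm ->]]; first by lia.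
  have [->|ne] := eqVneq j m.-1; first by rewrite nl.
  have := @sidx_sorted_lt d j m.-1 sd; rewrite szd nl.
  have -> : (j < m.-1 < m)%N by lia.
  by move=> /(_ isT); lia.
have min : (last 0%N d)%:Z - m.-1%:Z - n%:Z \in sidx b.
  by rewrite -(perm_mem pb) -nl; apply: WL2; lia.
by have := sidx_last sb b0 min lb; rewrite szb sz2; lia.
Qed.
End ExchangeTerms.

(** * Straightening *)

Section Span.
Variables (F : fieldType) (V : lmodType F) (I : Type).
Implicit Types (X : I -> V) (P : I -> bool).

(** Shaped like [in_Lambdak], to which it unfolds for the family of the H_rho. *)
Definition lspan P X (f : V) := exists2 s : seq (F * I),
  all (fun x => P x.2) s & f = \sum_(x <- s) x.1 *: X x.2.

Lemma lspan0 P X : lspan P X 0.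
Proof. by exists [::]; rewrite ?big_nil. Qed.

Lemma lspanD P X f g : lspan P X f -> lspan P X g -> lspan P X (f + g).
Proof.
by move=> [s Ps ->] [s' Ps' ->]; exists (s ++ s'); rewrite ?all_cat ?Ps // big_cat.
Qed.

Lemma lspanZ P X a f : lspan P X f -> lspan P X (a *: f).
Proof.
move=> [s Ps ->]; exists [seq (a * x.1, x.2) | x <- s]; first by rewrite all_map.
by rewrite big_map scaler_sumr; apply: eq_bigr => x _; rewrite scalerA.
Qed.

Lemma lspanN P X f : lspan P X f -> lspan P X (- f).
Proof. by move=> h; rewrite -scaleN1r; apply: lspanZ. Qed.

Lemma lspanB P X f g : lspan P X f -> lspan P X g -> lspan P X (f - g).
Proof. by move=> hf hg; apply: lspanD hf _; apply: lspanN. Qed.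

Lemma lspan_gen P X i : P i -> lspan P X (X i).
Proof. by move=> Pi; exists [:: (1, i)]; rewrite /= ?Pi // big_seq1 scale1r. Qed.

Lemma lspan_sum P X (J : Type) (r : seq J) (Q : pred J) (G : J -> V) :
  (forall j, Q j -> lspan P X (G j)) -> lspan P X (\sum_(j <- r | Q j) G j).
Proof.
by move=> H; elim/big_ind: _ => //; [apply: lspan0 | apply: lspanD].
Qed.

Lemma lspan_sum_seq P X (J : eqType) (r : seq J) (G : J -> V) :
  (forall j, j \in r -> lspan P X (G j)) -> lspan P X (\sum_(j <- r) G j).
Proof. by move=> H; rewrite big_seq; apply: lspan_sum. Qed.
End Span.

Section SpanMap.
Variables (F : fieldType) (V : lmodType F) (I J : Type).

Lemma linear_sum (T : V -> V) (K : Type) (s : seq (F * K)) (X : K -> V) : linear T ->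
  T (\sum_(x <- s) x.1 *: X x.2) = \sum_(x <- s) x.1 *: T (X x.2).
Proof.
move=> Tl; elim: s => [|x s IH]; last by rewrite !big_cons Tl IH.
by rewrite !big_nil; have := Tl (-1) 0 0; rewrite scaler0 addr0 scaleN1r addNr.
Qed.

Lemma lspan_map (P : I -> bool) (X : I -> V) (Q : J -> bool) (Y : J -> V) (T : V -> V) f :
  linear T -> (forall i, P i -> lspan Q Y (T (X i))) -> lspan P X f -> lspan Q Y (T f).
Proof.
move=> Tl H [s Ps ->]; rewrite linear_sum //.
elim: s Ps => [_|x s IH /= /andP[Px Ps]]; first by rewrite big_nil; apply: lspan0.
by rewrite big_cons; apply: lspanD (IH Ps); apply: lspanZ; apply: H.
Qed.

Lemma lspan_trans (P : I -> bool) (X : I -> V) (Q : J -> bool) (Y : J -> V) f :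
  (forall i, P i -> lspan Q Y (X i)) -> lspan P X f -> lspan Q Y f.
Proof. by apply: (@lspan_map _ _ _ _ id). Qed.

End SpanMap.

Lemma lspan_sub (F : fieldType) (V : lmodType F) (I : Type) (P Q : I -> bool) (X : I -> V) f :
  (forall i, P i -> Q i) -> lspan P X f -> lspan Q X f.
Proof. by move=> H; apply: lspan_trans => i Pi; apply: lspan_gen; apply: H. Qed.

Definition isum (r : seq int) : int := \sum_(x <- r) x.
(** For a partition this is the statistic n(rho) = sum_i (i - 1) rho_i. An operator e_ab lowers it
    by b - a, which makes it the measure for triangularity. *)
Definition istat (r : seq int) : int := \sum_(i < size r) i%:Z * r`_i.
Definition nstat (a : seq nat) : int := istat (map Posz a).

Lemma isum_nth r : isum r = \sum_(i < size r) r`_i.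
Proof. by rewrite /isum (big_nth 0) big_mkord. Qed.

Lemma istat_cons x r : istat (x :: r) = isum r + istat r.
Proof.
rewrite /istat /= big_ord_recl mul0r add0r isum_nth -big_split.
by apply: eq_bigr => i _; rewrite /= /bump PoszD mulrDl mul1r.
Qed.

Lemma isum_cons x r : isum (x :: r) = x + isum r.
Proof. by rewrite /isum big_cons. Qed.

Lemma isum_cat r r' : isum (r ++ r') = isum r + isum r'.
Proof. by rewrite /isum big_cat. Qed.

Lemma istat_cat r r' : istat (r ++ r') = istat r + (size r)%:Z * isum r' + istat r'.
Proof.
elim: r => [|x r IH]; first by rewrite /= {2}/istat big_ord0; lia.
by rewrite /= !istat_cons IH isum_cat; lia.
Qed.

Lemma isum_nat a : isum (map Posz a) = (sumn a)%:Z.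
Proof.
by elim: a => [|x a IH]; rewrite /= ?isum_cons ?IH ?PoszD // /isum big_nil.
Qed.

Lemma nstat_ge0 a : 0 <= nstat a.
Proof.
elim: a => [|x a IH]; first by rewrite /nstat /istat big_ord0.
by rewrite /nstat /= istat_cons isum_nat; move: IH; rewrite /nstat; lia.
Qed.

Lemma is_part_cons a g : is_part (a :: g) = [&& (0 < a)%N, (head 0%N g <= a)%N & is_part g].
Proof.
rewrite /is_part inE negb_or eq_sym -lt0n; case: g => [|b g] /=.
  by rewrite andbT.
by rewrite andbA [RHS]andbCA -!andbA; do !bool_congr.
Qed.

Section Straighten.
Variables (F : fieldType) (F0 : [pchar F] =i pred0) (t : F) (V : lmodType F).
Variable B : int -> V -> V.
Hypothesis Blin : forall n, linear (B n).
Hypothesis Bquad : forall m n f,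
  B m (B n f) - t *: B (m + 1) (B (n - 1) f) =
  - (B (n - 1) (B (m + 1) f) - t *: B n (B m f)).
Variable vac : V.
Hypothesis B0vac : B 0 vac = vac.
Hypothesis Bneg_vac : forall n, B (Negz n) vac = 0.
Local Notation bword := (bword B).

Definition Hword (a : seq nat) : V := bword (map Posz a) vac.

Lemma Bop_straighten (a b : int) f : a < b -> lspan
  (fun c : int => [&& a < c, c <= b & a + b - c <= c])
  (fun c => B c (B (a + b - c) f)) (B a (B b f)).
Proof.
move: {2}(absz (b - a)) (leqnn (absz (b - a))) => e.
elim: e a b => [|e IH] a b; first by lia.
move=> be ab; have q := Bquad a b f.
have hb : lspan (fun c : int => [&& a < c, c <= b & a + b - c <= c])
    (fun c => B c (B (a + b - c) f)) (B b (B a f)).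
  have := @lspan_gen _ _ _ (fun c : int => [&& a < c, c <= b & a + b - c <= c])
    (fun c => B c (B (a + b - c) f)) b.
  by rewrite addrK; apply; lia.
have [b1|nb1] := eqVneq b (a + 1).
  have x0 (x : V) : x = - x -> x = 0.
    move/eqP; rewrite -subr_eq0 opprK -mulr2n -scaler_nat scaler_eq0.
    by move/pcharf0P: F0 => -> /= /eqP.
  suff -> : B a (B b f) = t *: B b (B a f) by apply: lspanZ.
  by apply: subr0_eq; apply: x0; move: q; rewrite b1 addrK.
have -> : B a (B b f) = t *: B (a + 1) (B (b - 1) f) - B (b - 1) (B (a + 1) f)
    + t *: B b (B a f).
  by move/eqP: q; rewrite subr_eq => /eqP ->; rewrite opprB addrC addrA [RHS]addrAC.
apply: lspanD; last by apply: lspanZ.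
have hb1 : lspan (fun c : int => [&& a < c, c <= b & a + b - c <= c])
    (fun c => B c (B (a + b - c) f)) (B (b - 1) (B (a + 1) f)).
  have := @lspan_gen _ _ _ (fun c : int => [&& a < c, c <= b & a + b - c <= c])
    (fun c => B c (B (a + b - c) f)) (b - 1).
  by rewrite (_ : a + b - (b - 1) = a + 1); [apply; lia | lia].
apply: lspanB => //; apply: lspanZ.
have [b2|nb2] := eqVneq (a + 1) (b - 1); first by rewrite b2 in hb1 *.
have := IH (a + 1) (b - 1) _ _; have -> : (absz (b - 1 - (a + 1))%R <= e)%N by lia.
have -> : a + 1 < b - 1 by lia.
move=> /(_ isT isT); apply: lspan_trans => c cc.
have -> : a + 1 + (b - 1) - c = a + b - c by lia.
apply: (@lspan_gen _ _ _ (fun c : int => [&& a < c, c <= b & a + b - c <= c])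
   (fun c => B c (B (a + b - c) f))); lia.
Qed.

Lemma insert_base (K L : nat) g (a : int) :
    kpart K g -> (size g <= L)%N -> a <= K%:Z -> (head 0%N g)%:Z <= a ->
  lspan (fun e => [&& kpart K e, (sumn e)%:Z == a + (sumn g)%:Z, a <= (head 0%N e)%:Z,
      (size e <= L.+1)%N & nstat e <= (sumn g)%:Z + nstat g]) Hword (B a (Hword g)).
Proof.
case: a => [[|a]|a] kg sg aK ga; last by lia.
  case: g kg sg ga => [|b g] kg _ /= ga.
    rewrite /Hword /= B0vac; apply: (@lspan_gen _ _ _ _ Hword [::]).
    by rewrite /kpart /is_part /nstat /istat /= big_ord0.
  by move: kg; rewrite /kpart is_part_cons /=; lia.
apply: (@lspan_gen _ _ _ _ Hword (a.+1 :: g)); move: kg.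
rewrite /kpart is_part_cons => /andP[-> gK] /=.
by rewrite /nstat /= istat_cons isum_nat; lia.
Qed.

Lemma insert_nil (K L : nat) (a : int) : a <= K%:Z ->
  lspan (fun e => [&& kpart K e, (sumn e)%:Z == a + (sumn [::])%:Z, a <= (head 0%N e)%:Z,
      (size e <= L.+1)%N & nstat e <= (sumn [::])%:Z + nstat [::]])
    Hword (B a (Hword [::])).
Proof.
move=> aK; have [a0|a0] := leP 0 a; first exact: insert_base.
case: a aK a0 => [a|a] aK a0; first by lia.
by rewrite /Hword /= Bneg_vac; apply: lspan0.
Qed.

(** Exchanging a with the first part of g gives words (c, d, ...) with a < c <= K. First d is
    inserted into the shorter tail, then c, whose distance to K is smaller; the length bound in the
    conclusion is what admits the second insertion. The bound on [nstat] is [istat] of the word (a,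
    g). *)
Lemma insert_straighten (K L : nat) g (a : int) :
    kpart K g -> (size g <= L)%N -> a <= K%:Z ->
  lspan (fun e => [&& kpart K e, (sumn e)%:Z == a + (sumn g)%:Z, a <= (head 0%N e)%:Z,
      (size e <= L.+1)%N & nstat e <= (sumn g)%:Z + nstat g]) Hword (B a (Hword g)).
Proof.
elim: L g a => [|L IHL] g a.
  by case: g => // _ _ aK; apply: insert_nil.
move: {2}(absz (K%:Z - a)) (leqnn (absz (K%:Z - a))) => e.
elim: e g a => [|e IH] g a ae kg sg aK.
all: have [ga|ag] := leP (head 0%N g)%:Z a.
- exact: insert_base.
- by move: kg; rewrite /kpart => /andP[_ gK]; lia.
- exact: insert_base.
case: g kg sg ag => [|b g] kg sg /= ag; first exact: insert_nil.
move: (kg); rewrite /kpart is_part_cons /= => /andP[/and3P[b0 gb pg] bK].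
have kg' : kpart K g by rewrite /kpart pg; lia.
rewrite /Hword /= -/(Hword g).
apply: lspan_trans (Bop_straighten (Hword g) ag) => c /and3P[ac cb dc].
have := @IHL g (a + b%:Z - c) kg' sg; have -> : a + b%:Z - c <= K%:Z by lia.
move=> /(_ isT); apply: (lspan_map (Blin c)) => h /and5P[kh /eqP sh ch szh sth].
have := IH h c _ kh szh _; have -> : (absz (K%:Z - c)%R <= e)%N by lia.
have -> : c <= K%:Z by lia.
move=> /(_ isT isT); apply: lspan_sub => x /and5P[kx /eqP sx cx szx stx].
apply/and5P; split=> //.
- by rewrite sx sh; lia.
- by lia.
- move: stx; rewrite /nstat /= istat_cons isum_nat.
  by move: sth; rewrite /nstat sh; lia.
Qed.
End Straighten.

Lemma kpartW k g : kpart k g -> all (fun r => 0 < r <= k)%N g.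
Proof.
elim: g => //= a g IH; rewrite /kpart is_part_cons /= => /andP[/and3P[a0 ga pg] ak].
by rewrite a0 ak /= IH // /kpart pg; lia.
Qed.

Lemma size_raise ab r : size (raise ab r) = size r.
Proof. by rewrite size_mkseq. Qed.

Lemma nth_raise a b r i : (i < size r)%N ->
  (raise (a, b) r)`_i = r`_i + (i == a)%:Z - (i == b)%:Z.
Proof. by move=> ir; rewrite nth_mkseq. Qed.

Lemma sum_indicator (n a : nat) (c : nat -> int) : (a < n)%N ->
  \sum_(i < n) c i * (i == a :> nat)%:Z = c a.
Proof.
move=> an; rewrite (bigD1 (Ordinal an)) //= eqxx mulr1 big1 ?addr0 // => i ia.
by rewrite -val_eqE /= in ia; rewrite (negPf ia) mulr0.
Qed.

Lemma weighted_raise (c : nat -> int) a b r : (a < b < size r)%N ->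
  \sum_(i < size r) c i * (raise (a, b) r)`_i =
  \sum_(i < size r) c i * r`_i + c a - c b.
Proof.
move=> /andP[ab br].
rewrite (eq_bigr (fun i : 'I_(size r) => c i * r`_i +
  (c i * (i == a :> nat)%:Z - c i * (i == b :> nat)%:Z))).
  by rewrite big_split /= sumrB !sum_indicator ?addrA //; lia.
by move=> i _; rewrite nth_raise //; ring.
Qed.

Lemma isum_raise a b r : (a < b < size r)%N -> isum (raise (a, b) r) = isum r.
Proof.
move=> abr; rewrite !isum_nth size_raise.
have := weighted_raise (fun=> 1) abr; rewrite addrK.
by under eq_bigr do rewrite mul1r; under [RHS]eq_bigr do rewrite mul1r.
Qed.

Lemma istat_raise a b r : (a < b < size r)%N ->
  istat (raise (a, b) r) = istat r + a%:Z - b%:Z.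
Proof. by move=> abr; rewrite /istat size_raise (weighted_raise Posz abr). Qed.

(** * Unitriangularity of products of blocks against the H_rho *)

Section Triangular.
Variables (F : fieldType) (F0 : [pchar F] =i pred0) (t : F) (V : lmodType F).
Variable B : int -> V -> V.
Hypothesis Blin : forall n, linear (B n).
Hypothesis Bquad : forall m n f,
  B m (B n f) - t *: B (m + 1) (B (n - 1) f) =
  - (B (n - 1) (B (m + 1) f) - t *: B n (B m f)).
Variable vac : V.
Hypothesis B0vac : B 0 vac = vac.
Hypothesis Bneg_vac : forall n, B (Negz n) vac = 0.
Local Notation bword := (bword B).
Local Notation bpart := (bpart t B).
Local Notation Hword := (Hword B vac).

Lemma word_straighten (K : nat) (r : seq int) : (forall x, x \in r -> x <= K%:Z) ->
  lspan (fun e => [&& kpart K e, (sumn e)%:Z == isum r, head 0 r <= (head 0%N e)%:Z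
      & nstat e <= istat r]) Hword (bword r vac).
Proof.
elim: r => [|a r IH] H.
  apply: (@lspan_gen _ _ _ _ Hword [::]).
  by rewrite /kpart /is_part /isum big_nil /nstat /istat /= big_ord0.
have Hr x : x \in r -> x <= K%:Z by move=> xr; apply: H; rewrite inE xr orbT.
apply: (lspan_map (Blin a)) (IH Hr) => g /and4P[kg /eqP sg hg stg].
have aK : a <= K%:Z by apply: H; rewrite mem_head.
have := insert_straighten F0 Blin Bquad B0vac Bneg_vac kg (leqnn _) aK.
apply: lspan_sub => e /and5P[ke /eqP se he sze ste].
rewrite isum_cons istat_cons ke he se sg eqxx /=.
by rewrite sg in ste; lia.
Qed.

(** The traits of a nonleading term in an expanded product of raising operators that the later
    estimates use; c i bounds how far index i is raised. *)
Definition lower_word (c : nat -> nat) (r r' : seq int) :=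
  [/\ size r' = size r, isum r' = isum r, istat r' < istat r,
      exists i, [/\ (i < size r)%N, forall j, (j < i)%N -> r'`_j = r`_j & r`_i < r'`_i]
    & forall i, (i < size r)%N -> r'`_i <= r`_i + (c i)%:Z].

Lemma lower_word_head c r r' : lower_word c r r' -> head 0 r <= head 0 r'.
Proof.
move=> [_ _ _ [[|i] [_ e lt]] _]; rewrite -!nth0; first exact: ltW.
by rewrite e.
Qed.

Lemma raising_expand (s : seq (nat * nat)) (L : nat) :
  all (fun ab => ab.1 < ab.2 < L)%N s -> forall r, size r = L ->
  exists2 cs : seq (F * seq int),
    (forall x, x \in cs -> lower_word (fun i => count (fun ab => ab.1 == i) s) r x.2) &
    forall f, foldr (fun ab (Phi : seq int -> V) r => Phi r - t *: Phi (raise ab r))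
        (bword^~ f) s r = bword r f + \sum_(x <- cs) x.1 *: bword x.2 f.
Proof.
elim: s => [_ r rL|[a b] s IH /= /andP[/andP[/= ab bL] al] r rL].
  by exists [::] => // f; rewrite big_nil addr0.
have abr : (a < b < size r)%N by rewrite rL ab.
have [cs1 H1 E1] := IH al r rL.
have [cs2 H2 E2] := IH al (raise (a, b) r) (etrans (size_raise _ _) rL).
exists (cs1 ++ (- t, raise (a, b) r) :: [seq (- t * x.1, x.2) | x <- cs2]).
  move=> x; rewrite mem_cat inE => /or3P[/H1|/eqP -> /=|].
  - by case=> ? ? ? ? le; split=> // i ir; have := le i ir => /=; lia.
  - split; rewrite ?size_raise ?isum_raise ?istat_raise //; first by lia.
      exists a; split; first by lia.
        by move=> j ja; rewrite nth_raise ?(ltn_eqF ja) ?(ltn_eqF (ltn_trans ja ab)) ?addr0 ?subr0 //; lia.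
      by rewrite nth_raise ?eqxx ?(ltn_eqF ab); lia.
    move=> i ir; rewrite nth_raise // (eq_sym i a).
    by case: (a == i); case: (i == b) => /=; lia.
  - case/mapP => y /H2[sz sm st hd le] -> /=; split.
    + by rewrite sz size_raise.
    + by rewrite sm isum_raise.
    + by apply: lt_trans st _; rewrite istat_raise //; lia.
    + have [i [ir e lt]] := hd; rewrite size_raise in ir.
      have ra j : (j < a)%N -> (raise (a, b) r)`_j = r`_j.
        by move=> ja; rewrite nth_raise ?(ltn_eqF ja) ?(ltn_eqF (ltn_trans ja ab)) ?addr0 ?subr0 //; lia.
      have raa : (raise (a, b) r)`_a = r`_a + 1.
        by rewrite nth_raise ?eqxx ?(ltn_eqF ab); lia.
      case: (ltngtP i a) => [ia|ai|ia].
      * exists i; split=> //; last by rewrite -ra.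
        by move=> j ji; rewrite e // ra //; lia.
      * exists a; split; first by lia.
          by move=> j ja; rewrite e ?ra //; lia.
        by rewrite e // raa; lia.
      * exists i; split=> //; first by move=> j ji; rewrite e // ra //; lia.
        by move: lt; rewrite ia raa; apply: lt_trans; lia.
    + move=> i ir; have := le i; rewrite size_raise ir => /(_ isT).
      by rewrite nth_raise // (eq_sym i a); case: (a == i); case: (i == b) => /=; lia.
move=> f; rewrite E1 E2 big_cat big_cons /= big_map -addrA; congr (_ + _).
congr (_ + _); rewrite -scaleNr scalerDr scaler_sumr; congr (_ + _).
by apply: eq_bigr => x _; rewrite scalerA.
Qed.

Lemma count_ltpairs L i : (i < L)%N -> count (fun ab => ab.1 == i) (ltpairs L) = (L - i.+1)%N.
Proof.
move=> iL; rewrite ltpairsE -size_filter.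
have -> : size [seq ab <- ipairs 0 L | ab.1 == i] =
    size (map (pair i) (iota i.+1 (L - i.+1))).
  apply: perm_size; apply: uniq_perm; first by rewrite filter_uniq ?uniq_ipairs.
    by rewrite map_inj_uniq ?iota_uniq // => a b [].
  move=> [a b]; rewrite mem_filter mem_ipairs /=.
  apply/idP/mapP => [/andP[/eqP -> H]|[c ci [-> ->]]].
    by exists b => //; rewrite mem_iota; move: H; rewrite andbC; lia.
  by move: ci; rewrite mem_iota eqxx; lia.
by rewrite size_map size_iota.
Qed.

Lemma bpart_expand (b : seq nat) : exists2 cs : seq (F * seq int),
    (forall x, x \in cs -> lower_word (fun i => size b - i.+1)%N (map Posz b) x.2) &
    forall f, bpart b f = bword (map Posz b) f + \sum_(x <- cs) x.1 *: bword x.2 f.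
Proof.
have al : all (fun ab => ab.1 < ab.2 < size b)%N (ltpairs (size b)).
  by apply/allP => -[a c]; rewrite ltpairsE mem_ipairs /=; lia.
have sb : size (map Posz b) = size b by rewrite size_map.
have [cs H E] := raising_expand al sb.
exists cs => // x /H[sz sm st hd le]; split=> // i ib.
by have := le i ib; rewrite count_ltpairs //; rewrite size_map in ib.
Qed.

Definition Gblocks (bs : seq (seq nat)) : V := foldr bpart vac bs.

(** Index i of a block of L rows is raised at most L - 1 - i times, so it is bounded by the
    hook-length, hence by k, and straightening stays among k-bounded partitions. Each correction has
    a smaller [istat], and neither it nor the straightening lowers the first part. *)
Lemma Gblocks_lower k bs : all (fun b => hook b <= k)%N bs -> [::] \notin bs ->
    kpart k (flatten bs) ->
  lspan (fun e => [&& kpart k e, sumn e == sumn (flatten bs),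
      (head 0%N (flatten bs) <= head 0%N e)%N & nstat e < nstat (flatten bs)]) Hword
    (Gblocks bs - Hword (flatten bs)).
Proof.
elim: bs => [_ _ _|b bs IH]; first by rewrite subrr; apply: lspan0.
rewrite inE negb_or => /andP[hb hbs] /andP[nb nbs] kf.
have b0 : (0 < size b)%N by case: (b) nb.
pose rho := flatten bs.
have kf' : kpart k (b ++ rho) by [].
have {kf} kf := kf'.
have alk := kpartW kf.
have krho : kpart k rho.
  elim: (b) kf {nb hb b0 alk kf'} => //= x b' IHb.
  rewrite /kpart is_part_cons /= => /andP[/and3P[_ xb pb] xk]; apply: IHb.
  by rewrite /kpart pb; lia.
have bk x : x \in b -> (x <= head 0%N b)%N.
  case: (b) kf => // y b' kf; rewrite inE => /predU1P[->//|xb].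
  have : sorted geq ((y :: b') ++ rho) by case/andP: kf => /andP[].
  rewrite /= path_sortedE; last by move=> u v w uv vw; apply: leq_trans vw uv.
  by case/andP => /allP /(_ x) + _; rewrite mem_cat xb => /(_ isT).
have {}IH := IH hbs nbs krho; rewrite -/rho in IH.
set X := Gblocks bs in IH *.
have [cs csP csE] := bpart_expand b.
rewrite /Gblocks /= -/(Gblocks bs) -/X csE.
have W r g : size r = size b -> isum r = (sumn b)%:Z -> (head 0%N b)%:Z <= head 0 r ->
    (forall x, x \in r -> x <= k%:Z) -> kpart k g -> sumn g = sumn rho ->
    istat r + nstat g < istat (map Posz b) + nstat rho ->
  lspan (fun e => [&& kpart k e, sumn e == sumn (flatten (b :: bs)),
      (head 0%N (flatten (b :: bs)) <= head 0%N e)%N & nstat e < nstat (flatten (b :: bs))])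
    Hword (bword r (Hword g)).
  move=> sr ir hr rk kg sg st.
  have -> : bword r (Hword g) = bword (r ++ map Posz g) vac by rewrite bword_cat.
  have rgk x : x \in r ++ map Posz g -> x <= k%:Z.
    rewrite mem_cat => /orP[/rk //|/mapP[y yg ->]].
    by have := allP (kpartW kg) _ yg; lia.
  apply: lspan_sub (word_straighten rgk) => e /and4P[ke /eqP se he ste].
  rewrite ke /= -/rho; apply/and3P; split.
  - by move: se; rewrite isum_cat isum_nat ir sg sumn_cat => -[->].
  - have r0 : (0 < size r)%N by rewrite sr.
    move: he; rewrite (_ : head 0 (r ++ _) = head 0 r); last by case: (r) r0.
    rewrite (_ : head 0%N (b ++ rho) = head 0%N b); last by case: (b) b0.
    by lia.
  - move: ste st; rewrite istat_cat isum_nat sr sg /nstat map_cat istat_cat isum_nat.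
    by rewrite size_map; lia.
have mb x : x \in map Posz b -> x <= k%:Z.
  by case/mapP => y yb ->; have := allP alk y; rewrite mem_cat yb => /(_ isT); lia.
have Xrho g : kpart k g && (sumn g == sumn rho) && (nstat g <= nstat rho) ->
    forall x, x \in cs -> lspan (fun e => [&& kpart k e, sumn e == sumn (flatten (b :: bs)),
      (head 0%N (flatten (b :: bs)) <= head 0%N e)%N & nstat e < nstat (flatten (b :: bs))])
    Hword (bword x.2 (Hword g)).
  move=> /andP[/andP[kg /eqP sg] stg] x xcs; have [sz sm st _ le] := csP x xcs.
  have hd := lower_word_head (csP x xcs).
  apply: W => //.
  - by rewrite sz size_map.
  - by rewrite sm isum_nat.
  - by move: hd; case: (b) b0.
  - move=> y /(nthP 0)[i ix <-].
    have ib : (i < size b)%N by rewrite sz size_map in ix.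
    have := le i; rewrite size_map ib => /(_ isT); rewrite (nth_map 0%N) //.
    have := bk _ (mem_nth 0%N ib); move: hb; rewrite /hook.
    by move: (nth _ b i) (head _ b) (x.2)`_i; lia.
  - by lia.
have Xsum g f : lspan (fun e => [&& kpart k e, sumn e == sumn rho,
     (head 0%N rho <= head 0%N e)%N & nstat e < nstat rho]) Hword f -> g = f + Hword rho ->
   lspan (fun e => [&& kpart k e, sumn e == sumn (flatten (b :: bs)),
      (head 0%N (flatten (b :: bs)) <= head 0%N e)%N & nstat e < nstat (flatten (b :: bs))])
    Hword (\sum_(x <- cs) x.1 *: bword x.2 g).
  move=> sf ->; apply: lspan_sum_seq => x xcs; apply: lspanZ.
  rewrite bwordD //; apply: lspanD; last by apply: Xrho => //; rewrite krho eqxx lexx.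
  apply: (lspan_map (bword_linear Blin x.2)) sf => e /and4P[ke se he ste].
  by apply: Xrho => //; rewrite ke se ltW.
have -> : Hword (flatten (b :: bs)) = bword (map Posz b) (Hword rho).
  by rewrite -bword_cat -map_cat.
rewrite addrAC; apply: lspanD; last by apply: (Xsum _ _ IH); rewrite subrK.
have -> : bword (map Posz b) X - bword (map Posz b) (Hword rho) =
    bword (map Posz b) (X - Hword rho) by rewrite bwordD // bwordN.
apply: (lspan_map (bword_linear Blin _)) IH => e /and4P[ke /eqP se he ste].
by apply: W => //; rewrite ?size_map ?isum_nat //; [case: (b) b0 | lia].
Qed.
End Triangular.

(** * The k-split polynomials *)

Lemma ksplit_fuel k n m rho : all (fun r => r <= k)%N rho ->
  (size rho <= n)%N -> (size rho <= m)%N -> ksplit_rec n k rho = ksplit_rec m k rho.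
Proof.
elim: n m rho => [|n IH] [|m] [|r s] al //= sn sm.
have /andP[rk _] := al.
have [q qE] : exists q, (k.+1 - r = q.+1)%N by exists (k - r)%N; lia.
rewrite qE /=; congr (_ :: _); apply: IH; rewrite ?size_drop; try by lia.
by apply/allP => x /mem_drop xs; apply: (allP al); rewrite inE xs orbT.
Qed.

Lemma ksplit_block k b g : b != [::] -> all (fun r => r <= k)%N (b ++ g) ->
  size b = (k.+1 - head 0%N b)%N -> ksplit k (b ++ g) = b :: ksplit k g.
Proof.
case: b => // r s _ al sz.
rewrite /ksplit /= -[size (s ++ g)]/(size (s ++ g)) -/(ksplit_rec _ _ _) -sz.
have -> : take (size (r :: s)) (r :: s ++ g) = r :: s by apply: (take_size_cat (s1 := r :: s)).
have -> : drop (size (r :: s)) (r :: s ++ g) = g by apply: (drop_size_cat (s1 := r :: s)).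
congr (_ :: _); apply: ksplit_fuel => //; last by rewrite size_cat leq_addl.
by move: al; rewrite all_cat => /andP[].
Qed.

Lemma ksplit_last k b : b != [::] -> (size b <= k.+1 - head 0%N b)%N -> ksplit k b = [:: b].
Proof.
case: b => // r s _ sz; rewrite /ksplit /= take_oversize // drop_oversize //.
by case: (size s).
Qed.

Lemma kpart_le k g x : kpart k g -> x \in g -> (x <= head 0%N g)%N.
Proof.
case: g => // a g /andP[/andP[+ _] _]; rewrite /= path_sortedE; last first.
  by move=> u v w uv vw; apply: leq_trans vw uv.
by case/andP => /allP H _; rewrite inE => /predU1P[->//|/H].
Qed.

Lemma kpart_cat k b g : sorted geq b -> (0 < last 0%N b)%N -> (head 0%N b <= k)%N ->
  kpart k g -> (head 0%N g <= last 0%N b)%N -> kpart k (b ++ g).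
Proof.
case: b => // x b; rewrite /= => + + xk kg.
elim: b x xk => [|y b IH] x xk /= => [_ x0 gx|/andP[yx sb] lb gb].
  by rewrite /kpart is_part_cons x0 gx xk /=; case/andP: kg => ->.
have /andP[pyb _] : kpart k (y :: b ++ g) by apply: IH => //; move: yx; rewrite /=; lia.
by rewrite /kpart is_part_cons pyb xk !andbT /=; move: yx pyb; rewrite /= is_part_cons; lia.
Qed.

Lemma head_nseq_pos n (x : nat) : (0 < n)%N -> head 0%N (nseq n x) = x.
Proof. by case: n. Qed.

Lemma sorted_nseq n (x : nat) : sorted geq (nseq n x).
Proof. by case: n => //= n; elim: n => //= n ->; rewrite leqnn. Qed.

Lemma last_nseq_pos n (x : nat) : (0 < n)%N -> last 0%N (nseq n x) = x.
Proof. by case: n => //= n _; elim: n. Qed.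

Section SplitPolynomials.
Variables (F : fieldType) (F0 : [pchar F] =i pred0) (t : F) (t0 : t != 0) (V : lmodType F).
Variable B : int -> V -> V.
Hypothesis Blin : forall n, linear (B n).
Hypothesis Bquad : forall m n f,
  B m (B n f) - t *: B (m + 1) (B (n - 1) f) =
  - (B (n - 1) (B (m + 1) f) - t *: B n (B m f)).
Variable vac : V.
Hypothesis B0vac : B 0 vac = vac.
Hypothesis Bneg_vac : forall n, B (Negz n) vac = 0.
Variable k : nat.
Local Notation bword := (bword B).
Local Notation bpart := (bpart t B).
Local Notation Hword := (Hword B vac).

Definition Gk rho : V := Gblocks t B vac (ksplit k rho).

Lemma Gk_lower rho : kpart k rho ->
  lspan (fun e => [&& kpart k e, sumn e == sumn rho, (head 0%N rho <= head 0%N e)%N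
    & nstat e < nstat rho]) Hword (Gk rho - Hword rho).
Proof.
move=> kr; have [fl ne hk _] := ksplitP kr.
have := Gblocks_lower F0 Blin Bquad B0vac Bneg_vac hk ne.
by rewrite fl => /(_ kr).
Qed.

Lemma Gk_in_H rho : kpart k rho -> lspan (kpart k) Hword (Gk rho).
Proof.
move=> kr; rewrite -[Gk rho](subrK (Hword rho)); apply: lspanD; last exact: lspan_gen.
by apply: lspan_sub (Gk_lower kr) => e /and4P[].
Qed.

(** Inverting [Gk_lower] terminates because [nstat] is a nonnegative integer. *)
Lemma Hword_in_G rho : kpart k rho ->
  lspan (fun e => [&& kpart k e, sumn e == sumn rho & (head 0%N rho <= head 0%N e)%N])
    Gk (Hword rho).
Proof.
move: {2}(absz (nstat rho)) (leqnn (absz (nstat rho))) => N.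
elim: N rho => [|N IH] rho rN kr.
all: have -> : Hword rho = Gk rho - (Gk rho - Hword rho) by rewrite opprB addrCA subrr addr0.
all: apply: lspanB; first by (apply: lspan_gen; rewrite kr eqxx leqnn).
all: apply: lspan_trans (Gk_lower kr) => e /and4P[ke /eqP se he ste].
  by have := nstat_ge0 e; have := nstat_ge0 rho; lia.
have eN : (absz (nstat e) <= N)%N by have := nstat_ge0 e; have := nstat_ge0 rho; lia.
apply: lspan_sub (IH e eN ke) => x /and3P[-> /eqP -> hx] /=.
by rewrite se eqxx (leq_trans he hx).
Qed.

Lemma H_span_G f : lspan (kpart k) Hword f -> lspan (kpart k) Gk f.
Proof.
by apply: lspan_trans => e ke; apply: lspan_sub (Hword_in_G ke) => x /and3P[].
Qed.

Lemma G_span_H f : lspan (kpart k) Gk f -> lspan (kpart k) Hword f.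
Proof. by apply: lspan_trans => e ke; apply: Gk_in_H. Qed.

Lemma B_span (c : int) f : c <= k%:Z -> lspan (kpart k) Hword f ->
  lspan (fun e => kpart k e && (c <= (head 0%N e)%:Z)) Hword (B c f).
Proof.
move=> ck; apply: (lspan_map (Blin c)) => g kg.
have := insert_straighten F0 Blin Bquad B0vac Bneg_vac kg (leqnn _) ck.
by apply: lspan_sub => e /and5P[-> _ -> _ _].
Qed.

Lemma B_span_gt (l : nat) f :
  lspan (fun e => kpart k e && (l < head 0%N e)%N) Hword f ->
  lspan (fun e => kpart k e && (l < head 0%N e)%N) Hword (B l%:Z f).
Proof.
apply: (lspan_map (Blin l%:Z)) => -[|b g] /andP[kg lb] //.
have lb' : l%:Z < b%:Z by rewrite /= in lb; lia.
apply: lspan_trans (Bop_straighten F0 Bquad (Hword g) lb') => c /and3P[lc cb dc].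
move: (kg); rewrite /kpart is_part_cons => /andP[/and3P[_ gb pg] /= bk].
have kg' : kpart k g by rewrite /kpart pg; lia.
have ck : c <= k%:Z by lia.
have dk : l%:Z + b%:Z - c <= k%:Z by lia.
have hd : lspan (kpart k) Hword (B (l%:Z + b%:Z - c) (Hword g)).
  by apply: lspan_sub (B_span dk (lspan_gen _ kg')) => e /andP[].
by apply: lspan_sub (B_span ck hd) => e /andP[ke ce]; apply/andP; split=> //; lia.
Qed.

Lemma bword_span r f : (forall x, x \in r -> x <= k%:Z) ->
  lspan (kpart k) Hword f -> lspan (kpart k) Hword (bword r f).
Proof.
elim: r => //= a r IH H hf.
have ak : a <= k%:Z by apply: H; rewrite mem_head.
have hr : forall x, x \in r -> x <= k%:Z by move=> x xr; apply: H; rewrite inE xr orbT.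
by apply: lspan_sub (B_span ak (IH hr hf)) => e /andP[].
Qed.

(** The new row starts at the shifted index -p and has p factors e_p - t e_a. If one of them fails
    to raise it, its index is still negative when it meets [vac], and the term vanishes; so every
    factor acts as e_p and the row becomes B_0. *)
Lemma bpart_rcons0 b : bpart (rcons b 0%N) vac = bpart b vac.
Proof.
rewrite !(bpartE t B) size_rcons; set p := size b; set o := fun i : nat => _.
have pe : perm_eq (ipairs 0 p.+1)
    (map (fun a => (a, p)) (iota 0 p) ++ (ipairs 0 p ++ ipairs p 1)).
  apply: uniq_perm; first exact: uniq_ipairs.
    have inj : injective (fun a : nat => (a, p)) by move=> x y [].
    rewrite cat_uniq (cat_uniq (ipairs 0 p)) !uniq_ipairs (map_inj_uniq inj).
    rewrite iota_uniq andbT !andTb; apply/andP; split; apply/hasPn => -[x y].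
      rewrite mem_cat !mem_ipairs; apply: contraL => /mapP[z].
      by rewrite mem_iota => zp [-> ->]; lia.
    by rewrite !mem_ipairs; lia.
  move=> [x y]; rewrite [in LHS]mem_ipairs [in RHS]mem_cat [X in _ || X]mem_cat.
  rewrite !mem_ipairs; apply/idP/idP => [H|/or3P[/mapP[z]||]]; try by lia.
    have [yp|ny] := @eqVneq nat y p; last by apply/or3P; apply: Or32; move: H ny; lia.
    by apply/or3P; apply: Or31; apply/mapP; exists x; rewrite ?mem_iota ?yp //; lia.
  by rewrite mem_iota => zp [-> ->]; lia.
rewrite /Eblk (kern_perm _ _ pe) kern_cat.
pose E o' := Eblk t B p (B (o' p) vac) o'.
have -> : kern t (ipairs 0 p ++ ipairs p 1) (wordfun B p.+1 vac) = E.
  apply: functional_extensionality => o'; rewrite -[p.+1]addn1 Eblk_cat // /E.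
  by congr (Eblk _ _ _ _ _); rewrite /Eblk /= /wordfun /= addn0.
have EN s o' : o' p = - (size s)%:Z -> all (fun a => a < p)%N s ->
    kern t (map (fun a => (a, p)) s) E o' = Eblk t B p vac o'.
  have EN0 s' o2 : o2 p + (size s')%:Z < 0 -> all (fun a => a < p)%N s' ->
      kern t (map (fun a => (a, p)) s') E o2 = 0.
    elim: s' o2 => [|a s' IHs] o2 /= neg.
      move=> _; rewrite /E; case: (o2 p) neg => [n|n] neg; first by lia.
      rewrite Bneg_vac; have := Eblk_linear t Blin p o2 (-1) 0 0.
      by rewrite scaler0 addr0 scaleN1r addNr.
    move=> /andP[ap al]; rewrite /kpair /= !IHs ?scaler0 ?subr0 //.
      by rewrite /inc (gtn_eqF ap); lia.
    by rewrite /inc eqxx; lia.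
  elim: s o' => [|a s IHs] o' /= op.
    by rewrite /E op oppr0 B0vac.
  move=> /andP[ap al]; rewrite /kpair /= [X in _ - _ *: X]EN0 //; last first.
    by rewrite /inc (gtn_eqF ap) op; lia.
  rewrite scaler0 subr0 IHs //; last by rewrite /inc eqxx op; lia.
  apply: Eblk_ext => i ip; rewrite /inc (ltn_eqF ip); lia.
rewrite EN.
- by apply: Eblk_ext => i ip; rewrite /o nth_rcons ip.
- by rewrite /o nth_rcons ltnn eqxx size_iota; lia.
- by apply/allP => x; rewrite mem_iota; lia.
Qed.

Lemma bpart_zeros b z : bpart (b ++ nseq z 0%N) vac = bpart b vac.
Proof.
elim: z => [|z IH]; first by rewrite cats0.
by rewrite -IH -addn1 nseqD catA cats1 bpart_rcons0.
Qed.

(** A block ending in 0 can only be followed by [vac]; dropping its zeros makes it the short last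
    block of a split. Padding with zeros thus gives all blocks the size k + 1 - r. *)
Lemma block_span b r g : sorted geq b -> size b = (k.+1 - r)%N -> head 0%N b = r ->
    (0 < r <= k)%N -> lspan (fun e => kpart k e && (head 0%N e <= last 0%N b)%N) Gk g ->
  lspan (fun e => kpart k e && (head 0%N e == r)) Gk (bpart b g).
Proof.
move=> sb szb hb /andP[r0 rk].
have bl : linear (bpart b).
  by move=> x u v; rewrite !(bpartE t B) Eblk_linear.
have b0 : b != [::] by case: (b) hb => // e; rewrite -e in r0.
apply: (lspan_map bl) => e /andP[ke he].
case: (posnP (last 0%N b)) => [lb0|lb].
  have -> : e = [::].
    by case: e ke he => // x e; rewrite /kpart is_part_cons lb0 /=; lia.
  have -> : Gk [::] = vac by [].
  pose b' := [seq x <- b | (0 < x)%N].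
  have bE : b = b' ++ nseq (size b - size b') 0%N.
    have : sorted geq b by [].
    rewrite /b'; elim: (b) => //= x s IH; rewrite path_sortedE; last first.
      by move=> u v w uv vw; apply: leq_trans vw uv.
    move=> /andP[al ss]; case: (posnP x) al => [->|x0] al /=; last by rewrite {1}IH // subSS.
    have -> : [seq y <- s | (0 < y)%N] = [::].
      by apply/eqP; rewrite -(negbK (_ == _)) -has_filter; apply/hasPn => y /(allP al) /=; lia.
    rewrite subn0 /=; congr (_ :: _); apply/all_pred1P/allP => y /(allP al) /=.
    by rewrite leqn0.
  have b'0 : b' != [::].
    rewrite -has_filter; apply/hasP; exists (head 0%N b); last by rewrite hb.
    by case: (b) b0 => // x s _; rewrite mem_head.
  have hb' : head 0%N b' = r.
    by move: hb; rewrite {1}bE; case: (b') b'0.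
  have kb' : kpart k b'.
    rewrite /kpart hb' rk andbT /is_part sorted_filter //; last first.
      by move=> u v w uv vw; apply: leq_trans vw uv.
    by rewrite mem_filter.
  rewrite bE bpart_zeros.
  have -> : bpart b' vac = Gk b'.
    rewrite /Gk ksplit_last // hb' -szb /b' size_filter; exact: count_size.
  by apply: lspan_gen; rewrite kb' hb' eqxx.
have kbe : kpart k (b ++ e) by apply: kpart_cat; rewrite ?hb.
have -> : bpart b (Gk e) = Gk (b ++ e).
  rewrite /Gk ksplit_block ?hb //; apply/allP => x xin.
  by have /= := allP (kpartW kbe) x xin; lia.
apply: lspan_gen; rewrite kbe /=.
by case: (b) hb b0 => //= x s ->.
Qed.

(** The converse of [block_span]: a short last block is padded with zeros, so that the exchange with
    a rectangle always meets a block of exact size k + 1 - r. *)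
Lemma Gk_decomp rho : kpart k rho -> (0 < head 0%N rho)%N -> exists b g,
  [/\ sorted geq b, size b = (k.+1 - head 0%N rho)%N, head 0%N b = head 0%N rho,
      kpart k g & [/\ (head 0%N g <= last 0%N b)%N, (size g < size rho)%N
      & Gk rho = bpart b (Gk g)]].
Proof.
move=> kr r0; set r := head 0%N rho; set q := (k.+1 - r)%N.
have rk : (r <= k)%N by case/andP: kr.
have q0 : (0 < q)%N by rewrite /q; lia.
have srt : sorted geq rho by case/andP: kr => /andP[].
have n0 : 0%N \notin rho by case/andP: kr => /andP[].
have gtr : transitive geq by move=> u v w uv vw; apply: leq_trans vw uv.
have rho0 : rho != [::] by rewrite /r in r0 *; case: (rho) r0.
case: (leqP q (size rho)) => szr.
  have szt : size (take q rho) = q by rewrite size_take_min; apply/minn_idPl.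
  have hdt : head 0%N (take q rho) = r.
    by rewrite /r; case: (rho) rho0 q0 => // x s _; case: (q).
  exists (take q rho), (drop q rho); split=> //.
  - exact: take_sorted.
  - have hdr : (head 0%N (drop q rho) <= k)%N.
      case E : (drop q rho) => [|x s] //=; apply: leq_trans rk.
      by apply: (kpart_le kr); apply: (@mem_drop q); rewrite E mem_head.
    rewrite /kpart hdr andbT /is_part drop_sorted //=.
    by apply: contra n0 => /mem_drop.
  split; last 1 first.
  - rewrite -{1}(cat_take_drop q rho) /Gk ksplit_block ?hdt ?szt //.
      by rewrite -size_eq0 szt -lt0n.
    rewrite cat_take_drop; apply/allP => x xin.
    by have /= := allP (kpartW kr) x xin; lia.
  - move: srt; rewrite -{1}(cat_take_drop q rho).
    case: (drop q rho) => [|x s] //.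
    case E : (take q rho) szt => [|y u] szt; first by rewrite -szt in q0.
    by rewrite /= cat_path /= => /and3P[_ + _].
  - by rewrite size_drop; lia.
exists (rho ++ nseq (q - size rho) 0%N), [::]; split=> //.
- case: (q - size rho)%N => [|z]; first by rewrite cats0.
  rewrite sorted_pairwise // pairwise_cat -!sorted_pairwise // srt sorted_nseq /= andbT.
  by apply/allrelP => x y _ yz; have [-> _] := nseqP (yz : y \in nseq z.+1 0%N).
- by rewrite size_cat size_nseq subnKC // ltnW.
- by rewrite /r; case: (rho) rho0.
split=> //; first by rewrite lt0n size_eq0.
rewrite bpart_zeros /Gk ksplit_last //; exact: ltnW.
Qed.
End SplitPolynomials.

(** * Rectangles and the k-Schur functions *)

Lemma kpart_catr k mu nu : kpart k (mu ++ nu) -> kpart k nu.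
Proof.
elim: mu => //= a s IH; rewrite /kpart is_part_cons => /andP[/and3P[_ ha pa] /= ak].
by apply: IH; rewrite /kpart pa (leq_trans ha ak).
Qed.

Lemma kpart_rect k l mu nu : (0 < l <= k)%N -> kpart k (mu ++ nu) ->
    (head 0%N nu <= l)%N -> (mu != [::] -> l < last 0%N mu)%N ->
  kpart k (mu ++ nseq (k + 1 - l) l ++ nu).
Proof.
case/andP=> l0 lk km nl; have -> : (k + 1 - l)%N = (k - l).+1 by lia.
have kR : kpart k (nseq (k - l).+1 l ++ nu).
  by apply: kpart_cat (kpart_catr km) _; rewrite ?sorted_nseq ?last_nseq_pos.
case: mu km => // a s km /(_ isT) ml; apply: kpart_cat kR _; last exact: ltnW.
- have /andP[/andP[+ _] _] := km; move/(take_sorted (size (a :: s))).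
  by rewrite take_size_cat.
- exact: leq_ltn_trans ml.
- by case/andP: km.
Qed.

Section Rectangle.
Variables (F : fieldType) (F0 : [pchar F] =i pred0) (t : F) (t0 : t != 0) (V : lmodType F).
Variable B : int -> V -> V.
Hypothesis Blin : forall n, linear (B n).
Hypothesis Bquad : forall m n f,
  B m (B n f) - t *: B (m + 1) (B (n - 1) f) =
  - (B (n - 1) (B (m + 1) f) - t *: B n (B m f)).
Variable vac : V.
Hypothesis B0vac : B 0 vac = vac.
Hypothesis Bneg_vac : forall n, B (Negz n) vac = 0.
Variables k l : nat.
Hypothesis lk : (0 < l <= k)%N.
Local Notation bword := (bword B).
Local Notation bpart := (bpart t B).
Local Notation Hword := (Hword B vac).
Local Notation Gk := (Gk t B vac k).
Local Notation R := (nseq (k + 1 - l) l).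

Lemma bpart_linear b : linear (bpart b).
Proof. by move=> x u v; rewrite !(bpartE t B) Eblk_linear. Qed.

Lemma rect_block g : lspan (fun e => kpart k e && (head 0%N e <= l)%N) Gk g ->
  lspan (fun e => kpart k e && (head 0%N e == l)) Gk (bpart R g).
Proof.
have h0 : (0 < k + 1 - l)%N by lia.
move=> hg; apply: (block_span t0 Blin B0vac Bneg_vac) => //.
- exact: sorted_nseq.
- by rewrite size_nseq; lia.
- exact: head_nseq_pos.
- by rewrite last_nseq_pos.
Qed.

(* A block with head r > l and B_R exchange into a combination of products of a
   block with head r and a block with head l. *)
Lemma rect_Gk rho : kpart k rho ->
  lspan (fun e => kpart k e && (head 0%N e == maxn l (head 0%N rho))) Gk (bpart R (Gk rho)).
Proof.
move: {2}(size rho) (leqnn (size rho)) => N; elim: N rho => [|N IH] rho rN kr.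
  have -> : rho = [::] by case: (rho) rN.
  by rewrite maxn0; apply: rect_block; apply: lspan_gen.
have [rl|lr] := leqP (head 0%N rho) l.
  by apply: rect_block; apply: lspan_gen; rewrite kr.
set r := head 0%N rho in lr *.
have rk : (r <= k)%N by case/andP: kr.
have r0 : (0 < r)%N by lia.
have [b [g [sb szb hb kg [hg sg ->]]]] := Gk_decomp t0 Blin B0vac Bneg_vac kr r0.
(* With m = k + 1 - r and n = r - l the rectangle has m + n rows, the block has m rows and first
   part l + n, as [exch_term_spec] demands. *)
have hE : (k + 1 - l = (k.+1 - r) + (r - l))%N by lia.
have hd : head 0%N b = (l + (r - l))%N by rewrite subnKC ?hb // ltnW.
have m0 : (0 < k.+1 - r)%N by lia.
have l0 : (0 < l)%N by lia.
have [c ->] : exists c : 'S_(k.+1 - r + (r - l)) -> F, bpart R (bpart b (Gk g)) =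
    \sum_(s : 'S_(k.+1 - r + (r - l))) c s *: exch_term t B l b s (Gk g).
  by rewrite hE; apply: exchange_bpart.
apply: lspan_sum => s _; apply: lspanZ.
have [->|[e [a [b' [-> [sa sza ha la] [sb' szb' hb'] H]]]]] :=
  exch_term_spec F0 t0 Blin Bquad sb szb hd m0 l0 s (Gk g); first exact: lspan0.
apply: lspanZ; have har : head 0%N a = r by rewrite ha subnKC // ltnW.
have rk' : (0 < r <= k)%N by rewrite r0.
(* If b ends at l or above, the whole rectangle moves inside and the induction applies to g.
   Otherwise [b'] has first part l and inherits the last part of b, so it may precede [Gk g], while
   a ends at l or above and may precede [b']. *)
case: leqP H => lb H.
  have [-> ->] := H; rewrite -hE; apply: block_span => //.
  apply: lspan_sub (IH g _ kg) => [x /andP[-> /eqP ->] /=|]; last by lia.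
  by rewrite geq_max lb.
apply: block_span => //.
apply: (lspan_sub (P := fun e => kpart k e && (head 0%N e == l))) => [x /andP[-> /eqP ->] //|].
apply: block_span => //; first by rewrite szb'; lia.
by apply: lspan_gen; rewrite kg H.
Qed.

Variable T : nat -> V -> V.
Hypothesis Tlin : forall j a f g, lspan (kpart k) Hword f -> lspan (kpart k) Hword g ->
  T j (a *: f + g) = a *: T j f + T j g.
Hypothesis TG : forall j rho, kpart k rho ->
  T j (Gk rho) = if head 0%N rho == j then Gk rho else 0.

Let GH f : lspan (kpart k) Gk f -> lspan (kpart k) Hword f.
Proof. exact: G_span_H. Qed.

Fixpoint ks (rho : seq nat) : V := if rho is r :: s then T r (B r%:Z (ks s)) else vac.

Lemma T_D j f g : lspan (kpart k) Gk f -> lspan (kpart k) Gk g -> T j (f + g) = T j f + T j g.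
Proof. by move=> hf hg; rewrite -[f]scale1r Tlin ?scale1r //; apply: GH. Qed.

Lemma T_0 j : T j 0 = 0.
Proof.
have := Tlin j (-1) (lspan0 _ _) (lspan0 _ _).
by rewrite scaler0 addr0 scaleN1r addNr.
Qed.

Lemma T_Z j a f : lspan (kpart k) Gk f -> T j (a *: f) = a *: T j f.
Proof.
by move=> hf; rewrite -[a *: f]addr0 Tlin ?T_0 ?addr0 //; [apply: GH | apply: lspan0].
Qed.

Lemma T_sum j (s : seq (F * seq nat)) : all (fun x => kpart k x.2) s ->
  T j (\sum_(x <- s) x.1 *: Gk x.2) = \sum_(x <- s | head 0%N x.2 == j) x.1 *: Gk x.2.
Proof.
elim: s => [_|x s IH /= /andP[kx ks']]; first by rewrite !big_nil T_0.
have hs : lspan (kpart k) Gk (\sum_(y <- s) y.1 *: Gk y.2) by exists s.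
rewrite !big_cons T_D //; last by apply: lspanZ; apply: lspan_gen.
rewrite T_Z ?TG ?IH //; last exact: lspan_gen.
by case: ifP; rewrite ?scaler0 ?add0r.
Qed.

Lemma T_span j f : lspan (kpart k) Gk f ->
  lspan (fun e => kpart k e && (head 0%N e == j)) Gk (T j f).
Proof.
move=> [s al ->]; rewrite T_sum //; rewrite big_seq_cond.
apply: lspan_sum => x /andP[xs hx]; apply: lspanZ; apply: lspan_gen.
by rewrite hx (allP al).
Qed.

Lemma T_id j f : lspan (fun e => kpart k e && (head 0%N e == j)) Gk f -> T j f = f.
Proof.
move=> [s al ->]; rewrite T_sum; last by apply: sub_all al => x /andP[].
by rewrite big_seq_cond [RHS]big_seq; apply: eq_bigl => x;
  case xs: (x \in s) => //=; have /andP[_ ->] := allP al x xs.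
Qed.

Lemma T_eq0 j f : lspan (fun e => kpart k e && (head 0%N e != j)) Gk f -> T j f = 0.
Proof.
move=> [s al ->]; rewrite T_sum; last by apply: sub_all al => x /andP[].
rewrite big_seq_cond big1 // => x /andP[xs hx].
by have /andP[_] := allP al x xs; rewrite hx.
Qed.

Lemma T_rest (j : nat) f : lspan (fun e => kpart k e && (j <= head 0%N e)%N) Gk f ->
  lspan (fun e => kpart k e && (j < head 0%N e)%N) Gk (f - T j f).
Proof.
move=> [s al ->]; rewrite T_sum; last by apply: sub_all al => x /andP[].
rewrite (bigID (fun x => head 0%N x.2 == j)) /= addrAC subrr add0r big_seq_cond.
apply: lspan_sum => x /andP[xs hx]; apply: lspanZ; apply: lspan_gen.
by have /andP[-> jx] := allP al x xs; rewrite ltn_neqAle jx eq_sym hx.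
Qed.

(** Both transition matrices between the H_rho and the G_rho never lower the first part, so upward
    closed conditions on it carry over. *)
Lemma head_HG (P : nat -> bool) f : (forall i j, (i <= j)%N -> P i -> P j) ->
  lspan (fun e => kpart k e && P (head 0%N e)) Hword f ->
  lspan (fun e => kpart k e && P (head 0%N e)) Gk f.
Proof.
move=> Pm; apply: lspan_trans => e /andP[ke Pe].
apply: lspan_sub (Hword_in_G F0 t0 Blin Bquad B0vac Bneg_vac ke) => x /and3P[-> _ hx] /=.
exact: Pm Pe.
Qed.

Lemma head_GH (P : nat -> bool) f : (forall i j, (i <= j)%N -> P i -> P j) ->
  lspan (fun e => kpart k e && P (head 0%N e)) Gk f ->
  lspan (fun e => kpart k e && P (head 0%N e)) Hword f.
Proof.
move=> Pm; apply: lspan_trans => e /andP[ke Pe]; rewrite -[Gk e](subrK (Hword e)).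
apply: lspanD; last by apply: lspan_gen; rewrite ke.
apply: lspan_sub (Gk_lower F0 Blin Bquad B0vac Bneg_vac ke) => x /and4P[-> _ hx _] /=.
exact: Pm Pe.
Qed.

Lemma B_spanG (c : nat) f : (c <= k)%N -> lspan (kpart k) Gk f ->
  lspan (fun e => kpart k e && (c <= head 0%N e)%N) Gk (B c%:Z f).
Proof.
move=> ck hf; apply: (head_HG (P := leq c)) => [i j ij ci|]; first exact: leq_trans ij.
have ck' : c%:Z <= k%:Z by lia.
apply: lspan_sub (B_span F0 Blin Bquad B0vac Bneg_vac ck' (GH hf)) => e /andP[ke ce].
by apply/andP; split.
Qed.

Lemma ks_span rho : kpart k rho ->
  lspan (fun e => kpart k e && (head 0%N e == head 0%N rho)) Gk (ks rho).
Proof.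
elim: rho => [_|r s IH]; first by apply: (@lspan_gen _ _ _ _ Gk [::]).
rewrite /kpart is_part_cons => /andP[/and3P[r0 sr ps] /= rk].
have ks' : kpart k s by rewrite /kpart ps; lia.
apply: T_span; apply: lspan_sub (B_spanG rk _) => [e /andP[] //|].
by apply: lspan_sub (IH ks') => e /andP[].
Qed.

Lemma T_rect r f : (l < r)%N ->
  lspan (fun e => kpart k e && (l < head 0%N e)%N) Gk f ->
  T r (bpart R f) = bpart R (T r f).
Proof.
move=> lr [s al ->]; elim: s al => [_|x s IH /= /andP[/andP[kx lx] al]].
  rewrite big_nil T_0; have := bpart_linear R (-1) 0 0.
  by rewrite scaler0 addr0 scaleN1r addNr => ->; rewrite T_0.
have al' : all (fun x => kpart k x.2) s by apply: sub_all al => y /andP[].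
have hs : lspan (kpart k) Gk (\sum_(y <- s) y.1 *: Gk y.2) by exists s.
have RG f' : lspan (kpart k) Gk f' -> lspan (kpart k) Gk (bpart R f').
  apply: (lspan_map (bpart_linear R)) => e ke.
  by apply: lspan_sub (rect_Gk ke) => y /andP[].
have Gx : lspan (kpart k) Gk (Gk x.2) by apply: lspan_gen.
rewrite !big_cons bpart_linear Tlin; try by apply: GH; apply: RG.
rewrite {}IH // Tlin; try exact: GH.
rewrite bpart_linear; congr (_ *: _ + _).
have := rect_Gk kx; rewrite (maxn_idPr (ltnW lx)) => hR; rewrite TG //.
case: eqP => [e|/eqP ne]; first by apply: T_id; rewrite -e.
rewrite T_eq0; last by apply: lspan_sub hR => y /andP[-> /eqP ->].
by have := bpart_linear R (-1) 0 0; rewrite scaler0 addr0 scaleN1r addNr.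
Qed.

Lemma ks_rect_step r rho : (l < r)%N -> kpart k (r :: rho) ->
  bpart R (ks (r :: rho)) = t ^+ (r - l) *: T r (B r%:Z (bpart R (ks rho))).
Proof.
move=> lr; rewrite /kpart is_part_cons => /andP[/and3P[r0 sr ps] /= rk].
have kr : kpart k rho by rewrite /kpart ps; lia.
have hk : lspan (kpart k) Gk (ks rho) by apply: lspan_sub (ks_span kr) => e /andP[].
rewrite -T_rect //; last first.
  by apply: lspan_sub (B_spanG rk hk) => e /andP[-> /=]; apply: leq_trans.
rewrite (rect_comm F0 Blin Bquad); last by lia.
apply: T_Z; apply: lspan_sub (B_spanG rk _) => [e /andP[] //|].
apply: (lspan_map (bpart_linear R)) hk => e ke.
by apply: lspan_sub (rect_Gk ke) => y /andP[].
Qed.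

Lemma iter_B_span i f : lspan (kpart k) Gk f ->
  lspan (fun e => kpart k e && (l <= head 0%N e)%N) Gk (iter i.+1 (B l%:Z) f).
Proof.
move=> hf; have lk' : (l <= k)%N by case/andP: lk.
elim: i => [|i IH] /=; first exact: B_spanG.
by apply: B_spanG => //; apply: lspan_sub IH => e /andP[].
Qed.

(* On the span of the G_rho with head at least l, f - T_l f lies in the span of
   those with head > l, which B_l preserves: T_l B_l f = T_l B_l T_l f. *)
Lemma ks_iter i nu : kpart k nu ->
  ks (nseq i.+1 l ++ nu) = T l (iter i.+1 (B l%:Z) (ks nu)).
Proof.
move=> kn; have hf : lspan (kpart k) Gk (ks nu) by apply: lspan_sub (ks_span kn) => e /andP[].
elim: i => [|i IH] //; rewrite -[LHS]/(T l (B l%:Z (ks (nseq i.+1 l ++ nu)))) IH.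
set f := iter i.+1 _ _; have hl := iter_B_span i hf; rewrite -/f in hl.
have fk : lspan (kpart k) Gk f by apply: lspan_sub hl => e /andP[].
have lk' : (l <= k)%N by case/andP: lk.
have Tf := T_rest hl; set w := f - T l f in Tf.
have BD u v : B l%:Z (u + v) = B l%:Z u + B l%:Z v.
  by have := Blin l%:Z 1 u v; rewrite !scale1r.
have wk : lspan (kpart k) Gk w by apply: lspan_sub Tf => e /andP[].
have Tk : lspan (kpart k) Gk (T l f) by apply: lspan_sub (T_span l fk) => e /andP[].
have Bk u : lspan (kpart k) Gk u -> lspan (kpart k) Gk (B l%:Z u).
  by move=> hu; apply: lspan_sub (B_spanG lk' hu) => e /andP[].
have Bw : T l (B l%:Z w) = 0.
  apply: T_eq0.
  apply: (lspan_sub (P := fun e => kpart k e && (l < head 0%N e)%N)).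
    by move=> e /andP[-> /= le]; rewrite gtn_eqF.
  apply: (head_HG (P := fun i => l < i)%N) => [a b ab la|]; first exact: leq_trans ab.
  apply: (B_span_gt F0 t0 Blin Bquad B0vac Bneg_vac).
  by apply: (head_GH (P := fun i => l < i)%N) => [a b ab la|]; first exact: leq_trans ab.
have -> : iter i.+2 (B l%:Z) (ks nu) = B l%:Z w + B l%:Z (T l f).
  by rewrite -BD /w subrK.
by rewrite T_D ?Bw ?add0r //; apply: Bk.
Qed.

(** Entry j of R is raised by at most k - l - j, so all indices stay bounded by k. The first changed
    entry exceeds l and forces first parts above l; the unchanged entries l in front of it preserve
    this by [B_span_gt]. *)
Lemma bword_lower r f : lspan (kpart k) Gk f ->
    lower_word (fun i => size (R : seq nat) - i.+1)%N (map Posz R) r ->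
  lspan (fun e => kpart k e && (l < head 0%N e)%N) Gk (bword r f).
Proof.
move=> hf [sz sm st [i [ih e lt]] le]; rewrite size_map size_nseq in sz ih le.
have rn j : (j < k + 1 - l)%N -> (map Posz R)`_j = l%:Z.
  by move=> jh; rewrite (nth_map 0%N) ?size_nseq // nth_nseq jh.
have rk x : x \in r -> x <= k%:Z.
  move=> /(nthP 0)[j jr <-]; rewrite sz in jr.
  by have := le j jr; rewrite rn //=; move: (r`_j) => y; lia.
apply: (head_HG (P := fun i => l < i)%N) => [a b ab la|]; first exact: leq_trans ab.
have rE : r = nseq i l%:Z ++ r`_i :: drop i.+1 r.
  rewrite -drop_nth ?sz // -{1}(cat_take_drop i r); congr (_ ++ _).
  apply: (@eq_from_nth _ 0); first by rewrite size_nseq size_take sz ih.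
  move=> j; rewrite size_take sz ih => ji; rewrite nth_take // nth_nseq ji e //.
  by rewrite rn //; lia.
rewrite rE bword_cat -[bword (_ :: _) f]/(B r`_i (bword (drop i.+1 r) f)).
have ri : r`_i <= k%:Z by apply: rk; rewrite mem_nth ?sz.
have hd : lspan (kpart k) Hword (bword (drop i.+1 r) f).
  apply: (bword_span F0 Blin Bquad B0vac Bneg_vac) (GH hf) => x /mem_drop; exact: rk.
rewrite rn // in lt.
have := B_span F0 Blin Bquad B0vac Bneg_vac ri hd; set X := B _ _ => hX.
have {}hX : lspan (fun e => kpart k e && (l < head 0%N e)%N) Hword X.
  by apply: lspan_sub hX => x /andP[kx lx]; apply/andP; split=> //; lia.
elim: i {ih e lt rE ri hd X} (X) hX => [|i IH] X hX //=.
by apply: (B_span_gt F0 t0 Blin Bquad B0vac Bneg_vac); apply: IH.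
Qed.

(* In the other words of the expansion of B_R the first index that changes is
   raised, so T_l kills their values: B_R f = T_l B_R f = T_l B_l ... B_l f. *)
Lemma ks_rect_base nu : kpart k nu -> (head 0%N nu <= l)%N ->
  bpart R (ks nu) = ks (R ++ nu).
Proof.
move=> kn nl; have hf : lspan (kpart k) Gk (ks nu) by apply: lspan_sub (ks_span kn) => e /andP[].
have hE : (k + 1 - l)%N = (k - l).+1 by lia.
have [cs csP csE] := bpart_expand t B R.
have wR : bword (map Posz R) (ks nu) = iter (k - l).+1 (B l%:Z) (ks nu).
  by rewrite map_nseq hE; elim: (k - l).+1 => //= n ->.
rewrite {2}hE ks_iter // -wR.
have TR : T l (bpart R (ks nu)) = bpart R (ks nu).
  apply: T_id; apply: (lspan_map (bpart_linear R)) (ks_span kn) => e /andP[ke /eqP he].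
  by have := rect_Gk ke; rewrite he (maxn_idPl nl).
rewrite -{1}TR csE T_D.
- rewrite [X in _ + X]T_eq0 ?addr0 //; apply: lspan_sum_seq => x /csP xl; apply: lspanZ.
  by apply: lspan_sub (bword_lower hf xl) => e /andP[-> /= le]; rewrite gtn_eqF.
- by rewrite wR; apply: lspan_sub (iter_B_span _ hf) => e /andP[].
- apply: lspan_sum_seq => x /csP xl; apply: lspanZ.
  by apply: lspan_sub (bword_lower hf xl) => e /andP[].
Qed.

Lemma ks_rect mu nu : kpart k (mu ++ nu) -> (head 0%N nu <= l)%N ->
    (mu != [::] -> (l < last 0%N mu)%N) ->
  bpart R (ks (mu ++ nu)) = t ^+ (sumn mu - size mu * l) *: ks (mu ++ R ++ nu).
Proof.
elim: mu => [|r mu IH] km nl ml; first by rewrite scale1r; apply: ks_rect_base.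
move: (km); rewrite /= /kpart is_part_cons => /andP[/and3P[r0 sr ps] /= rk].
have kmn : kpart k (mu ++ nu) by rewrite /kpart ps; lia.
have ml' : mu != [::] -> (l < last 0%N mu)%N by case: (mu) ml => //= a s; apply.
have bound : all (fun x => l < x)%N (r :: mu).
  have : sorted geq (r :: mu).
    have /andP[/andP[+ _] _] := km; move/(take_sorted (size (r :: mu))).
    by rewrite take_size_cat.
  have := ml isT; elim: (mu) (r) {IH km nl ml sr ps kmn ml' rk r0} => [|y s IHs] x /=.
    by rewrite andbT.
  by move=> ly /andP[yx sy]; have := IHs y ly sy => /= /andP[H ->]; rewrite H !andbT; apply: leq_trans yx.
have lr : (l < r)%N by case/andP: bound.
rewrite ks_rect_step // IH //.
have kR : kpart k (mu ++ R ++ nu) by apply: kpart_rect.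
have hk : lspan (kpart k) Gk (ks (mu ++ R ++ nu)) by apply: lspan_sub (ks_span kR) => e /andP[].
have -> : B r%:Z (t ^+ (sumn mu - size mu * l) *: ks (mu ++ R ++ nu)) =
    t ^+ (sumn mu - size mu * l) *: B r%:Z (ks (mu ++ R ++ nu)).
  exact: (bwordZ Blin [:: r%:Z]).
rewrite T_Z; last by apply: lspan_sub (B_spanG rk hk) => e /andP[].
rewrite scalerA -exprD; congr (_ ^+ _ *: _) => /=.
(* The exponents are truncated differences; they add only because every part of mu exceeds l. *)
have : (size mu * l <= sumn mu)%N.
  case/andP: bound => _; elim: (mu) {IH km ml sr ps kmn ml' kR hk} => //= a s IHs /andP[la /IHs].
  by rewrite mulSn; lia.
by rewrite mulSn; lia.
Qed.
End Rectangle.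

(** * Linear independence *)

Section Free.
Variables (F : fieldType) (V : lmodType F) (I : eqType).
Implicit Types (s : seq I) (X Y : I -> V).

Definition lfree s X := forall c : I -> F,
  \sum_(i <- s) c i *: X i = 0 -> forall i, i \in s -> c i = 0.

Lemma lspan_mem s X f : uniq s -> lspan (mem s) X f ->
  exists c : I -> F, f = \sum_(i <- s) c i *: X i.
Proof.
move=> us [r + ->]; elim: r => [_|[a j] r IH /= /andP[js al]].
  by exists (fun=> 0); rewrite big_nil big1 // => i _; rewrite scale0r.
have [c cE] := IH al; exists (fun i => a *+ (i == j) + c i).
rewrite big_cons cE; under [RHS]eq_bigr do rewrite scalerDl.
rewrite big_split /=; congr (_ + _).
rewrite (bigD1_seq j) //= eqxx big1 ?addr0 // => i /negPf ->.
by rewrite scale0r.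
Qed.

Lemma lfree_sub s s' X : uniq s -> uniq s' -> {subset s' <= s} -> lfree s X -> lfree s' X.
Proof.
move=> us us' sub fr c e0 i is'.
have pe : perm_eq [seq j <- s | j \in s'] s'.
  apply: uniq_perm => //; first exact: filter_uniq.
  by move=> j; rewrite mem_filter andb_idr // => /sub.
have := fr (fun j => if j \in s' then c j else 0) => /(_ _ i (sub _ is')).
rewrite is'; apply; rewrite -[RHS]e0 -(perm_big _ pe) /= big_filter [RHS]big_mkcond /=.
by apply: eq_bigr => j _; case: ifP; rewrite ?scale0r.
Qed.

(* The matrix expressing X in terms of Y is square and has independent rows, hence is invertible. *)
Lemma lfree_span s X Y : uniq s -> lfree s X ->
  (forall i, i \in s -> lspan (mem s) Y (X i)) -> lfree s Y.
Proof.
move=> us fX H; case: s us fX H => [|i0 s'] //; set s := i0 :: s' => us fX H.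
pose n := size s; pose e (i : 'I_n) := nth i0 s i.
have es i : e i \in s by apply: mem_nth.
have sumE (c : I -> F) (Z : I -> V) : \sum_(i <- s) c i *: Z i = \sum_(i < n) c (e i) *: Z (e i).
  by rewrite (big_nth i0) big_mkord.
have /fin_all_exists [M ME] : forall i : 'I_n, exists c : 'rV[F]_n, X (e i) = \sum_j c 0 j *: Y (e j).
  move=> i; have [c cE] := lspan_mem us (H _ (es i)).
  exists (\row_j c (e j)); rewrite cE sumE; apply: eq_bigr => j _; by rewrite mxE.
pose A : 'M[F]_n := \matrix_(i, j) M i 0 j.
have comb (u : 'rV[F]_n) : \sum_i u 0 i *: X (e i) = \sum_j (u *m A) 0 j *: Y (e j).
  under eq_bigr do rewrite ME scaler_sumr.
  rewrite exchange_big; apply: eq_bigr => j _ /=; rewrite mxE scaler_suml.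
  by apply: eq_bigr => i _; rewrite mxE scalerA.
have eidx i : index (e i) s = i by rewrite index_uniq.
have uX (u : 'rV[F]_n) : \sum_i u 0 i *: X (e i) = 0 -> u = 0.
  move=> u0; apply/rowP => i; rewrite mxE.
  have := fX (fun j => if insub (index j s) is Some k then u 0 k else 0).
  rewrite sumE => /(_ _ (e i) (es i)); rewrite eidx valK; apply; rewrite -[RHS]u0.
  by apply: eq_bigr => j _; rewrite eidx valK.
have Au : A \in unitmx.
  rewrite -row_free_unit -kermx_eq0; apply/eqP/row_matrixP => i; rewrite row0.
  apply: uX; rewrite comb.
  have -> : row i (kermx A) *m A = 0 by rewrite -row_mul mulmx_ker row0.
  by rewrite big1 // => j _; rewrite mxE scale0r.
move=> c; rewrite sumE => c0 i; pose u : 'rV[F]_n := \row_j c (e j).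
have v0 : u *m invmx A = 0.
  apply: uX; rewrite comb mulmxKV // -[RHS]c0.
  by apply: eq_bigr => j _; rewrite mxE.
have u0 : u = 0 by rewrite -(mulmxKV Au u) v0 mul0mx.
move=> /(nthP i0)[j jn <-]; have := congr1 (fun w : 'rV[F]_n => w 0 (Ordinal jn)) u0.
by rewrite !mxE.
Qed.

(** After equal indices are collected all coefficients vanish, also those selected by Q. This makes
    the projection onto part of a basis well defined. *)
Lemma lfree_proj (Q : pred I) X (r : seq (F * I)) s : uniq s -> lfree s X ->
    {subset [seq x.2 | x <- r] <= s} ->
  \sum_(x <- r) x.1 *: X x.2 = 0 -> \sum_(x <- r | Q x.2) x.1 *: X x.2 = 0.
Proof.
move=> us fX sub; pose c i := \sum_(x <- r | x.2 == i) x.1.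
have collect (Q' : pred I) : \sum_(x <- r | Q' x.2) x.1 *: X x.2 =
    \sum_(i <- s | Q' i) c i *: X i.
  transitivity (\sum_(x <- r | Q' x.2) \sum_(i <- s | Q' i && (x.2 == i)) x.1 *: X i).
    rewrite big_seq_cond [RHS]big_seq_cond; apply: eq_bigr => x /andP[xr Qx].
    have xs : x.2 \in s by apply: sub; apply: map_f.
    rewrite [RHS]big_mkcond (bigD1_seq x.2) //= Qx eqxx big1 ?addr0 // => i xi.
    by rewrite eq_sym (negPf xi) andbF.
  rewrite (exchange_big_dep Q') /=; last by move=> x i _ /andP[].
  apply: eq_bigr => i Qi; rewrite /c scaler_suml; apply: eq_bigl => x.
  by rewrite Qi /=; case: eqVneq => [->|]; rewrite ?Qi ?andbF.
have := collect xpredT; rewrite /= => -> c0; rewrite collect big_seq_cond big1 // => i /andP[is_ _].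
by rewrite (fX c c0 i is_) scale0r.
Qed.
End Free.

Lemma proj_exists (F : fieldType) (V : lmodType F) (I : Type) (P Q : I -> bool) (X : I -> V) :
    (forall r : seq (F * I), all (fun x => P x.2) r -> \sum_(x <- r) x.1 *: X x.2 = 0 ->
      \sum_(x <- r | Q x.2) x.1 *: X x.2 = 0) ->
  exists T : V -> V,
    [/\ forall a f g, lspan P X f -> lspan P X g -> T (a *: f + g) = a *: T f + T g,
        forall i, P i -> T (X i) = if Q i then X i else 0
      & forall f, ~ lspan P X f -> T f = 0].
Proof.
move=> H.
pose rep f r := all (fun x => P x.2) r /\ f = \sum_(x <- r) x.1 *: X x.2 :> V.
(* [S] chooses one representing combination for each vector of the span; the hypothesis makes the
   projection independent of this choice. *)
have [S SP] : exists S : V -> seq (F * I), forall f, lspan P X f -> rep f (S f).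
  have ex f : exists r, lspan P X f -> rep f r.
    case: (classic (lspan P X f)) => [[r Pr ->]|nf]; first by exists r; split.
    by exists [::] => /nf.
  exists (fun f => proj1_sig (constructive_indefinite_description _ (ex f))) => f.
  exact: (proj2_sig (constructive_indefinite_description _ (ex f))).
pose T f := if excluded_middle_informative (lspan P X f)
  then \sum_(x <- S f | Q x.2) x.1 *: X x.2 else 0.
have TE r : all (fun x => P x.2) r ->
    T (\sum_(x <- r) x.1 *: X x.2) = \sum_(x <- r | Q x.2) x.1 *: X x.2.
  rewrite /T => Pr; set f := \sum_(x <- r) _.
  have hf : lspan P X f by exists r.
  case: excluded_middle_informative => // hf' /=; have [PS SE] := SP f hf.
  have neg (Q' : I -> bool) : \sum_(x <- [seq (- x.1, x.2) | x <- r] | Q' x.2) x.1 *: X x.2 =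
      - \sum_(x <- r | Q' x.2) x.1 *: X x.2.
    by rewrite big_map -sumrN; apply: eq_bigr => x _; rewrite scaleNr.
  apply: subr0_eq; have := H (S f ++ [seq (- x.1, x.2) | x <- r]); rewrite !big_cat !neg /=; apply.
    rewrite all_cat PS all_map; exact: Pr.
  by have := neg xpredT; rewrite /= => ->; rewrite -SE subrr.
exists T; split; last by move=> f nf; rewrite /T; case: excluded_middle_informative.
  move=> a _ _ [r Pr ->] [r' Pr' ->]; rewrite !TE // !scaler_sumr.
  have sE (Q' : I -> bool) : \sum_(x <- [seq (a * x.1, x.2) | x <- r] | Q' x.2) x.1 *: X x.2 =
      \sum_(x <- r | Q' x.2) a *: (x.1 *: X x.2).
    by rewrite big_map; apply: eq_bigr => x _; rewrite scalerA.
  have := sE xpredT; rewrite /= => <-; rewrite -big_cat TE ?big_cat ?sE //=.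
  rewrite all_cat all_map Pr' andbT; exact: Pr.
move=> i Pi; have := TE [:: (1, i)]; rewrite /= Pi big_seq1 scale1r => ->//.
by rewrite big_mkcond big_seq1 scale1r.
Qed.

Fixpoint bounded_seqs (n w : nat) : seq (seq nat) :=
  if n is n'.+1 then [::] :: [seq r :: s | r <- iota 0 w.+1, s <- bounded_seqs n' w] else [:: [::]].

Lemma mem_bounded_seqs n w s : (size s <= n)%N -> all (fun r => r <= w)%N s ->
  s \in bounded_seqs n w.
Proof.
elim: n s => [|n IH] [|r s] // sn /andP[rw al].
rewrite inE; apply/orP; right; apply/allpairsP; exists (r, s).
by split; [by rewrite mem_iota ltnS | exact: IH | ].
Qed.

(** A bound on the weight instead of a fixed weight lets combinations of mixed weights lie over one
    finite list. *)
Definition parts (P : pred (seq nat)) (n : nat) : seq (seq nat) :=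
  [seq e <- undup (bounded_seqs n n) | [&& P e, is_part e & (sumn e <= n)%N]].

Lemma uniq_parts P n : uniq (parts P n).
Proof. by rewrite filter_uniq // undup_uniq. Qed.

Lemma mem_parts P n e : (e \in parts P n) = [&& P e, is_part e & (sumn e <= n)%N].
Proof.
rewrite mem_filter mem_undup andb_idr // => /and3P[_ pe].
have : all (fun r => 0 < r)%N e.
  by apply/allP => x xe; rewrite lt0n; apply: contraTneq pe => x0; rewrite /is_part -x0 xe andbF.
move=> al en; apply: mem_bounded_seqs.
  apply: leq_trans en; elim: e al {pe} => //= r s IH /andP[r0 /IH]; lia.
by elim: e al en {pe} => //= r s IH /andP[r0 al] en; rewrite IH //; lia.
Qed.

(** * Spanning products of power sums by words in the vertex operators *)

Section Words.
Variables (F : fieldType) (F0 : [pchar F] =i pred0) (A : comAlgType F).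
Variables (B : int -> A -> A) (h p : nat -> A) (c : nat -> F).
Hypothesis Blin : forall n, linear (B n).
Hypothesis h0 : h 0 = 1.
Hypothesis c0 : c 0 = 1.
Hypothesis B1 : forall n : nat, B n%:Z 1 = h n.
Hypothesis Bmul : forall (n : nat) m g,
  B m (h n * g) = \sum_(a < n.+1) c a *: (h (n - a) * B (m + a%:Z) g).
Hypothesis newton : forall n, n%:R *: h n = \sum_(i < n) p i.+1 * h (n - i.+1).
Local Notation word := (fun s => bword B s 1).
Local Notation words w := (lspan (fun s : seq int => isum s == w) word).

(** The rule for B_m (h_n g) is solved for its term a = 0, which is h_n B_m g since c_0 = 1; the
    other terms have a smaller n, and B_m is applied to a product of h_n with a shorter word. *)
Lemma mulh_words n w f : words w f -> words (w + n%:Z) (h n * f).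
Proof.
elim/ltn_ind: n w f => n IHn w f.
have hl : linear (fun g : A => h n * g) by move=> x u v; rewrite mulrDr scalerAr.
apply: (lspan_map hl) => s /eqP <- {w f}; elim: s => [|m s IH].
  rewrite mulr1 -B1; apply: (@lspan_gen _ _ _ _ word [:: n%:Z]).
  by rewrite isum_cons addrC.
have -> : h n * word (m :: s) = B m (h n * word s) -
    \sum_(a < n) c a.+1 *: (h (n - a.+1) * B (m + a.+1%:Z) (word s)).
  by rewrite Bmul big_ord_recl subn0 addr0 c0 scale1r addrK.
apply: lspanB.
  apply: (lspan_map (Blin m)) IH => s' /eqP ss'; apply: (@lspan_gen _ _ _ _ word (m :: s')).
  by rewrite !isum_cons ss' addrA.
apply: lspan_sum => a _; apply: lspanZ.
have -> : isum (m :: s) + n%:Z = isum (m + a.+1%:Z :: s) + (n - a.+1)%N%:Z.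
  by rewrite !isum_cons; have := ltn_ord a; lia.
apply: IHn; first by have := ltn_ord a; lia.
by apply: (@lspan_gen _ _ _ _ word (m + a.+1%:Z :: s)).
Qed.

(** Newton's identity expresses p_n through the complete functions and the p_i with i < n, to which
    induction applies. *)
Lemma mulp_words n w f : (0 < n)%N -> words w f -> words (w + n%:Z) (p n * f).
Proof.
elim/ltn_ind: n w f => -[//|n] IHn w f _ hf.
have -> : p n.+1 * f = n.+1%:R *: (h n.+1 * f) -
    \sum_(i < n) p i.+1 * (h (n - i) * f).
  rewrite scalerAl newton big_ord_recr /= subnn h0 mulr1 mulrDl mulr_suml addrAC.
  rewrite -[LHS]add0r; congr (_ + _); apply/esym/eqP; rewrite subr_eq0.
  by apply/eqP; apply: eq_bigr => i _; rewrite subSS mulrA.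
apply: lspanB; first by apply: lspanZ; apply: mulh_words.
apply: lspan_sum => i _.
have -> : w + n.+1%:Z = w + (n - i)%N%:Z + i.+1%:Z by have := ltn_ord i; lia.
by apply: IHn; [have := ltn_ord i; lia | | apply: mulh_words].
Qed.

Lemma prodp_words (e : seq nat) : 0%N \notin e -> words (sumn e)%:Z (\prod_(r <- e) p r).
Proof.
elim: e => [_|r e IH]; first by rewrite big_nil; apply: (@lspan_gen _ _ _ _ word [::]); rewrite /isum big_nil.
rewrite inE negb_or eq_sym -lt0n big_cons => /andP[r0 /IH he].
by rewrite /= addnC PoszD; apply: mulp_words.
Qed.

Variable t : F.
Hypothesis Bquad : forall m n f,
  B m (B n f) - t *: B (m + 1) (B (n - 1) f) =
  - (B (n - 1) (B (m + 1) f) - t *: B n (B m f)).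
Hypothesis Bneg : forall n, B (Negz n) 1 = 0.
Hypothesis pfree : forall n, lfree (parts xpredT n) (fun e => \prod_(r <- e) p r).

(* The products of the p_r are spanned by words, hence by as many H_rho. *)
Lemma Hword_free n : lfree (parts xpredT n) (Hword B 1).
Proof.
have B01 : B 0 1 = 1 by rewrite (B1 0).
apply: lfree_span (uniq_parts _ _) (@pfree n) _ => e; rewrite mem_parts => /and3P[_ pe en].
have n0 : 0%N \notin e by case/andP: pe.
apply: lspan_trans (prodp_words n0) => s /eqP sE.
pose K := (\sum_(x <- s) absz x)%N.
have sK x : x \in s -> x <= K%:Z.
  by move=> xs; have : (absz x <= K)%N; [rewrite /K (big_rem x) //= leq_addr | lia].
apply: lspan_sub (word_straighten F0 Blin Bquad B01 Bneg sK) => e' /and4P[/andP[pe' _]].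
by rewrite sE => /eqP se' _ _; rewrite /= mem_parts pe' /=; lia.
Qed.

Hypothesis t0 : t != 0.

Lemma Gk_free k n : lfree (parts (kpart k) n) (Gk t B 1 k).
Proof.
have B01 : B 0 1 = 1 by rewrite (B1 0).
apply: lfree_span (uniq_parts _ _) (lfree_sub _ _ _ (@Hword_free n)) _.
- exact: uniq_parts.
- exact: uniq_parts.
- by move=> e; rewrite !mem_parts => /and3P[_ -> ->].
move=> e; rewrite mem_parts => /and3P[ke pe en].
apply: lspan_sub (Hword_in_G F0 t0 Blin Bquad B01 Bneg ke) => e' /and3P[ke' /eqP se _].
by rewrite /= mem_parts ke' se en andbT /=; case/andP: ke'.
Qed.

Lemma Gk_proj k (Q : pred (seq nat)) (r : seq (F * seq nat)) : all (fun x => kpart k x.2) r ->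
  \sum_(x <- r) x.1 *: Gk t B 1 k x.2 = 0 -> \sum_(x <- r | Q x.2) x.1 *: Gk t B 1 k x.2 = 0.
Proof.
move=> kr; pose n := (\sum_(x <- r) sumn x.2)%N.
apply: (lfree_proj Q (uniq_parts (kpart k) n) (@Gk_free k n)) => e /mapP[x xr ->].
rewrite mem_parts; have kx := allP kr _ xr; rewrite kx /n (big_rem x) //= leq_addr andbT.
by case/andP: kx.
Qed.
End Words.

(** * Symmetric functions *)

Section Symmetric.
Variables (F : fieldType) (F0 : [pchar F] =i pred0).

Definition pmon (e : seq nat) : {cmonom nat} := foldr (fun r m => mmul (ucm r.-1) m) mone e.

Lemma prod_psum e : \prod_(r <- e) psum F r = << pmon e >>.
Proof.
elim: e => [|r e IH].
  by transitivity (1 : sym F); [apply: big_nil | rewrite mpolyC1E].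
transitivity (psum F r * \prod_(r <- e) psum F r); first by rewrite big_cons.
by transitivity (<< ucm r.-1 >> * << pmon e >> : sym F); [rewrite IH | apply: malgUM].
Qed.

Lemma pmonE e i : 0%N \notin e -> pmon e i = count_mem i.+1 e.
Proof.
elim: e => [_|r e IH]; first exact: cm1.
rewrite inE negb_or => /andP[r0 /IH /= <-].
transitivity (ucm r.-1 i + pmon e i)%N; first exact: cmM.
by rewrite cmU; case: r r0 => // r _ /=; rewrite eqSS.
Qed.

Lemma pmon_inj e e' : is_part e -> is_part e' -> pmon e = pmon e' -> e = e'.
Proof.
move=> /andP[se ne] /andP[se' ne'] ee; apply: (@sorted_eq _ geq) => //.
- by move=> u v w uv vw; apply: leq_trans vw uv.
- by move=> u v; rewrite /geq /= => H; apply/eqP; rewrite eqn_leq andbC.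
apply/allP => -[|i] _ /=; first by rewrite !(count_memPn _).
by rewrite -!pmonE ?ee.
Qed.

Lemma mcoeff_prod_psum e e' : is_part e -> is_part e' ->
  (\prod_(r <- e') psum F r)@_(pmon e) = (e' == e)%:R.
Proof.
move=> pe pe'; transitivity ((<< pmon e' >> : sym F)@_(pmon e)).
  exact: (congr1 (fun g : sym F => g@_(pmon e)) (prod_psum e')).
rewrite [LHS]mcoeffU; congr (_%:R); congr nat_of_bool.
by apply/eqP/eqP => [/pmon_inj -> | ->].
Qed.

Lemma psum_free n : lfree (parts xpredT n) (fun e => \prod_(r <- e) psum F r).
Proof.
move=> c c0 e en; have := congr1 (fun g : sym F => g@_(pmon e)) c0.
have -> : (0 : sym F)@_(pmon e) = 0 by apply: mcoeff0.
move=> <-; transitivity (\sum_(e' <- parts xpredT n) c e' * (\prod_(r <- e') psum F r)@_(pmon e)).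
  have pe : is_part e by move: en; rewrite mem_parts => /and3P[].
  rewrite (bigD1_seq e) ?uniq_parts //= mcoeff_prod_psum // eqxx mulr1 big1_seq ?addr0 //.
  move=> e' /andP[ne]; rewrite mem_parts => /and3P[_ pe' _].
  by rewrite mcoeff_prod_psum // (negPf ne) mulr0.
rewrite [RHS]raddf_sum; apply: eq_bigr => e' _; by rewrite [RHS]mcoeffZ.
Qed.

Variables (t : F) (t0 : t != 0).

Lemma Bop_mulhsym (n : nat) m g : Bop t m (hsym F n * g) =
  \sum_(a < n.+1) hcoef t a *: (hsym F (n - a) * Bop t (m + a%:Z) g).
Proof.
transitivity (\sum_(a < n.+1) hcoef t a *: (hsymz F (n%:Z - a%:Z) * Bop t (m + a%:Z) g)).
  have nn : (n%:Z < n.+1%:Z)%R by lia.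
  exact: (Bop_mulh F0 t m g nn).
apply: eq_bigr => a _; apply: congr1; apply: (congr1 (fun z => z * _)).
by rewrite subzn // -ltnS.
Qed.

Lemma Bop_vac : Bop t 0 1 = 1 :> sym F.
Proof. by transitivity (hsymz F 0); [apply: Bop1 | apply: hsym0]. Qed.

Lemma Bop_neg_vac n : Bop t (Negz n) 1 = 0 :> sym F.
Proof. exact: Bop1. Qed.

Lemma Top_exists k j : exists T, is_Top t k j T.
Proof.
have [|T [Tl TG T0]] := @proj_exists F (sym F) (seq nat) (kpart k)
    (fun e => head 0%N e == j) (Gk t (Bop t) 1 k).
  move=> r kr; apply: (@Gk_proj F F0 (sym F) (Bop t) (hsym F) (psum F) (hcoef t)
    (Bop_is_linear t) (hsym0 F) (erefl _) (fun n => Bop1 F0 t n%:Z) Bop_mulhsym (newton_hsym F0)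
    t (Bop_quadratic F0 t) Bop_neg_vac psum_free t0 k (fun e => head 0%N e == j) r kr).
have GH f : lspan (kpart k) (Gk t (Bop t) 1 k) f -> in_Lambdak t k f.
  exact: (G_span_H F0 (Bop_is_linear t) (Bop_quadratic F0 t) Bop_vac Bop_neg_vac).
have HG f : in_Lambdak t k f -> lspan (kpart k) (Gk t (Bop t) 1 k) f.
  exact: (H_span_G F0 t0 (Bop_is_linear t) (Bop_quadratic F0 t) Bop_vac Bop_neg_vac).
exists T; split; first by move=> a f g /HG hf /HG hg; apply: Tl.
  exact: TG.
by move=> f nf; apply: T0 => /GH.
Qed.
Lemma TopP k j : is_Top t k j (Top t k j).
Proof. exact: epsilon_spec (Top_exists k j). Qed.

Lemma kschurE k rho : kschur t k rho = ks (Bop t) 1 (Top t k) rho.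
Proof. by elim: rho => //= r rho ->. Qed.

Lemma kschur_rect k l mu nu : (0 < l <= k)%N -> kpart k (mu ++ nu) -> (head 0%N nu <= l)%N ->
    (mu != [::] -> l < last 0%N mu)%N ->
  Bpart t (nseq (k + 1 - l) l) (kschur t k (mu ++ nu)) =
  t ^+ (sumn mu - size mu * l) *: kschur t k (mu ++ nseq (k + 1 - l) l ++ nu).
Proof.
move=> lk km nl ml; rewrite !kschurE.
apply: (ks_rect F0 t0 (Bop_is_linear t) (Bop_quadratic F0 t) Bop_vac Bop_neg_vac lk) => //.
  by move=> j; case: (TopP k j).
by move=> j; case: (TopP k j).
Qed.
End Symmetric.

Lemma part_union_rect k l mu nu : (0 < l <= k)%N -> kpart k (mu ++ nu) ->
    (head 0%N nu <= l)%N -> (mu != [::] -> l < last 0%N mu)%N ->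
  part_union (nseq (k + 1 - l) l) (mu ++ nu) = mu ++ nseq (k + 1 - l) l ++ nu.
Proof.
move=> lk km nl ml; have /andP[/andP[sr _] _] := kpart_rect lk km nl ml.
apply: (@sorted_eq _ geq) => //.
- by move=> u v w uv vw; apply: leq_trans vw uv.
- by move=> u v; rewrite /geq /= => H; apply/eqP; rewrite eqn_leq andbC.
- by apply: sort_sorted => u v; apply: leq_total.
- by rewrite /part_union perm_sort perm_catCA.
Qed.

Lemma Qqt_char0 : [pchar Qqt] =i pred0.
Proof.
apply/pcharf0P => n; rewrite -(rmorph_nat (@tofrac _)) tofrac_eq0.
by rewrite -polyC_natr polyC_eq0 -polyC_natr polyC_eq0 Num.Theory.pnatr_eq0.
Qed.

Lemma tQ_neq0 : tQ != 0.
Proof. by rewrite tofrac_eq0 polyX_eq0. Qed.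

Theorem theorem3 (k l : nat) (mu nu : seq nat)
    (hk : (0 < k)%N) (hl : (1 <= l <= k)%N)
    (hmu : is_part mu) (hnu : is_part nu) (hmunu : is_part (mu ++ nu))
    (hbound : (head 0%N (mu ++ nu) <= k)%N)
    (hmul : mu != [::] -> (l < last 0%N mu)%N)
    (hnul : (head 0%N nu <= l)%N) :
  Bpart tQ (nseq (k + 1 - l) l) (kschur tQ k (mu ++ nu)) =
  tQ ^+ (sumn mu - size mu * l)
    *: kschur tQ k (part_union (nseq (k + 1 - l) l) (mu ++ nu)).
Proof.
have km : kpart k (mu ++ nu) by rewrite /kpart hmunu.
rewrite (part_union_rect hl km hnul hmul).
exact: (kschur_rect Qqt_char0 tQ_neq0 hl km hnul hmul).
Qed.
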